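(* Let $d \ge 2$ and let $G \le \mathrm{Aut}(\mathcal{T}_d)$ be a self-similar group. If $G$ is finitely presented, then $G$ embeds in a finitely presented simple group; that is, $G$ satisfies the Boone--Higman conjecture.
   Context: For $d\ge 2$, $\mathcal{T}_d$ is the rooted $d$-regular tree: its vertex set is the set $\{1,\dots,d\}^*$ of finite words over $\{1,\dots,d\}$, with root the empty word and an edge from $w$ to $wi$ for each word $w$ and each $i\in\{1,\dots,d\}$. $\mathrm{Aut}(\mathcal{T}_d)$ is its automorphism group (all automorphisms fix the root). There is an isomorphism $\mathrm{Aut}(\mathcal{T}_d)\to S_d\wr_d \mathrm{Aut}(\mathcal{T}_d)$, $g\mapsto \sigma(g_1,\dots,g_d)$, where $\sigma\in S_d$ is the permutation $g$ induces on the first letter of words and $g_i\in\mathrm{Aut}(\mathcal{T}_d)$ is defined by $g(iw)=\sigma(i)\,g_i(w)$ for all words $w$; the $g_i$ are the level-1 states of $g$. A subgroup $G\le\mathrm{Aut}(\mathcal{T}_d)$ is self-similar if all level-1 states of every $g\in G$ lie in $G$. A group is said to satisfy the Boone--Higman conjecture if it embeds in a finitely presented simple group. *)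

(* Defs.v *)
From mathcomp Require Import all_boot.
From Stdlib Require Import FunctionalExtensionality ProofIrrelevance.

Set Implicit Arguments.
Unset Strict Implicit.
Unset Printing Implicit Defensive.

Record group := Group {
  gcar :> Type;
  gmul : gcar -> gcar -> gcar;
  ginv : gcar -> gcar;
  gone : gcar;
  gmulA : forall x y z, gmul x (gmul y z) = gmul (gmul x y) z;
  gmul1 : forall x, gmul gone x = x;
  gmulV : forall x, gmul (ginv x) x = gone
}.
Arguments gmul {g}.
Arguments ginv {g}.
Arguments gone {g}.

Definition is_hom (G H : group) (phi : G -> H) : Prop :=
  forall x y, phi (gmul x y) = gmul (phi x) (phi y).

(* Words in n generators and their inverses: (i, false) = x_i, (i, true) = x_i^-1. *)
Definition gword (n : nat) := seq ('I_n * bool).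

Definition eval_word (H : group) (n : nat) (y : 'I_n -> H) (w : gword n) : H :=
  foldr (fun p acc => gmul (if p.2 then ginv (y p.1) else y p.1) acc) gone w.

(* G admits a finite presentation < x_0..x_{n-1} | R >: the x_i generate G,
   satisfy the relators R, and G has the universal property of the group
   defined by this presentation (any assignment of the generators in any
   group satisfying R extends to a homomorphism). *)
Definition finitely_presented (G : group) : Prop :=
  exists (n : nat) (x : 'I_n -> G) (R : seq (gword n)),
    (forall g : G, exists w, eval_word x w = g) /\
    (forall r, r \in R -> eval_word x r = gone) /\
    (forall (H : group) (y : 'I_n -> H),
        (forall r, r \in R -> eval_word y r = gone) ->
        exists phi : G -> H, is_hom phi /\ forall i, phi (x i) = y i).

Definition normal_subgroup (G : group) (N : G -> Prop) : Prop :=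
  [/\ N gone,
      (forall a b, N a -> N b -> N (gmul a b)),
      (forall a, N a -> N (ginv a)) &
      (forall a g, N a -> N (gmul (gmul (ginv g) a) g))].

Definition simple_group (G : group) : Prop :=
  (exists g : G, g <> gone) /\
  forall N : G -> Prop, normal_subgroup N ->
    (forall a, N a -> a = gone) \/ (forall a, N a).

Definition boone_higman (G : group) : Prop :=
  exists (S : group) (phi : G -> S),
    finitely_presented S /\ simple_group S /\ is_hom phi /\ injective phi.

Record is_subgroup (H : group) (P : H -> Prop) : Prop := IsSubgroup {
  sg1 : P gone;
  sgM : forall x y, P x -> P y -> P (gmul x y);
  sgV : forall x, P x -> P (ginv x)
}.

Section Sub.
Variables (H : group) (P : H -> Prop) (sP : is_subgroup P).

Definition sub_mul (a b : {x | P x}) : {x | P x} :=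
  exist _ (gmul (proj1_sig a) (proj1_sig b)) (sgM sP (proj2_sig a) (proj2_sig b)).
Definition sub_inv (a : {x | P x}) : {x | P x} :=
  exist _ (ginv (proj1_sig a)) (sgV sP (proj2_sig a)).
Definition sub_one : {x | P x} := exist _ gone (sg1 sP).

Lemma sub_eq (a b : {x | P x}) : proj1_sig a = proj1_sig b -> a = b.
Proof.
case: a b => [a pa] [b pb] /= e; subst b; f_equal; apply: proof_irrelevance.
Qed.

Lemma sub_mulA x y z : sub_mul x (sub_mul y z) = sub_mul (sub_mul x y) z.
Proof. by apply: sub_eq; rewrite /= gmulA. Qed.
Lemma sub_mul1 x : sub_mul sub_one x = x.
Proof. by apply: sub_eq; rewrite /= gmul1. Qed.
Lemma sub_mulV x : sub_mul (sub_inv x) x = sub_one.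
Proof. by apply: sub_eq; rewrite /= gmulV. Qed.

Definition subgroup_group : group :=
  Group sub_mulA sub_mul1 sub_mulV.
End Sub.

(* Vertices: finite words over {1..d}, encoded as seq 'I_d; edges w -- wi. *)
Definition tree_adj (d : nat) (u v : seq 'I_d) : Prop :=
  (exists i, v = rcons u i) \/ (exists i, u = rcons v i).

Record aut (d : nat) := Aut {
  afun : seq 'I_d -> seq 'I_d;
  ainv : seq 'I_d -> seq 'I_d;
  afunK : cancel afun ainv;
  ainvK : cancel ainv afun;
  aadj : forall u v, tree_adj u v <-> tree_adj (afun u) (afun v)
}.

Section AutGroup.
Variable d : nat.

Lemma aut_eq (a b : aut d) : afun a =1 afun b -> a = b.
Proof.
case: a b => f1 g1 K1 K1' A1 [f2 g2 K2 K2' A2] /= e.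
have ef : f1 = f2 by apply: functional_extensionality.
subst f2.
have eg : g1 = g2.
  apply: functional_extensionality => w.
  by rewrite -{1}(K2' w) K1.
subst g2; f_equal; apply: proof_irrelevance.
Qed.

Definition aut_mul (a b : aut d) : aut d.
Proof.
refine (@Aut d (fun w => afun a (afun b w)) (fun w => ainv b (ainv a w)) _ _ _).
- by move=> w; rewrite afunK afunK.
- by move=> w; rewrite ainvK ainvK.
- move=> u v; exact: (iff_trans (aadj b u v) (aadj a _ _)).
Defined.

Definition aut_inv (a : aut d) : aut d.
Proof.
refine (@Aut d (ainv a) (afun a) (ainvK a) (afunK a) _).
move=> u v; apply: iff_sym.
by have := aadj a (ainv a u) (ainv a v); rewrite !ainvK.
Defined.

Definition aut_one : aut d.
Proof.
refine (@Aut d id id (fun _ => erefl) (fun _ => erefl) _).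
by move=> u v.
Defined.

Lemma aut_mulA x y z : aut_mul x (aut_mul y z) = aut_mul (aut_mul x y) z.
Proof. by apply: aut_eq. Qed.
Lemma aut_mul1 x : aut_mul aut_one x = x.
Proof. by apply: aut_eq. Qed.
Lemma aut_mulV x : aut_mul (aut_inv x) x = aut_one.
Proof. by apply: aut_eq => w /=; rewrite afunK. Qed.

Definition Aut_T : group := Group aut_mulA aut_mul1 aut_mulV.
End AutGroup.

Definition self_similar (d : nat) (G : Aut_T d -> Prop) : Prop :=
  forall g : Aut_T d, G g -> forall i : 'I_d,
    exists (gi : Aut_T d) (j : 'I_d),
      G gi /\ forall w, afun g (i :: w) = j :: afun gi w.

(* Main.v *)
(* A self-similar group K on D letters acts on the Cantor set of D-ary streams; let V be the
   Roever-Nekrashevych group of all bijections which on every cone of some level replace a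
   prefix and apply an element of K to the tail.  We replace the given group G by K = G x G,
   acting on an even number D >= 6 of letters, with a wreath recursion chosen so that the last
   letter m is fixed with trivial state and no proper quotient of V sees K.

   Finite presentability.  Let A be the stabiliser in V of the point m m m ...  The complement
   of this point is the disjoint union of the cones c_0, c_1, ... of the "comb" m^a i (i < m),
   and every element of A is a fraction of splittings of the comb, up to a finitary labelled
   permutation of the cones.  This makes A the group of fractions of an Ore monoid, presented by
   the splittings lam_i, the adjacent transpositions tau_i and the labels kap; conjugation by
   lam_0 shifts indices, which reduces the presentation to a finite one.  Then V acts triply
   transitively on the orbit of m m m ..., with finitely presented point stabiliser A and
   finitely generated two-point stabiliser, and such a group is finitely presented.

   Simplicity.  A nontrivial normal subgroup contains the commutators of elements supported in
   a small cone, so all swaps of disjoint cones of that cone are congruent; as a swap is the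
   product of the D swaps of its subcones and D is even, all swaps lie in the subgroup, and with
   them lam_0 and, by the choice of the recursion, the labels. *)
Require Import Defs.
From mathcomp Require Import all_boot zify.
From Stdlib Require Import FunctionalExtensionality ProofIrrelevance ClassicalEpsilon.

Set Implicit Arguments.
Unset Strict Implicit.
Unset Printing Implicit Defensive.

(* Off the point m m m ... the cones of a partition can be indexed by the natural numbers, and
   splitting the cone 0 merely adds m to the later indices. Hence conjugation by [lam 0] is an index
   shift, as in Thompson's group F, and relations between large indices follow from those between
   small ones. This works only if the elements of A are label-free shifts near the point, which is
   why the last letter is fixed with trivial state.

   Simplicity meets a different obstacle. Modulo a nontrivial normal subgroup all swaps die, and a
   label becomes the product of its states; for a general G some labels could survive this. In G x G
   three new letters prevent it: there (g, h) has the states (1, g), (h, 1) and (1, h). For g = 1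
   the relation reads (1, h) = (h, 1)(1, h), so (h, 1) dies; then (g, 1) and its states at the old
   letters are dead, so the remaining state (1, g) dies too. The old letters, these three, the fixed
   last letter and one spare letter for odd d make D = d + 4 or d + 5, an even number. *)
Declare Scope grp_scope.
Delimit Scope grp_scope with grp.
Notation "x ** y" := (gmul x y) (at level 40, left associativity) : grp_scope.
Notation "x ^!" := (ginv x) (at level 2, format "x ^!") : grp_scope.
Open Scope grp_scope.

(** * Groups and words *)

Section GroupTheory.
Variable X : group.
Implicit Types x y z a b c l : X.

Lemma gmulI x y z : x ** y = x ** z -> y = z.
Proof. by move=> e; rewrite -(gmul1 y) -(gmulV x) -gmulA e gmulA gmulV gmul1. Qed.

Lemma gmulrV x : x ** x^! = gone.
Proof.
rewrite -(gmul1 (x ** x^!)) -{1}(gmulV (x^!)) -gmulA (gmulA (x^!) x) gmulV gmul1.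
exact: gmulV.
Qed.

Lemma gmulr1 x : x ** gone = x.
Proof. by rewrite -(gmulV x) gmulA gmulrV gmul1. Qed.

Lemma gmulK x y : y ** x ** x^! = y.
Proof. by rewrite -gmulA gmulrV gmulr1. Qed.

Lemma gmulKV x y : y ** x^! ** x = y.
Proof. by rewrite -gmulA gmulV gmulr1. Qed.

Lemma gmulIr x y z : y ** x = z ** x -> y = z.
Proof. by move=> e; rewrite -(gmulK x y) e gmulK. Qed.

Lemma ginv_uniq x y : x ** y = gone -> x^! = y.
Proof. by move=> e; apply: (@gmulI x); rewrite gmulrV e. Qed.

Lemma ginvK x : x^!^! = x.
Proof. by apply: ginv_uniq; rewrite gmulV. Qed.

Lemma ginvM x y : (x ** y)^! = y^! ** x^!.
Proof. by apply: ginv_uniq; rewrite gmulA gmulK gmulrV. Qed.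

Lemma ginv1 : (gone : X)^! = gone.
Proof. by apply: ginv_uniq; rewrite gmul1. Qed.

Definition gE := (ginvM, ginvK, ginv1, gmul1, gmulr1, gmulA, gmulK, gmulKV, gmulrV, gmulV).

(* [tk x a b] says that conjugation by [x] takes [a] to [b]. *)
Definition tk x a b := x ** a = b ** x.

Lemma tkE x a b : tk x a b -> b = x ** a ** x^!.
Proof. by rewrite /tk => ->; rewrite gmulK. Qed.

Lemma tk1 x : tk x gone gone.
Proof. by rewrite /tk !gE. Qed.

Lemma tkM x a b a' b' : tk x a b -> tk x a' b' -> tk x (a ** a') (b ** b').
Proof. by rewrite /tk => e e'; rewrite gmulA e -gmulA e' gmulA. Qed.

Lemma tkV x a b : tk x a b -> tk x (a^!) (b^!).
Proof. by move=> /tkE ->; rewrite /tk !gE. Qed.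

Lemma tk_sym x a b : tk x a b -> tk (x^!) b a.
Proof. by move=> /tkE ->; rewrite /tk !gE. Qed.

Lemma tk_comp x y a b c : tk x a b -> tk y b c -> tk (y ** x) a c.
Proof. by rewrite /tk => e e'; rewrite -gmulA e gmulA e' -gmulA. Qed.

Lemma tk_comm x a : tk x a a -> tk a x x.
Proof. by rewrite /tk => ->. Qed.

Lemma tk_uniq x a b b' : tk x a b -> tk x a b' -> b = b'.
Proof. by move=> /tkE -> /tkE ->. Qed.

(** As [b] is the conjugate of [a] by [l], the effect of [x] on [b] is determined by its effect on
    [l] and [a]. Together with [tk_shift] this carries relations from small indices to large
    ones. *)
Lemma tk_conj x l l' a a' b b' :
  tk x l l' -> tk l a b -> tk x a a' -> tk l' a' b' -> tk x b b'.
Proof.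
move=> h1 /tkE -> h2 /tkE ->.
by apply: tkM (tkV h1); apply: tkM h1 h2.
Qed.

Lemma tk_shift c x x' a a' b b' :
  tk c x x' -> tk c a a' -> tk c b b' -> tk x a b -> tk x' a' b'.
Proof. by move=> /tkE -> /tkE -> /tkE -> e; rewrite /tk !gE -(gmulA c x a) e !gE. Qed.

End GroupTheory.

Section Hom.
Variables (X H : group) (phi : X -> H).
Hypothesis phiM : is_hom phi.

Lemma hom1 : phi gone = gone.
Proof. by apply: (@gmulI _ (phi gone)); rewrite -phiM !gE. Qed.

Lemma homV x : phi (x^!) = (phi x)^!.
Proof. by symmetry; apply: ginv_uniq; rewrite -phiM gmulrV hom1. Qed.

End Hom.

(** Maps out of groups of fractions arise first as relations between an element and its possible
    values. The function obtained by choice is arbitrary outside [P], so multiplicativity is claimed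
    on [P] only. *)
Lemma hom_of_rel (X H : group) (P : X -> Prop) (Rl : X -> H -> Prop) :
  (forall a, P a -> exists h, Rl a h) ->
  (forall a b, P a -> P b -> P (a ** b)) ->
  (forall a b h k, Rl a h -> Rl b k -> Rl (a ** b) (h ** k)) ->
  (forall a h k, Rl a h -> Rl a k -> h = k) ->
  exists phi : X -> H, (forall a b, P a -> P b -> phi (a ** b) = phi a ** phi b) /\
    (forall a, P a -> Rl a (phi a)).
Proof.
move=> tot PM RM fn.
have ch a : exists h, P a -> Rl a h.
  case: (excluded_middle_informative (P a)) => [pa|na]; last by exists gone.
  by have [h hh] := tot a pa; exists h.
pose phi a := proj1_sig (constructive_indefinite_description _ (ch a)).
have phiP a : P a -> Rl a (phi a).
  by rewrite /phi; case: constructive_indefinite_description.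
exists phi; split=> // a b pa pb.
by apply: (fn (a ** b)); [apply/phiP/PM | apply: RM; apply: phiP].
Qed.

Section Words.
Variable I : Type.

Definition evalw (H : group) (y : I -> H) (w : seq (I * bool)) : H :=
  foldr (fun p acc => (if p.2 then (y p.1)^! else y p.1) ** acc) gone w.

Definition winv (w : seq (I * bool)) := rev [seq (p.1, ~~ p.2) | p <- w].

Lemma evalw_cat (H : group) (y : I -> H) u v : evalw y (u ++ v) = evalw y u ** evalw y v.
Proof. by elim: u => [|p u IH] /=; rewrite ?gmul1 // IH gmulA. Qed.

Lemma evalw_inv (H : group) (y : I -> H) w : evalw y (winv w) = (evalw y w)^!.
Proof.
elim: w => [|[i b] w IH] /=; first by rewrite /winv /= ginv1.
rewrite /winv /= rev_cons -cats1 evalw_cat -/(winv w) IH ginvM /= gmulr1.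
by case: b => //=; rewrite ginvK.
Qed.

Definition gen (H : group) (y : I -> H) (h : H) := exists w, evalw y w = h.

Lemma gen1 (H : group) (y : I -> H) : gen y gone.
Proof. by exists [::]. Qed.
Lemma genM (H : group) (y : I -> H) a b : gen y a -> gen y b -> gen y (a ** b).
Proof. by move=> [u <-] [v <-]; exists (u ++ v); rewrite evalw_cat. Qed.
Lemma genV (H : group) (y : I -> H) a : gen y a -> gen y (a^!).
Proof. by move=> [u <-]; exists (winv u); rewrite evalw_inv. Qed.
Lemma gen_gen (H : group) (y : I -> H) i : gen y (y i).
Proof. by exists [:: (i, false)]; rewrite /= gmulr1. Qed.

Lemma gen_ind (H : group) (y : I -> H) (Q : H -> Prop) :
  Q gone -> (forall a b, Q a -> Q b -> Q (a ** b)) -> (forall a, Q a -> Q (a^!)) ->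
  (forall i, Q (y i)) -> forall a, gen y a -> Q a.
Proof.
move=> q1 qM qV qy a [w <-]; elim: w => [|[i []] w IH] //=; apply: qM => //.
exact: qV.
Qed.

End Words.

Lemma evalw_map I J (f : I -> J) (H : group) (y : J -> H) w :
  evalw y [seq (f p.1, p.2) | p <- w] = evalw (y \o f) w.
Proof. by elim: w => [|p w IH] //=; rewrite IH. Qed.

Lemma evalw_hom I (X H : group) (P : X -> Prop) (phi : X -> H) (x : I -> X) :
  (forall a b, P a -> P b -> phi (a ** b) = phi a ** phi b) -> is_subgroup P ->
  (forall i, P (x i)) -> forall w, P (evalw x w) /\ phi (evalw x w) = evalw (phi \o x) w.
Proof.
move=> phiM [p1 pM pV] px.
have e1 : phi gone = gone by apply: (@gmulI _ (phi gone)); rewrite -phiM // !gE.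
have eV a : P a -> phi (a^!) = (phi a)^!.
  by move=> pa; symmetry; apply: ginv_uniq; rewrite -phiM ?gmulrV //; apply: pV.
elim=> [|[i b] w [pw IH]] //=.
have pi : P (if b then (x i)^! else x i) by case: b => //; apply: pV.
split; first exact: pM.
by rewrite phiM // IH; case: b pi => //= _; rewrite eV.
Qed.

(** * Finite systems of equations *)

(** The term is defined uniformly in all groups, and one word computes it everywhere. Relations can
    thus be stated as readable equations, from which [fin_eqs] recovers a finite list of
    relators. *)
Definition is_word I (T : forall H : group, (I -> H) -> H) :=
  exists w, forall H y, T H y = evalw y w.

Section Terms.
Variable I : Type.
Implicit Types T : forall H : group, (I -> H) -> H.

Lemma word_gen i : is_word (fun (H : group) (y : I -> H) => y i).
Proof. by exists [:: (i, false)] => H y; rewrite /= gmulr1. Qed.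
Lemma word_1 : is_word (fun (H : group) (y : I -> H) => gone).
Proof. by exists [::]. Qed.
Lemma word_M T T' : is_word T -> is_word T' -> is_word (fun H y => T H y ** T' H y).
Proof. by move=> [w e] [w' e']; exists (w ++ w') => H y; rewrite e e' evalw_cat. Qed.
Lemma word_V T : is_word T -> is_word (fun H y => (T H y)^!).
Proof. by move=> [w e]; exists (winv w) => H y; rewrite e evalw_inv. Qed.
End Terms.

Lemma word_evalw I J (T : forall H : group, (I -> H) -> J -> H) :
  (forall j, is_word (fun H y => T H y j)) ->
  forall w, is_word (fun H y => evalw (T H y) w).
Proof.
move=> h; elim=> [|[j b] w IH] /=; first exact: word_1.
by apply: word_M => //; case: b => //; apply: word_V.
Qed.

Definition fin_eqs (I : eqType) (E : forall H : group, (I -> H) -> Prop) :=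
  exists R : seq (seq (I * bool)), forall H y,
    E H y <-> (forall r, r \in R -> evalw y r = gone).

Section FinEqs.
Variable I : eqType.
Implicit Types E : forall H : group, (I -> H) -> Prop.

Lemma fin_eq (T T' : forall H : group, (I -> H) -> H) :
  is_word T -> is_word T' -> fin_eqs (fun H y => T H y = T' H y).
Proof.
move=> [w e] [w' e']; exists [:: w ++ winv w'] => H y; split.
  by move=> ee r; rewrite inE => /eqP ->; rewrite evalw_cat evalw_inv -e -e' ee gmulrV.
move=> /(_ _ (mem_head _ _)); rewrite evalw_cat evalw_inv -e -e' => ee.
by rewrite -(gmulKV (T' H y) (T H y)) ee gmul1.
Qed.

Lemma fin_tk (x a b : forall H : group, (I -> H) -> H) :
  is_word x -> is_word a -> is_word b -> fin_eqs (fun H y => tk (x H y) (a H y) (b H y)).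
Proof. by move=> *; apply: fin_eq; apply: word_M. Qed.

Lemma fin_and E E' : fin_eqs E -> fin_eqs E' -> fin_eqs (fun H y => E H y /\ E' H y).
Proof.
move=> [R e] [R' e']; exists (R ++ R') => H y; rewrite e e'; split.
  by move=> [h h'] r; rewrite mem_cat => /orP [/h|/h'].
by move=> h; split=> r hr; apply: h; rewrite mem_cat hr ?orbT.
Qed.

Lemma fin_cond (b : bool) E : fin_eqs E -> fin_eqs (fun H y => b -> E H y).
Proof.
case: b => [[R e]|_]; last by exists [::].
by exists R => H y; rewrite -e; split=> // h; apply: h.
Qed.

Lemma fin_bounded N (E : nat -> forall H : group, (I -> H) -> Prop) :
  (forall i, fin_eqs (E i)) -> fin_eqs (fun H y => forall i, i < N -> E i H y).
Proof.
move=> h; elim: N => [|N [R e]]; first by exists [::].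
have [R' e'] := h N; exists (R ++ R') => H y; split.
  move=> hE r; rewrite mem_cat => /orP [hr|hr].
    by apply: (proj1 (e H y)) => // i lti; apply: hE; apply: ltnW.
  by apply: (proj1 (e' H y)) => //; apply: hE.
move=> hr i; rewrite ltnS leq_eqVlt => /orP [/eqP ->|].
  by apply/e' => r rR; apply: hr; rewrite mem_cat rR orbT.
by move: i; apply/e => r rR; apply: hr; rewrite mem_cat rR.
Qed.

Lemma fin_seq (T : eqType) (s : seq T) (E : T -> forall H : group, (I -> H) -> Prop) :
  (forall i, fin_eqs (E i)) -> fin_eqs (fun H y => forall i, i \in s -> E i H y).
Proof.
move=> h; elim: s => [|x s [R e]]; first by exists [::].
have [R' e'] := h x; exists (R ++ R') => H y; split.
  move=> hE r; rewrite mem_cat => /orP [hr|hr].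
    by apply: (proj1 (e H y)) => // i si; apply: hE; rewrite inE si orbT.
  by apply: (proj1 (e' H y)) => //; apply: hE; rewrite mem_head.
move=> hr i; rewrite inE => /orP [/eqP ->|].
  by apply/e' => r rR; apply: hr; rewrite mem_cat rR orbT.
by move: i; apply/e => r rR; apply: hr; rewrite mem_cat rR.
Qed.

Lemma fin_fintype (J : finType) (E : J -> forall H : group, (I -> H) -> Prop) :
  (forall i, fin_eqs (E i)) -> fin_eqs (fun H y => forall i, E i H y).
Proof.
move=> h; have [R e] := fin_seq (enum J) h; exists R => H y; rewrite -e; split=> hE i.
  by move=> _; apply: hE.
by apply: hE; rewrite mem_enum.
Qed.

End FinEqs.

(* Finite presentability of the subgroup P of X, with homomorphisms defined on all of X
   but only required to be multiplicative on P. *)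
Definition fp_on (X : group) (P : X -> Prop) :=
  exists (I : finType) (x : I -> X) (E : forall H : group, (I -> H) -> Prop),
    [/\ fin_eqs E, forall i, P (x i), forall g, P g -> gen x g, E X x &
     forall H y, E H y -> exists phi : X -> H,
       (forall a b, P a -> P b -> phi (a ** b) = phi a ** phi b) /\
       forall i, phi (x i) = y i].

Lemma fp_on_of_fp (X : group) : finitely_presented X -> fp_on (fun _ : X => True).
Proof.
move=> [n [x [R [xg [xR xu]]]]].
exists 'I_n, x, (fun H y => forall r, r \in R -> evalw y r = gone); split=> //.
- by exists R.
- by move=> g _; apply: xg.
by move=> H y /xu [phi [hphi e]]; exists phi; split=> // a b _ _; apply: hphi.
Qed.

Lemma fp_of_fp_on (X : group) (P : X -> Prop) (sP : is_subgroup P) :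
  fp_on P -> finitely_presented (subgroup_group sP).
Proof.
move=> [I [x [E [[R eR] px xg xE xu]]]].
pose f (i : 'I_#|I|) : I := enum_val i.
pose r (w : seq (I * bool)) : gword #|I| := [seq (enum_rank p.1, p.2) | p <- w].
have er (H : group) (y : 'I_#|I| -> H) w :
    eval_word y (r w) = evalw (y \o enum_rank) w.
  by rewrite -evalw_map.
pose x' (i : 'I_#|I|) : subgroup_group sP := exist _ (x (f i)) (px (f i)).
have ex' w : proj1_sig (evalw (x' \o enum_rank) w) = evalw x w.
  elim: w => [|[i b] w IH] //=.
  by rewrite IH; case: b => /=; rewrite /f enum_rankK.
exists #|I|, x', [seq r w | w <- R]; split; [|split].
- move=> [g pg]; have [w ew] := xg g pg; exists (r w).
  by apply: sub_eq; rewrite er ex'.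
- move=> _ /mapP [w wR ->]; apply: sub_eq; rewrite er ex' /=.
  by apply: (proj1 (eR X x)).
move=> H y yR.
have [phi [phiM ephi]] : exists phi : X -> H,
    (forall a b, P a -> P b -> phi (a ** b) = phi a ** phi b) /\
    forall i, phi (x i) = (y \o enum_rank) i.
  by apply: xu; apply/eR => w wR; rewrite -er; apply: yR; apply: map_f.
exists (fun a => phi (proj1_sig a)); split.
  by move=> [a pa] [b pb] /=; apply: phiM.
by move=> i /=; rewrite ephi /= /f enum_valK.
Qed.

(** * Bijections of a type *)

Section Bij.
Variable T : Type.

Record bij := MkBij { bf : T -> T; bg : T -> T; bfK : cancel bf bg; bgK : cancel bg bf }.

Lemma bij_eq (a b : bij) : bf a =1 bf b -> a = b.
Proof.
case: a b => f1 g1 K1 K1' [f2 g2 K2 K2'] /= e.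
have ef : f1 = f2 by apply: functional_extensionality.
subst f2.
have eg : g1 = g2 by apply: functional_extensionality => w; rewrite -{1}(K2' w) K1.
subst g2; f_equal; apply: proof_irrelevance.
Qed.

Definition bij_mul (a b : bij) : bij.
Proof.
refine (@MkBij (bf a \o bf b) (bg b \o bg a) _ _) => w /=.
  by rewrite !bfK.
by rewrite !bgK.
Defined.
Definition bij_inv (a : bij) : bij := MkBij (bgK a) (bfK a).
Definition bij_one : bij := @MkBij id id (fun _ => erefl) (fun _ => erefl).

Lemma bij_mulA x y z : bij_mul x (bij_mul y z) = bij_mul (bij_mul x y) z.
Proof. exact: bij_eq. Qed.
Lemma bij_mul1 x : bij_mul bij_one x = x.
Proof. exact: bij_eq. Qed.
Lemma bij_mulV x : bij_mul (bij_inv x) x = bij_one.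
Proof. by apply: bij_eq => w /=; rewrite bfK. Qed.

Definition Bij : group := Defs.Group bij_mulA bij_mul1 bij_mulV.

Lemma Bij_eq (a b : Bij) : bf a =1 bf b -> a = b.
Proof. exact: bij_eq. Qed.

Lemma bf_inj (a : Bij) : injective (bf a).
Proof. exact: can_inj (bfK a). Qed.

Lemma bfM (a b : Bij) x : bf (a ** b) x = bf a (bf b x).
Proof. by []. Qed.
Lemma bf1 x : bf (gone : Bij) x = x.
Proof. by []. Qed.
Lemma bfVK (a : Bij) x : bf (a^!) (bf a x) = x.
Proof. exact: bfK. Qed.
Lemma bfKV (a : Bij) x : bf a (bf (a^!) x) = x.
Proof. exact: bgK. Qed.

End Bij.

(** * Finitary permutations of the natural numbers *)

Definition tp (i j : nat) := if j == i then i.+1 else if j == i.+1 then i else j.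

Lemma tpP i j : [\/ j = i /\ tp i j = i.+1, j = i.+1 /\ tp i j = i |
  [/\ j <> i, j <> i.+1 & tp i j = j]].
Proof.
rewrite /tp; case: (j =P i) => [->|h1]; first by constructor 1.
by case: (j =P i.+1) => [->|h2]; [constructor 2 | constructor 3].
Qed.

Lemma tpK i : involutive (tp i).
Proof.
move=> j; case: (tpP i j) => [[-> ->]|[-> ->]|[h1 h2 e]].
- by rewrite /tp; case: (_ =P i) => [|_]; [lia | rewrite eqxx].
- by rewrite /tp eqxx.
by rewrite !e.
Qed.

Definition pwt (w : seq nat) j := foldr tp j w.

Lemma pwt_cat u v j : pwt (u ++ v) j = pwt u (pwt v j).
Proof. exact: foldr_cat. Qed.

Lemma pwtK w : cancel (pwt w) (pwt (rev w)).
Proof.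
elim: w => [|i w IH] j //=.
by rewrite rev_cons -cats1 pwt_cat /= tpK IH.
Qed.

Lemma pwtKV w : cancel (pwt (rev w)) (pwt w).
Proof. by move=> j; rewrite -{1}(revK w) pwtK. Qed.

Lemma pwt_inj w : injective (pwt w).
Proof. exact: can_inj (pwtK w). Qed.

Lemma pwt_large n w j : all (fun i => i < n) w -> n < j -> pwt w j = j.
Proof.
elim: w => [|i w IH] //= /andP [hi hw] hj; rewrite (IH hw hj).
by case: (tpP i j) => [[? _]|[? _]|[_ _ ->]] //; lia.
Qed.

Lemma pwt_small o w j : all (fun i => o <= i) w -> j < o -> pwt w j = j.
Proof.
elim: w => [|i w IH] //= /andP [hi hw] hj; rewrite (IH hw hj).
by case: (tpP i j) => [[? _]|[? _]|[_ _ ->]] //; lia.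
Qed.

(** This run stands for $\tau_{k+r-1}\cdots\tau_k$, a cycle carrying k to k + r. The runs with k + r
    = n + 1 serve as coset representatives in [coset_form]. *)
Fixpoint cd k r := if r is r'.+1 then (k + r') :: cd k r' else [::].

Lemma cd_rcons k r : cd k r.+1 = rcons (cd k.+1 r) k.
Proof.
elim: r => [|r IH]; first by rewrite /= addn0.
by rewrite [LHS]/= -[_ :: cd k r]/(cd k r.+1) IH /= addnS addSn.
Qed.

Lemma pwt_cd k r : pwt (cd k r) k = k + r.
Proof.
elim: r => [|r IH] /=; first by rewrite addn0.
by rewrite IH /tp eqxx addnS.
Qed.

Lemma all_cd_ge k r : all (fun i => k <= i) (cd k r).
Proof. by elim: r => //= r ->; rewrite leq_addr. Qed.

Lemma all_cd_lt k r : all (fun i => i < k + r) (cd k r).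
Proof.
elim: r => //= r IH; rewrite addnS ltnS leqnn /=.
by apply: sub_all IH => i; lia.
Qed.

(** Induction on [n]: composing [f] with the inverse of a descending cycle from the preimage of [n]
    to [n] makes it fix [n]. The bound [o] is kept because elements that are trivial on the first
    cones must later be written with generators of index at least [o]. *)
Lemma perm_word o n (f g : nat -> nat) : cancel f g -> cancel g f ->
  (forall j, j < o -> f j = j) -> (forall j, n <= j -> f j = j) ->
  exists w, all (fun i => o <= i) w /\ f =1 pwt w.
Proof.
elim: n f g => [|n IH] f g fK gK fo fn; first by exists [::]; split=> // j; apply: fn.
set k := g n.
have fk : f k = n by rewrite /k gK.
have kn : k <= n.
  by rewrite leqNgt; apply/negP => h; have := fn k h; rewrite fk; lia.
have ok : (o <= k) || (k == n).
  case: (leqP o k) => //= h; have := fo k h; rewrite fk => ->; exact: eqxx.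
pose c := cd k (n - k).
have hc : pwt c k = n by rewrite pwt_cd subnKC.
have co : all (fun i => o <= i) c.
  case/orP: ok => [h|/eqP e]; last by rewrite /c e subnn.
  by apply: sub_all (all_cd_ge _ _) => i; apply: leq_trans.
have cn j : n < j -> pwt c j = j.
  by move=> h; apply: (@pwt_large n) => //; rewrite -{1}(subnKC kn); apply: all_cd_lt.
have cn' j : n < j -> pwt (rev c) j = j by move=> h; rewrite -{1}(cn j h) pwtK.
have co' j : j < o -> pwt (rev c) j = j.
  by move=> h; rewrite -{1}(pwt_small co h) pwtK.
have [] := IH (f \o pwt (rev c)) (pwt c \o g).
- by move=> j /=; rewrite fK pwtKV.
- by move=> j /=; rewrite pwtK gK.
- by move=> j h /=; rewrite co' // fo.
- move=> j; rewrite leq_eqVlt => /orP [/eqP <-|h] /=; last by rewrite cn' // fn.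
  by rewrite -{1}hc pwtK.
move=> w [wo ew]; exists (w ++ c); split; first by rewrite all_cat wo.
by move=> j; rewrite pwt_cat -ew /= pwtK.
Qed.

(** * Coxeter relations and the finitary symmetric group *)

Section Coxeter.
Variables (H : group) (tau : nat -> H).

Definition evt (w : seq nat) : H := foldr (fun i acc => tau i ** acc) gone w.

Lemma evt_cat u v : evt (u ++ v) = evt u ** evt v.
Proof. by elim: u => [|i u IH] /=; rewrite ?gmul1 // IH gmulA. Qed.

Record Cox : Prop := {
  cox2 : forall i, tau i ** tau i = gone;
  coxB : forall i, tau i ** tau i.+1 ** tau i = tau i.+1 ** tau i ** tau i.+1;
  coxC : forall i j, i.+1 < j -> tk (tau i) (tau j) (tau j) }.

Hypothesis cox : Cox.

Lemma cox_comm i j : i.+1 < j \/ j.+1 < i -> tau i ** tau j = tau j ** tau i.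
Proof. by case=> [/(coxC cox)|/(coxC cox)]. Qed.

Lemma evt_rev w : evt (rev w) = (evt w)^!.
Proof.
elim: w => [|i w IH] /=; first by rewrite ginv1.
rewrite rev_cons -cats1 evt_cat IH /= gmulr1 ginvM; congr (_ ** _).
by symmetry; apply: ginv_uniq; rewrite cox2.
Qed.

Lemma evt_comm x w : (forall i, i \in w -> tk x (tau i) (tau i)) -> tk x (evt w) (evt w).
Proof.
elim: w => [|i w IH] h /=; first exact: tk1.
apply: tkM; first by apply: h; rewrite mem_head.
by apply: IH => j jw; apply: h; rewrite inE jw orbT.
Qed.

Lemma cd_tau_lt k r j : j.+1 < k -> evt (cd k r) ** tau j = tau j ** evt (cd k r).
Proof.
move=> h; symmetry; apply: evt_comm => i /(allP (all_cd_ge k r)) hi.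
by apply: coxC => //; apply: leq_trans hi.
Qed.

Lemma cd_tau_pred k r : evt (cd k.+1 r) ** tau k = evt (cd k r.+1).
Proof. by rewrite cd_rcons -cats1 evt_cat /= gmulr1. Qed.

Lemma cd_tau_eq k r : evt (cd k r.+1) ** tau k = evt (cd k.+1 r).
Proof. by rewrite -cd_tau_pred -gmulA cox2 // gmulr1. Qed.

Lemma cd_tau_mid k r j : k < j < k + r ->
  evt (cd k r) ** tau j = tau j.-1 ** evt (cd k r).
Proof.
elim: r => [|r IH]; first by move=> ?; lia.
move=> /andP [kj jr] /=.
case: (ltnP j (k + r)) => h.
  rewrite -gmulA IH ?kj // !gmulA; congr (_ ** _).
  by apply: cox_comm; lia.
have -> : j = k + r by lia.
case: r {IH} h jr => [|r] h jr; first by lia.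
rewrite /= addnS /= !gmulA.
rewrite -gmulA (_ : evt (cd k r) ** _ = tau (k + r).+1 ** evt (cd k r)).
  by rewrite !gmulA (coxB cox).
symmetry; apply: evt_comm => i /(allP (all_cd_lt k r)) hi.
by apply: cox_comm; lia.
Qed.

End Coxeter.

Definition tauN i : Bij nat := MkBij (tpK i) (tpK i).

Lemma tauN_cox : Cox tauN.
Proof.
split=> [i|i|i j h]; apply: Bij_eq => x; first exact: tpK.
  by rewrite /= /tp; do !case: eqP => //=; lia.
by rewrite /tk /= /tp; do !case: eqP => //=; lia.
Qed.

Lemma evt_tauN w j : bf (evt tauN w) j = pwt w j.
Proof. by elim: w => //= i w ->. Qed.

(** One more transposition on the right either slides through the descending run, keeping its index
    or losing one, or it lengthens or shortens the run. The new word and [k] are chosen before the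
    group, so that the same decomposition can be read in [H] and in the permutations of the natural
    numbers. *)
Lemma coset_form n w : all (fun i => i < n.+1) w ->
  exists w' k, [/\ all (fun i => i < n) w', k <= n.+1 &
    forall (H : group) (tau : nat -> H), Cox tau ->
      evt tau w = evt tau w' ** evt tau (cd k (n.+1 - k))].
Proof.
elim/last_ind: w => [|w j IH].
  by exists [::], n.+1; split=> // L t _; rewrite subnn /= gmul1.
rewrite all_rcons => /andP [hj /IH [w' [k [hw' hk e]]]] {IH}.
have {}e (H : group) (tau : nat -> H) : Cox tau ->
    evt tau (rcons w j) = evt tau w' ** (evt tau (cd k (n.+1 - k)) ** tau j).
  by move=> c; rewrite -cats1 evt_cat e //= gmulr1 gmulA.
case: (ltngtP j.+1 k) => h.
- exists (rcons w' j), k; split=> //; first by rewrite all_rcons hw' andbT; lia.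
  by move=> H tau c; rewrite e // cd_tau_lt // -cats1 evt_cat /= gmulr1 gmulA.
- case: (j =P k) => [jk|jk].
    subst j; exists w', k.+1; split=> //.
    move=> H tau c; rewrite e //; congr (_ ** _).
    by rewrite subSS -cd_tau_eq // -subSn.
  exists (rcons w' j.-1), k; split=> //; first by rewrite all_rcons hw' andbT; lia.
  move=> H tau c; rewrite e // cd_tau_mid //; last by rewrite subnKC //; lia.
  by rewrite -cats1 evt_cat /= gmulr1 gmulA.
subst k; exists w', j; split=> //; first by lia.
move=> H tau c; rewrite e //; congr (_ ** _).
by rewrite cd_tau_pred subSS -subSn.
Qed.

Theorem cox_faithful (H : group) (tau : nat -> H) w :
  Cox tau -> (forall j, pwt w j = j) -> evt tau w = gone.
Proof.
move=> c; have [n hn] : exists n, all (fun i => i < n) w.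
  exists (\max_(i <- w) i).+1; apply/allP => i iw; rewrite ltnS.
  by rewrite (big_rem _ iw) /= leq_maxl.
elim: n w hn => [|n IH] w hn hw; first by case: w hn {hw}.
have [w' [k [hw' hk e]]] := coset_form hn.
have ep j : pwt w j = pwt w' (pwt (cd k (n.+1 - k)) j).
  by rewrite -pwt_cat -!evt_tauN (e _ _ tauN_cox) evt_cat.
(* As a permutation, the decomposed word sends [k] to [n.+1], which [w'] fixes. Since [w] acts
   trivially, the run must be empty. *)
have kn : k = n.+1.
  have := ep k; rewrite pwt_cd subnKC // (pwt_large hw') // hw //.
rewrite e // kn subnn /= gmulr1; apply: IH => // j.
by rewrite -[RHS]hw ep kn subnn.
Qed.

(** * Self-similar groups *)

Fixpoint actw (K : group) d (kp : K -> 'I_d -> 'I_d) (ks : K -> 'I_d -> K) (g : K)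
    (u : seq 'I_d) : seq 'I_d :=
  if u is i :: u' then kp g i :: actw kp ks (ks g i) u' else [::].

(* A faithful self-similar group on m + 1 letters whose wreath recursion is trivial at
   the last letter: [kp g] is the permutation of the letters, [ks g i] the state at [i]. *)
Record selfsim (m : nat) := SelfSim {
  sgrp :> group;
  kp : sgrp -> 'I_m.+1 -> 'I_m.+1;
  ks : sgrp -> 'I_m.+1 -> sgrp;
  kp1 : forall i, kp gone i = i;
  ks1 : forall i, ks gone i = gone;
  kpM : forall g h i, kp (g ** h) i = kp g (kp h i);
  ksM : forall g h i, ks (g ** h) i = ks g (kp h i) ** ks h i;
  kp_last : forall g, kp g ord_max = ord_max;
  ks_last : forall g, ks g ord_max = gone;
  kfaithful : forall g, (forall u, actw kp ks g u = u) -> g = gone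
}.

(** * Finitary labelled permutations *)

Section Labelled.
Variables (m : nat) (K : selfsim m).

(* [Tau i] swaps the indices i and i + 1, [Kap i g] puts the label g on the index i.  A word
   acts from the left, so its last atom acts first: it sends the index j to [pw w j] and
   collects the label [lb w j] on the way. *)
Inductive atom := Tau of nat | Kap of nat & K.

Definition pwa (a : atom) j := if a is Tau i then tp i j else j.
Definition lba (a : atom) j : K := if a is Kap i g then (if j == i then g else gone) else gone.
Definition pw (w : seq atom) j := foldr pwa j w.
Fixpoint lb (w : seq atom) j : K :=
  if w is a :: w' then lba a (pw w' j) ** lb w' j else gone.

Lemma pw_cat u v j : pw (u ++ v) j = pw u (pw v j).
Proof. exact: foldr_cat. Qed.

Lemma lb_cat u v j : lb (u ++ v) j = lb u (pw v j) ** lb v j.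
Proof. by elim: u => [|a u IH] /=; rewrite ?gmul1 // IH pw_cat gmulA. Qed.

Definition ainv (a : atom) := if a is Kap i g then Kap i (g^!) else a.
Definition pwinv (w : seq atom) := rev (map ainv w).

Lemma pwaK a : cancel (pwa a) (pwa (ainv a)).
Proof. by case: a => //= i; apply: tpK. Qed.

Lemma pwK w : cancel (pw w) (pw (pwinv w)).
Proof.
elim: w => [|a w IH] j //=.
by rewrite /pwinv /= rev_cons -cats1 pw_cat /= pwaK -/(pwinv w) IH.
Qed.

Lemma ainvK : involutive ainv.
Proof. by case=> //= i g; rewrite ginvK. Qed.

Lemma pwinvK : involutive pwinv.
Proof. by move=> w; rewrite /pwinv map_rev revK mapK //; apply: ainvK. Qed.

Lemma pwKV w : cancel (pw (pwinv w)) (pw w).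
Proof. by move=> j; rewrite -{1}(pwinvK w) pwK. Qed.

Lemma pw_inj w : injective (pw w).
Proof. exact: can_inj (pwK w). Qed.

Lemma lb_invK w j : lb (pwinv w) (pw w j) ** lb w j = gone.
Proof.
elim: w => [|a w IH] /=; first by rewrite gmul1.
rewrite /pwinv /= rev_cons -cats1 lb_cat /= pwaK -/(pwinv w) gmulr1.
have -> : lba (ainv a) (pwa a (pw w j)) = (lba a (pw w j))^!.
  by case: a => [i|i g] /=; rewrite ?ginv1 //; case: eqP; rewrite ?ginv1.
by rewrite !gE.
Qed.

Lemma lb_pwinv w j : lb (pwinv w) j = (lb w (pw (pwinv w) j))^!.
Proof.
have := lb_invK w (pw (pwinv w) j); rewrite pwKV => /ginv_uniq <-.
by rewrite ginvK.
Qed.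

Definition weq (w w' : seq atom) := pw w =1 pw w' /\ lb w =1 lb w'.

Definition taus (w : seq atom) := pmap (fun a => if a is Tau i then Some i else None) w.

Lemma pw_taus w j : pwt (taus w) j = pw w j.
Proof. by elim: w => //= [[i|i g]] w IH //=; rewrite IH. Qed.

Definition amin o (a : atom) := match a with Tau i => o <= i | Kap i _ => o <= i end.

Lemma labelled_word o n (f g : nat -> nat) (l : nat -> K) :
  cancel f g -> cancel g f ->
  (forall j, j < o -> f j = j /\ l j = gone) -> (forall j, n <= j -> f j = j /\ l j = gone) ->
  exists w, [/\ all (amin o) w, pw w =1 f & lb w =1 l].
Proof.
move=> fK gK fo fn.
have [w [wo ew]] := @perm_word o n f g fK gK (fun j h => (fo j h).1) (fun j h => (fn j h).1).
have pT u j : pw (map Tau u) j = pwt u j by elim: u => //= i u ->.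
have lT u j : lb (map Tau u) j = gone by elim: u => //= i u ->; rewrite gmul1.
pose ks r := [seq Kap i (l i) | i <- iota o r].
have pk r j : pw (ks r) j = j by rewrite /ks; elim: (iota o r) => //= i s ->.
have lk r j : lb (ks r) j = if o <= j < o + r then l j else gone.
  rewrite /ks; elim: r => [|r IH]; first by rewrite /=; case: ifP => //; lia.
  rewrite -addn1 iotaD map_cat lb_cat /= gmulr1 IH; case: (j =P o + r) => [->|h].
    by rewrite leq_addr ltnn addnA addn1 ltnSn gmul1.
  by rewrite gmulr1 (_ : (o <= j < o + (r + 1)) = (o <= j < o + r)) //; lia.
exists (map Tau w ++ ks (n - o)); split.
- rewrite all_cat !all_map; apply/andP; split=> //.
  by apply/allP => i /=; rewrite mem_iota => /andP [].
- by move=> j; rewrite pw_cat pk pT ew.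
move=> j; rewrite lb_cat pk lT gmul1 lk; case: ifP => // h.
case: (ltnP j o) => ho; first by have [_ ->] := fo j ho.
by have [|_ ->] := fn j; [lia|].
Qed.

Section Eval.
Variables (H : group) (tau : nat -> H) (kap : K -> H).

Fixpoint kapi i (g : K) : H :=
  if i is i'.+1 then tau i' ** kapi i' g ** tau i' else kap g.

Definition eva (a : atom) := match a with Tau i => tau i | Kap i g => kapi i g end.
Definition ev (w : seq atom) := foldr (fun a acc => eva a ** acc) gone w.

Lemma ev_cat u v : ev (u ++ v) = ev u ** ev v.
Proof. by elim: u => [|i u IH] /=; rewrite ?gmul1 // IH gmulA. Qed.

(** A presentation of the restricted wreath product of [K] with the finitary symmetric group, in
    which only labels at the index 0 are generators; [ev_weq] shows that these relations suffice. *)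
Record labelled_rels : Prop := {
  lr_cox :> Cox tau;
  lr_hom : is_hom kap;
  lr_tau : forall g j, 0 < j -> tk (kap g) (tau j) (tau j);
  lr_kap : forall g h, tk (kap g) (kapi 1 h) (kapi 1 h) }.

Hypothesis rel : labelled_rels.

Lemma kapi_hom i : is_hom (kapi i).
Proof.
elim: i => [|i IH] g h /=; first exact: (lr_hom rel).
by rewrite IH !gmulA -(gmulA _ (tau i) (tau i)) (cox2 rel) gmulr1.
Qed.

Lemma tau_kapi j i g : tk (tau j) (kapi i g) (kapi (tp j i) g).
Proof.
have big : forall i j, i < j -> tk (tau j) (kapi i g) (kapi i g).
  elim=> [|i' IH] j' h; first by apply: tk_comm; apply: (lr_tau rel).
  have c : tk (tau j') (tau i') (tau i') by apply: tk_comm; apply: (coxC rel).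
  by apply: (tkM _ c); apply: (tkM c); apply: IH; lia.
case: (tpP j i) => [[-> ->]|[-> ->]|[h1 h2 ->]].
- by rewrite /tk /= -gmulA (cox2 rel) gmulr1.
- by rewrite /tk /= !gmulA (cox2 rel) gmul1.
case: (ltnP i j) => h; first exact: big.
have {h h1 h2} : j.+1 < i by lia.
elim: i => [|i IH] //; rewrite ltnS leq_eqVlt => /orP [/eqP <-|h] /=.
  (* The base case i = j + 2: a braid relation turns [tau j] into [tau j.+1], which passes
     [kapi j g], and the braid relation turns it back on the other side. *)
  have c : tk (tau j.+1) (kapi j g) (kapi j g) by apply: big.
  rewrite /tk !gmulA (coxB rel) -(gmulA (tau j.+1 ** tau j)) c !gmulA.
  set P := _ ** kapi j g.
  by rewrite -2!(gmulA P) -(coxB rel) !gmulA.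
have c : tk (tau j) (tau i) (tau i) by apply: (coxC rel).
by apply: (tkM _ c); apply: (tkM c); apply: IH.
Qed.

Lemma kapi_comm i j g h : i <> j -> tk (kapi i g) (kapi j h) (kapi j h).
Proof.
wlog lt : i j g h / i < j.
  move=> W ne; case: (ltngtP i j) => // lt; first exact: W.
  by apply: tk_comm; apply: W => // e; apply: ne.
move=> _.
have h0 : forall j, 0 < j -> tk (kapi 0 g) (kapi j h) (kapi j h).
  case=> // j' _; elim: j' => [|j' IH]; first exact: (lr_kap rel).
  have c : tk (kapi 0 g) (tau j'.+1) (tau j'.+1) by apply: (lr_tau rel).
  by apply: (tkM _ c); apply: (tkM c IH).
elim: i lt => [|i IH] lt; first exact: h0.
have c : tk (tau i) (kapi j h) (kapi j h).
  by have := tau_kapi i j h; case: (tpP i j) => [[? _]|[? _]|[_ _ ->]] //; lia.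
have c' : tk (tau i) (kapi i g) (kapi i.+1 g).
  by have := tau_kapi i i g; rewrite /tp eqxx.
by apply: (tk_shift c' c c); apply: IH; lia.
Qed.

Lemma evt_kapi w j g : tk (evt tau w) (kapi j g) (kapi (pwt w j) g).
Proof.
elim: w => [|i w IH] /=; first by rewrite /tk !gE.
by apply: (tk_comp IH); apply: tau_kapi.
Qed.

Fixpoint kprod B (l : nat -> K) : H :=
  if B is B'.+1 then kprod B' l ** kapi B' (l B') else gone.

Lemma eq_kprod B l l' : (forall j, j < B -> l j = l' j) -> kprod B l = kprod B l'.
Proof.
elim: B => //= B IH h; rewrite IH ?h // => j hj; apply: h; exact: ltnW.
Qed.

Lemma kprod_comm B l i g : B <= i -> tk (kapi i g) (kprod B l) (kprod B l).
Proof.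
elim: B => [|B IH] h /=; first exact: tk1.
by apply: tkM; [apply: IH; lia | apply: kapi_comm; lia].
Qed.

Lemma kprod_mul B l i g : i < B ->
  kapi i g ** kprod B l = kprod B (fun j => if j == i then g ** l j else l j).
Proof.
elim: B => //= B IH; rewrite ltnS leq_eqVlt => /orP [/eqP ->|h].
  rewrite eqxx kapi_hom !gmulA kprod_comm //; congr (_ ** _ ** _).
  by apply: eq_kprod => j hj; case: eqP => //; lia.
by rewrite gmulA IH //; case: eqP => //; lia.
Qed.

Lemma kprod1 B l : (forall j, l j = gone) -> kprod B l = gone.
Proof.
move=> h; elim: B => //= B ->; rewrite h gmul1; exact: (hom1 (@kapi_hom B)).
Qed.

Definition abnd B (a : atom) := match a with Tau i => i.+1 < B | Kap i _ => i < B end.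

(** Labels can be carried to the right through the transpositions, which only change their indices.
    What remains is a word in the [tau i], governed by the Coxeter relations, and a product
    determined by the label function. *)
Lemma ev_normal B w : all (abnd B) w -> ev w = evt tau (taus w) ** kprod B (lb w).
Proof.
elim: w => [|a w IH] /=; first by move=> _; rewrite kprod1 // gmul1.
move=> /andP [ha hw]; rewrite (IH hw) {IH}; case: a ha => [i|i g] /= hi.
  by rewrite gmulA; congr (_ ** _); apply: eq_kprod => j _; rewrite gmul1.
set j := pwt (rev (taus w)) i.
have ej : pwt (taus w) j = i by rewrite /j pwtKV.
have jB : j < B.
  have wB : all (fun k => k < B.-1) (taus w).
    elim: w hw {j ej} => //= [[k|k h]] w IH /= /andP [hk /IH hw] //=.
    by rewrite hw andbT; lia.
  case: (ltnP j B) => // h.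
  have := @pwt_large B.-1 _ j wB; rewrite ej; lia.
have c := evt_kapi (taus w) j g; rewrite ej in c.
rewrite gmulA -c -gmulA kprod_mul //; congr (_ ** _).
apply: eq_kprod => k _; rewrite -pw_taus.
case: eqP => [->|h]; first by rewrite ej eqxx.
by case: eqP => [h'|]; rewrite ?gmul1 //; case: h; apply: (@pwt_inj (taus w)); rewrite ej.
Qed.

Lemma abnd_ex w : exists B, all (abnd B) w.
Proof.
elim: w => [|a w [B hB]]; first by exists 0.
pose C := match a with Tau i => i.+2 | Kap i _ => i.+1 end.
exists (maxn B C); rewrite /=; apply/andP; split.
  by case: a @C => [i|i g] /=; rewrite leq_max leqnn orbT.
by apply: sub_all hB => -[i|i g] /=; rewrite leq_max => ->.
Qed.

Lemma abnd_mono B B' w : B <= B' -> all (abnd B) w -> all (abnd B') w.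
Proof. by move=> h; apply: sub_all => -[i|i g] /= hi; apply: leq_trans h. Qed.

Theorem ev_weq w w' : weq w w' -> ev w = ev w'.
Proof.
move=> [ep el].
have [B hB] := abnd_ex w; have [B' hB'] := abnd_ex w'.
rewrite (ev_normal (abnd_mono (leq_maxl B B') hB)).
rewrite (ev_normal (abnd_mono (leq_maxr B B') hB')).
rewrite (eq_kprod (fun j _ => el j)); congr (_ ** _).
apply: (@gmulI _ (evt tau (rev (taus w')))); rewrite -!evt_cat.
rewrite !(cox_faithful rel) // => j; rewrite pwt_cat; first exact: pwtK.
by rewrite pw_taus ep -pw_taus pwtK.
Qed.

End Eval.
End Labelled.

(** * Splitting relations *)

Ltac casel := repeat match goal with |- context [if ?b then _ else _] =>
  lazymatch b with context [if _ then _ else _] => fail | _ => destruct b eqn:? end end;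
  try lia.

Lemma pwt_iota j r x : pwt (iota j r) x =
  if x == j + r then j else if j <= x < j + r then x.+1 else x.
Proof.
elim: r j x => [|r IH] j x /=; first by casel.
by rewrite IH /tp; casel.
Qed.

Lemma pwt_rev_iota j r x : pwt (rev (iota j r)) x =
  if x == j then j + r else if j < x <= j + r then x.-1 else x.
Proof.
apply: (@pwt_inj (iota j r)); rewrite pwtKV pwt_iota; casel.
Qed.

Section Splitting.
Variables (m : nat) (K : selfsim m).
Hypothesis m_gt0 : 0 < m.

(* Position of the index l after index i has been split into i, ..., i + m. *)
Definition dl i l := if l < i then l else l + m.

(* [isexp w i w']: w' describes w after splitting its i-th source cone. *)
Definition isexp (w : seq (atom K)) i (w' : seq (atom K)) :=
  (forall l, l <> i -> pw w' (dl i l) = dl (pw w i) (pw w l) /\ lb w' (dl i l) = lb w l) /\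
  (forall k : 'I_m.+1, pw w' (i + k) = pw w i + kp (lb w i) k /\
                       lb w' (i + k) = ks (lb w i) k).

Lemma dlP i x : (exists2 l, l <> i & x = dl i l) \/ (exists k : 'I_m.+1, x = i + k).
Proof.
rewrite /dl; case: (ltnP x i) => h; first by left; exists x; rewrite ?h //; lia.
case: (ltnP x (i + m.+1)) => h'.
  have hk : x - i < m.+1 by lia.
  by right; exists (Ordinal hk); rewrite /= subnKC.
by left; exists (x - m); [lia | case: ltnP; lia].
Qed.

Lemma isexp_uniq w i w1 w2 : isexp w i w1 -> isexp w i w2 -> weq w1 w2.
Proof.
move=> [a1 b1] [a2 b2]; split=> x; case: (dlP i x) => [[l hl ->]|[k ->]].
- by rewrite (a1 l hl).1 (a2 l hl).1.
- by rewrite (b1 k).1 (b2 k).1.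
- by rewrite (a1 l hl).2 (a2 l hl).2.
by rewrite (b1 k).2 (b2 k).2.
Qed.

Lemma isexp_weq w w2 i w' : weq w w2 -> isexp w i w' -> isexp w2 i w'.
Proof.
move=> [ep el] [a b]; split=> [l hl|k]; first by rewrite -!ep -el; apply: a.
by rewrite -ep -el; apply: b.
Qed.

Lemma isexp_cat u v i u' v' :
  isexp v i v' -> isexp u (pw v i) u' -> isexp (u ++ v) i (u' ++ v').
Proof.
move=> [av bv] [au bu]; split=> [l hl|k].
  have [e1 e2] := av l hl.
  have [|e3 e4] := au (pw v l); first by move=> e; apply: hl; apply: (@pw_inj _ _ v).
  by rewrite !pw_cat !lb_cat e1 e2 e3 e4.
have [e1 e2] := bv k; have [e3 e4] := bu (kp (lb v i) k).
by rewrite !pw_cat !lb_cat e1 e2 e3 e4 kpM ksM.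
Qed.

Lemma isexp_nil i : isexp [::] i [::].
Proof. by split=> [l hl|k] //=; rewrite kp1 ks1. Qed.

Lemma pw_Tau u j : pw (map (@Tau _ K) u) j = pwt u j.
Proof. by elim: u => //= i u ->. Qed.
Lemma lb_Tau u j : lb (map (@Tau _ K) u) j = gone.
Proof. by elim: u => //= i u ->; rewrite gmul1. Qed.

(** If one of the two cones being swapped is split, all its children must pass the other cone:
    [iota j m.+1] moves a block of m + 1 indices one place to the right and its right neighbour to
    the front. *)
Definition tau_exp j i : seq nat :=
  if i < j then [:: j + m] else if i == j then iota j m.+1
  else if i == j.+1 then rev (iota j m.+1) else [:: j].

Lemma isexp_Tau j i : isexp [:: Tau K j] i (map (@Tau _ K) (tau_exp j i)).
Proof.
split=> [l hl|k]; rewrite !pw_Tau !lb_Tau /= ?gmul1 ?kp1 ?ks1; split=> //.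
  rewrite /tau_exp; case: (ltnP i j) => h1; first by rewrite /= /tp /dl; casel.
  case: eqP => h2; first by subst i; rewrite pwt_iota /tp /dl; casel.
  case: eqP => h3; first by subst i; rewrite pwt_rev_iota /tp /dl; casel.
  by rewrite /= /tp /dl; casel.
have hk := ltn_ord k.
rewrite /tau_exp; case: (ltnP i j) => h1; first by rewrite /= /tp; casel.
case: eqP => h2; first by subst i; rewrite pwt_iota /tp eqxx; casel.
case: eqP => h3; first by subst i; rewrite pwt_rev_iota /tp; casel.
by rewrite /= /tp; casel.
Qed.

Lemma isexp_Kap0 (g : K) i : 0 < i -> isexp [:: Kap 0 g] i [:: Kap 0 g].
Proof.
move=> hi; split=> [l hl|k] /=.
  by split=> //; rewrite !gmulr1 /dl; casel.
by do !case: eqP; try lia; rewrite !gmulr1 kp1 ks1.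
Qed.

Lemma isexp_Kap0_ex (g : K) : exists w', isexp [:: Kap 0 g] 0 w'.
Proof.
pose f (h : K) x := if x < m.+1 then nat_of_ord (kp h (inord x)) else x.
have fK h h' : h' ** h = gone -> cancel (f h) (f h').
  move=> e x; rewrite /f; case: (ltnP x m.+1) => hx; last by rewrite ltnNge hx.
  by rewrite ltn_ord inord_val -kpM e kp1 inordK.
have [||//||w' [_ e1 e2]] :=
  @labelled_word m K 0 m.+1 (f g) (f (g^!)) (fun x => if x < m.+1 then ks g (inord x) else gone).
- by apply: fK; rewrite gmulV.
- by apply: fK; rewrite gmulrV.
- by move=> j hj; rewrite /f (ltnNge j) hj.
exists w'; split=> [l hl|k]; rewrite e1 e2 /f /=.
  rewrite /dl /= (_ : (l + m < m.+1) = false); last by lia.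
  by case: eqP => [/hl|_] //; rewrite gmulr1.
by rewrite ltn_ord inord_val gmulr1.
Qed.

Lemma weq_kapS j (g : K) : weq ([:: Tau K j] ++ [:: Kap j g] ++ [:: Tau K j]) [:: Kap j.+1 g].
Proof.
split=> x /=; first exact: tpK.
rewrite !gmulr1 !gmul1; case: (tpP j x) => [[-> ->]|[-> ->]|[h1 h2 ->]].
- by casel.
- by rewrite !eqxx.
by casel.
Qed.

Lemma isexp_exists w i : exists w', isexp w i w'.
Proof.
have cat u v i0 : (exists v', isexp v i0 v') -> (exists u', isexp u (pw v i0) u') ->
    exists w', isexp (u ++ v) i0 w'.
  by move=> [v' hv] [u' hu]; exists (u' ++ v'); apply: isexp_cat.
have hT j i0 : exists w', isexp [:: Tau K j] i0 w' by eexists; apply: isexp_Tau.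
elim: w i => [|a w IH] i; first by exists [::]; apply: isexp_nil.
apply: (cat [:: a]) => //; move: (pw w i) => {i IH}i.
case: a => // j g; elim: j i => [|j IH] i.
  by case: i => [|i]; [apply: isexp_Kap0_ex | exists [:: Kap 0 g]; apply: isexp_Kap0].
have [|w' hw'] := @cat [:: Tau K j] ([:: Kap j g] ++ [:: Tau K j]) i _ (hT _ _).
  by apply: cat.
by exists w'; apply: isexp_weq hw'; apply: weq_kapS.
Qed.

(** * From the finite system to all splitting relations *)

Section Eval.
Variables (H : group) (lam tau : nat -> H) (kap : K -> H).

Record split_rels : Prop := {
  sr_lab :> labelled_rels tau kap;
  sr_lam : forall i j, i < j -> tk (lam i) (lam j) (lam (j + m));
  sr_exp : forall w i w', isexp w i w' ->
    lam (pw w i) ** ev tau kap w = ev tau kap w' ** lam i }.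

Variables (J : Type) (x : J -> K).

(* A finite set of instances of the splitting relations, apart from the first two families,
   which may serve as definitions of the generators of large index. *)
Record base_rels : Prop := {
  br_lam0 : forall j, 0 < j -> tk (lam 0) (lam j) (lam (j + m));
  br_tau0 : forall j, 0 < j -> tk (lam 0) (tau j) (tau (j + m));
  br_lam : forall i j, 0 < i -> i <= m -> i < j -> j <= i + m.+1 ->
    tk (lam i) (lam j) (lam (j + m));
  br_tau : forall i j, 0 < i -> i <= m -> i < j -> j <= i + m.+1 ->
    tk (lam i) (tau j) (tau (j + m));
  br_taulam : forall i j, i <= m -> i.+1 < j -> j <= i + m.+2 -> tk (tau i) (lam j) (lam j);
  br_comm : forall i j, i <= m -> i.+1 < j -> j <= i + m.+2 -> tk (tau i) (tau j) (tau j);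
  br_2 : forall i, i <= m -> tau i ** tau i = gone;
  br_braid : forall i, i <= m -> tau i ** tau i.+1 ** tau i = tau i.+1 ** tau i ** tau i.+1;
  br_block : forall j, j <= m -> lam j.+1 ** tau j = evt tau (iota j m.+1) ** lam j;
  br_hom : is_hom kap;
  br_kaptau : forall k j, 0 < j -> j <= m.+1 -> tk (kap (x k)) (tau j) (tau j);
  br_kaplam : forall k j, 0 < j -> j <= m.+1 -> tk (kap (x k)) (lam j) (lam j);
  br_kap : forall k l, tk (kap (x k)) (kapi tau kap 1 (x l)) (kapi tau kap 1 (x l));
  br_kap0 : forall k, exists2 w, isexp [:: Kap 0 (x k)] 0 w &
    lam 0 ** kap (x k) = ev tau kap w ** lam 0 }.

Hypothesis x_gen : forall g, gen x g.
Hypothesis B : base_rels.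

(** For 0 < i <= m and j > i + m + 1, [y j] is the conjugate of [y (j - m)] by [lam i.+1], and the
    effect of [lam i] on both of these is known by induction; smaller j form the finite range.
    Indices i > m follow from smaller ones by conjugation with [lam 0]. *)
Lemma base_shift (y : nat -> H) :
  (forall j, 0 < j -> tk (lam 0) (y j) (y (j + m))) ->
  (forall i j, 0 < i -> i <= m -> i < j -> j <= i + m.+1 -> tk (lam i) (y j) (y (j + m))) ->
  forall i j, i < j -> tk (lam i) (y j) (y (j + m)).
Proof.
move=> y0 yb i j; elim/ltn_ind: j i => j IH i ij.
case: (posnP i) => [->|i0]; first by apply: y0; lia.
case: (leqP i m) => im.
  case: (leqP j (i + m.+1)) => jm; first exact: yb.
  have l0 : 0 < i.+1 by [].
  have jE : j = (j - m) + m by lia.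
  have h1 : tk (lam i.+1) (y (j - m)) (y j) by rewrite {2}jE; apply: IH; lia.
  have h2 : tk (lam i) (y (j - m)) (y j) by rewrite {2}jE; apply: IH; lia.
  have h3 : tk (lam i) (lam i.+1) (lam (i.+1 + m)) by apply: (br_lam B); lia.
  apply: (tk_conj h3 h1 h2).
  apply: (tk_shift (br_lam0 B l0) _ _ h1); last by apply: y0; lia.
  by rewrite {2}jE; apply: y0; lia.
have jE : j = (j - m) + m by lia.
have iE : i = (i - m) + m by lia.
have h : tk (lam (i - m)) (y (j - m)) (y j) by rewrite {2}jE; apply: IH; lia.
rewrite iE; apply: (tk_shift _ _ _ h); first by apply: (br_lam0 B); lia.
  by rewrite {2}jE; apply: y0; lia.
by apply: y0; lia.
Qed.

(** Here [lam i.+2] takes [y (j - m)] to [y j] and commutes with [tau i]. It has this effect only if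
    i + 2 < j - m, hence the finite range up to i + m + 2. *)
Lemma base_far (y : nat -> H) :
  (forall i j, i < j -> tk (lam i) (y j) (y (j + m))) ->
  (forall i j, i <= m -> i.+1 < j -> j <= i + m.+2 -> tk (tau i) (y j) (y j)) ->
  forall i j, i.+1 < j -> tk (tau i) (y j) (y j).
Proof.
move=> ys yb i j; elim/ltn_ind: j i => j IH i ij.
case: (leqP i m) => im.
  case: (leqP j (i + m.+2)) => jm; first exact: yb.
  have jE : j = (j - m) + m by lia.
  have h1 : tk (lam i.+2) (y (j - m)) (y j) by rewrite {2}jE; apply: ys; lia.
  have h2 : tk (tau i) (lam i.+2) (lam i.+2) by apply: (br_taulam B); lia.
  apply: (tk_conj h2 h1 _ h1).
  by apply: IH; lia.
have jE : j = (j - m) + m by lia.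
have iE : i = (i - m) + m by lia.
have h : tk (tau (i - m)) (y (j - m)) (y (j - m)) by apply: IH; lia.
have c : tk (lam 0) (y (j - m)) (y j) by rewrite {2}jE; apply: ys; lia.
rewrite iE; apply: (tk_shift _ c c h).
by apply: (br_tau0 B); lia.
Qed.

Lemma lam_lam i j : i < j -> tk (lam i) (lam j) (lam (j + m)).
Proof. by apply: base_shift; [apply: (br_lam0 B) | apply: (br_lam B)]. Qed.

Lemma lam_tau i j : i < j -> tk (lam i) (tau j) (tau (j + m)).
Proof. by apply: base_shift; [apply: (br_tau0 B) | apply: (br_tau B)]. Qed.

Lemma tau_lam i j : i.+1 < j -> tk (tau i) (lam j) (lam j).
Proof. by apply: base_far; [apply: lam_lam | apply: (br_taulam B)]. Qed.

Lemma nat_shift_ind (Q : nat -> Prop) :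
  (forall i, i <= m -> Q i) -> (forall i, 0 < i -> Q i -> Q (i + m)) -> forall i, Q i.
Proof.
move=> q0 qS; elim/ltn_ind=> i IH; case: (leqP i m) => h; first exact: q0.
by rewrite (_ : i = (i - m) + m); [apply: qS; [lia | apply: IH; lia] | lia].
Qed.

Lemma base_cox : Cox tau.
Proof.
split; last by apply: base_far; [apply: lam_tau | apply: (br_comm B)].
  elim/nat_shift_ind=> [|i i0 IH]; first exact: (br_2 B).
  have c := br_tau0 B i0.
  by have := tkM c c; rewrite IH => h; apply: (tk_uniq h); apply: tk1.
elim/nat_shift_ind=> [|i i0 IH]; first exact: (br_braid B).
have c := br_tau0 B i0.
have c' : tk (lam 0) (tau i.+1) (tau (i + m).+1) by apply: (br_tau0 B).
have := tkM (tkM c c') c; rewrite IH => h; apply: (tk_uniq h).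
exact: (tkM (tkM c' c) c').
Qed.

Lemma evt_iota_shift i j r : i < j -> tk (lam i) (evt tau (iota j r)) (evt tau (iota (j + m) r)).
Proof.
elim: r j => [|r IH] j h /=; first exact: tk1.
apply: tkM; first exact: lam_tau.
by rewrite -addSn; apply: IH; lia.
Qed.

Lemma lam_block j : lam j.+1 ** tau j = evt tau (iota j m.+1) ** lam j.
Proof.
elim/nat_shift_ind: j => [|j j0 IH]; first exact: (br_block B).
have h : tk (lam 0) (lam j.+1 ** tau j) (lam (j + m).+1 ** tau (j + m)).
  by apply: tkM; [apply: (br_lam0 B) | apply: (br_tau0 B)].
apply: (tk_uniq h); rewrite IH.
by apply: tkM; [apply: evt_iota_shift | apply: (br_lam0 B)].
Qed.

Lemma kap_ind (Q : H -> Prop) :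
  Q gone -> (forall a b, Q a -> Q b -> Q (a ** b)) -> (forall a, Q a -> Q (a^!)) ->
  (forall k, Q (kap (x k))) -> forall g, Q (kap g).
Proof.
move=> q1 qM qV qx g; apply: (@gen_ind _ _ x (fun g => Q (kap g)) _ _ _ _ g (x_gen g)) => //.
- by rewrite (hom1 (br_hom B)).
- by move=> a b ha hb; rewrite (br_hom B); apply: qM.
by move=> a ha; rewrite (homV (br_hom B)); apply: qV.
Qed.

Lemma kap_comm_ind y : (forall k, tk (kap (x k)) y y) -> forall g, tk (kap g) y y.
Proof.
move=> h; apply: (kap_ind (Q := fun a => tk a y y)) => //.
- by rewrite /tk !gE.
- by move=> a b ha hb; apply: (tk_comp hb ha).
by move=> a /tk_sym.
Qed.

Lemma kap_far (y : nat -> H) :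
  (forall i j, i < j -> tk (lam i) (y j) (y (j + m))) ->
  (forall k j, 0 < j -> j <= m.+1 -> tk (kap (x k)) (y j) (y j)) ->
  forall g j, 0 < j -> tk (kap g) (y j) (y j).
Proof.
move=> ys yb g j j0; apply: kap_comm_ind => k {g}.
elim/ltn_ind: j j0 => j IH j0.
case: (leqP j m.+1) => jm; first exact: yb.
have jE : j = (j - m) + m by lia.
have h1 : tk (lam 1) (y (j - m)) (y j) by rewrite {2}jE; apply: ys; lia.
have h2 : tk (kap (x k)) (lam 1) (lam 1) by apply: (br_kaplam B).
by apply: (tk_conj h2 h1 _ h1); apply: IH; lia.
Qed.

Lemma base_labelled : labelled_rels tau kap.
Proof.
split; [exact: base_cox | exact: (br_hom B) | |].
  by apply: kap_far; [apply: lam_tau | apply: (br_kaptau B)].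
move=> g h; apply: kap_comm_ind => k {g} /=.
have : tk (tau 0 ** kap (x k) ** tau 0) (kap h) (kap h).
  apply: tk_comm; apply: kap_comm_ind => l {h}.
  exact: (br_kap B l k).
have t2 := cox2 base_cox 0.
have c1 g : tk (tau 0) (tau 0 ** kap g ** tau 0) (kap g) by rewrite /tk !gmulA t2 gmul1.
have c2 g : tk (tau 0) (kap g) (tau 0 ** kap g ** tau 0) by rewrite /tk -!gmulA t2 gmulr1.
exact: (tk_shift (c1 _) (c2 _) (c2 _)).
Qed.

(** By [isexp_uniq] and [ev_weq] one expansion [w'] decides the matter for all, and by [expok_cat]
    the property passes to concatenations. So only single atoms have to be checked against the
    finite system. *)
Let expok w i := forall w', isexp w i w' ->
    lam (pw w i) ** ev tau kap w = ev tau kap w' ** lam i.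

Lemma expok_ex w i w' : isexp w i w' ->
  lam (pw w i) ** ev tau kap w = ev tau kap w' ** lam i -> expok w i.
Proof.
by move=> h e w2 h2; rewrite e (ev_weq base_labelled (isexp_uniq h h2)).
Qed.

Lemma expok_cat u v i : expok v i -> expok u (pw v i) -> expok (u ++ v) i.
Proof.
move=> hv hu; have [v' ev'] := isexp_exists v i; have [u' eu'] := isexp_exists u (pw v i).
apply: (expok_ex (isexp_cat ev' eu')).
by rewrite pw_cat !ev_cat gmulA (hu _ eu') -gmulA (hv _ ev') gmulA.
Qed.

Lemma expok_weq w w2 i : weq w w2 -> expok w i -> expok w2 i.
Proof.
move=> e h w' h'; rewrite -(ev_weq base_labelled e) -(e.1); apply: h.
by apply: isexp_weq h'; split=> j; rewrite ?e.1 ?e.2.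
Qed.

Lemma ev_Tau u : ev tau kap (map (@Tau _ K) u) = evt tau u.
Proof. by elim: u => //= i u ->. Qed.

Lemma expok_Tau j i : expok [:: Tau K j] i.
Proof.
apply: (expok_ex (isexp_Tau j i)); rewrite ev_Tau /= gmulr1 /tau_exp /tp.
case: (ltnP i j) => h1.
  rewrite (_ : (if i == j then _ else _) = i); last by casel.
  by rewrite /= gmulr1; apply: lam_tau.
case: eqP => [->|h2]; first exact: lam_block.
case: eqP => [->|h3]; last by rewrite /= gmulr1; symmetry; apply: tau_lam; lia.
rewrite evt_rev; last exact: base_cox.
apply: (@gmulI _ (evt tau (iota j m.+1))); rewrite !gmulA -lam_block gmulrV gmul1.
by rewrite -gmulA (cox2 base_cox) gmulr1.
Qed.

Lemma expok_Kap0 g : expok [:: Kap 0 g] 0.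
Proof.
have wM a b : weq ([:: Kap 0 a] ++ [:: Kap 0 b]) [:: Kap 0 (a ** b) : atom K].
  by split=> y //=; rewrite !gmulr1; case: eqP => //; rewrite gmul1.
have w1 : weq [::] [:: Kap 0 (gone : K)].
  by split=> y //=; case: eqP => _; rewrite gmul1.
have ok1 : expok [:: Kap 0 gone] 0.
  by apply: (expok_weq w1); apply: (expok_ex (isexp_nil 0)); rewrite /= gmul1 gmulr1.
apply: (@gen_ind _ _ x (fun g => expok [:: Kap 0 g] 0) _ _ _ _ g (x_gen g)) => //.
- by move=> a b ha hb; apply: (expok_weq (wM a b)); apply: expok_cat.
- move=> a ha; have [u hu] := isexp_Kap0_ex a; have [v hv] := isexp_Kap0_ex (a^!).
  have := ha u hu; rewrite /= gmulr1 => e.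
  (* The expansions of [a] and of its inverse concatenate to an expansion of the trivial label, for
     which the relation is known. Cancelling the relation for [a] leaves the one for the inverse. *)
  have c : isexp [:: Kap 0 (gone : K)] 0 (u ++ v).
    by rewrite -(gmulrV a); apply: (isexp_weq (wM _ _)); apply: isexp_cat.
  have := ok1 _ c; rewrite /= gmulr1 (hom1 (br_hom B)) gmulr1 ev_cat => e1.
  apply: (expok_ex hv); rewrite /= gmulr1 (homV (br_hom B)).
  apply: (@gmulI _ (ev tau kap u)); rewrite !gmulA -e gmulK.
  exact: e1.
move=> k; have [w hw e] := br_kap0 B k.
by apply: (expok_ex hw); rewrite /= gmulr1.
Qed.

Theorem base_split : split_rels.
Proof.
split; [exact: base_labelled | exact: lam_lam | ].
suff h w i : expok w i by move=> w i; apply: h.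
elim: w i => [|a w IH] i.
  by apply: (expok_ex (isexp_nil i)); rewrite /= gmul1 gmulr1.
apply: (@expok_cat [:: a]) => //; move: (pw w i) => {i IH}i.
case: a => [j|j g]; first exact: expok_Tau.
elim: j i => [|j IH] i.
  case: i => [|i]; first exact: expok_Kap0.
  apply: (expok_ex (isexp_Kap0 g (ltn0Sn i))); rewrite /= gmulr1.
  by symmetry; apply: (kap_far lam_lam (br_kaplam B)).
apply: (expok_weq (weq_kapS j g)); apply: expok_cat; last exact: expok_Tau.
by apply: expok_cat => //; apply: expok_Tau.
Qed.

End Eval.
End Splitting.

(** * Streams and the action on them *)

Section Streams.
Variable A : Type.
Definition stream := nat -> A.
Definition scons (i : A) (x : stream) : stream := fun n => if n is n'.+1 then x n' else i.
Definition scat (u : seq A) (x : stream) : stream := foldr scons x u.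
Definition stl (x : stream) : stream := fun n => x n.+1.
Definition stake n (x : stream) := mkseq x n.
Definition sdrop n (x : stream) : stream := fun k => x (n + k).

Lemma scons_eta x : scons (x 0) (stl x) = x.
Proof. by apply: functional_extensionality => -[|n]. Qed.

Lemma scons_inj i j x y : scons i x = scons j y -> i = j /\ x = y.
Proof.
move=> e; split; first exact: (f_equal (fun z => z 0) e).
by apply: functional_extensionality => n; exact: (f_equal (fun z => z n.+1) e).
Qed.

Lemma scat_cat u v x : scat (u ++ v) x = scat u (scat v x).
Proof. exact: foldr_cat. Qed.

Lemma scat_rcons u i x : scat (rcons u i) x = scat u (scons i x).
Proof. by rewrite -cats1 scat_cat. Qed.

Lemma scat_inj u x y : scat u x = scat u y -> x = y.
Proof. by elim: u => //= i u IH /scons_inj [_ /IH]. Qed.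

Lemma scat_eq_size u v x y : size u = size v -> scat u x = scat v y -> u = v /\ x = y.
Proof.
elim: u v => [|i u IH] [|j v] //= [es] /scons_inj [-> /(IH _ es) [-> ->]].
by [].
Qed.

Lemma stake_cons n i x : stake n.+1 (scons i x) = i :: stake n x.
Proof. by rewrite /stake /mkseq /= (iotaDl 1 0) -map_comp. Qed.

Lemma scat_stake n x : scat (stake n x) (sdrop n x) = x.
Proof.
elim: n x => [|n IH] x; first by [].
by rewrite -{1}[x]scons_eta stake_cons /= -[in RHS](scons_eta x) -[in RHS](IH (stl x)).
Qed.

Lemma size_stake n x : size (stake n x) = n.
Proof. exact: size_mkseq. Qed.

Lemma scat_nth u x (i0 : A) n : n < size u -> scat u x n = nth i0 u n.
Proof. by elim: u n => [|i u IH] [|n] //= h; apply: IH. Qed.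

Lemma scat_at u x : scat u x (size u) = x 0.
Proof. by elim: u. Qed.

End Streams.

Section Action.
Variables (m : nat) (K : selfsim m).
Notation letter := 'I_m.+1.
Notation word := (seq letter).
Notation point := (stream letter).
Implicit Types (g h : K) (u v : word) (x y : point).

Fixpoint stw g u : K := if u is i :: u' then stw (ks g i) u' else g.
Definition act g x : point := fun n => kp (stw g (stake n x)) (x n).
Notation actW := (actw (@kp m K) (@ks m K)).

Lemma act_cons g i x : act g (scons i x) = scons (kp g i) (act (ks g i) x).
Proof.
apply: functional_extensionality => -[|n] //=.
by rewrite /act stake_cons.
Qed.

Lemma act_cat g u x : act g (scat u x) = scat (actW g u) (act (stw g u) x).
Proof. by elim: u g => //= i u IH g; rewrite act_cons IH. Qed.

Lemma size_actw g u : size (actW g u) = size u.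
Proof. by elim: u g => //= i u IH g; rewrite IH. Qed.

Lemma act1 x : act gone x = x.
Proof.
apply: functional_extensionality => n; elim: n x => [|n IH] x.
  by rewrite -[x]scons_eta act_cons /= kp1.
by rewrite -{1}[x]scons_eta act_cons /= ks1 IH.
Qed.

Lemma actM g h x : act (g ** h) x = act g (act h x).
Proof.
apply: functional_extensionality => n; elim: n g h x => [|n IH] g h x.
  by rewrite -[x]scons_eta !act_cons /= kpM.
by rewrite -[x]scons_eta !act_cons /= ksM IH.
Qed.

Lemma actK g : cancel (act g) (act (g^!)).
Proof. by move=> x; rewrite -actM gmulV act1. Qed.
Lemma actKV g : cancel (act (g^!)) (act g).
Proof. by move=> x; rewrite -actM gmulrV act1. Qed.

Lemma act_faithful g : (forall x, act g x = x) -> g = gone.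
Proof.
move=> h; apply: kfaithful => u.
have := h (scat u (fun _ => ord0)); rewrite act_cat.
by move=> /scat_eq_size []; rewrite ?size_actw.
Qed.

Hypothesis m_gt0 : 0 < m.

(** The letter at position [size u] is constant on the right, since [v] is longer, but arbitrary on
    the left. *)
Lemma scat_sep u v (f : point -> point) :
  size u < size v -> ~ (forall x, scat u x = scat v (f x)).
Proof.
move=> lt e.
have h c : nth ord0 v (size u) = c.
  by have := f_equal (fun z => z (size u)) (e (fun _ => c)); rewrite scat_at (scat_nth _ ord0).
by have := h ord_max; rewrite (h ord0) => /(f_equal val) /=; lia.
Qed.

Lemma scat_act_inj u v g g' :
  (forall x, scat u (act g x) = scat v (act g' x)) -> u = v /\ g = g'.
Proof.
move=> e.
have es : size u = size v.
  case: (ltngtP (size u) (size v)) => // lt; exfalso.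
    by apply: (scat_sep lt (f := act (g' ** g^!))) => x; rewrite -{1}[x](actKV g) e actM.
  by apply: (scat_sep lt (f := act (g ** g'^!))) => x; rewrite -{1}[x](actKV g') -e actM.
have uv : u = v by have [] := scat_eq_size es (e (fun _ => ord0)).
split=> //; subst v.
have : g^! ** g' = gone.
  by apply: act_faithful => x; rewrite actM -(scat_inj (e x)) actK.
by move=> /ginv_uniq; rewrite ginvK.
Qed.

(** * Ordered cone partitions and their splittings *)

Definition pinf : point := fun _ => ord_max.
Definition part := nat -> word.

Definition comb : part := fun k => rcons (nseq (k %/ m) ord_max) (inord (k %% m)).

Definition split1 (b : part) i : part := fun l =>
  if l < i then b l else if l <= i + m then rcons (b i) (inord (l - i)) else b (l - m).

(* The head of the list is split first; [evl] below reverses the order accordingly. *)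
Definition splits := foldl split1.

Lemma splits_cons b i L : splits b (i :: L) = splits (split1 b i) L.
Proof. by []. Qed.

Lemma split1_dl b i l : l <> i -> split1 b i (dl m i l) = b l.
Proof.
move=> ne; rewrite /split1 /dl; casel; first by [].
by rewrite addnK.
Qed.

Lemma split1_blk b i (k : letter) : split1 b i (i + k) = rcons (b i) k.
Proof.
have hk := ltn_ord k; rewrite /split1 ltnNge leq_addr /= leq_add2l -ltnS hk.
by rewrite addKn inord_val.
Qed.

Lemma split1_comm b i j : i < j ->
  split1 (split1 b i) (j + m) = split1 (split1 b j) i.
Proof.
move=> ij; apply: functional_extensionality => l; rewrite /split1.
by casel; solve [done | congr (rcons (b _) (inord _)); lia | congr (b _); lia].
Qed.

(** A word and its extensions are incomparable, so [lex u v] orders two cones and makes them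
    disjoint at the same time. A sorted enumeration of a partition is then unique. *)
Fixpoint lex u v := match u, v with
  | i :: u', j :: v' => (i < j) || ((i == j) && lex u' v')
  | _, _ => false end.

Lemma lex_cat u v s t : lex u v -> lex (u ++ s) (v ++ t).
Proof.
elim: u v => [|i u IH] [|j v] //= /orP [->//|/andP [-> /IH ->]].
by rewrite orbT.
Qed.

Lemma lex_common c u v : lex (c ++ u) (c ++ v) = lex u v.
Proof. by elim: c => //= i c ->; rewrite ltnn eqxx. Qed.

Lemma lex_asym u v : lex u v -> lex v u = false.
Proof.
elim: u v => [|i u IH] [|j v] //= /orP [h|/andP [/eqP -> /IH ->]].
  by rewrite ltnNge (ltnW h) /= -val_eqE gtn_eqF.
by rewrite ltnn andbF.
Qed.

Lemma lex_prefix u s : lex u (u ++ s) = false.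
Proof. by elim: u => //= i u ->; rewrite ltnn andbF. Qed.

Lemma lex_prefix' u s : lex (u ++ s) u = false.
Proof. by elim: u => //= [|i u ->]; [case: s | rewrite ltnn andbF]. Qed.

Lemma lex_stream u v x y : lex u v -> scat u x <> scat v y.
Proof.
elim: u v => [|i u IH] [|j v] //= h e0; have [ij e] := scons_inj e0; move: h.
by rewrite ij ltnn eqxx /= => h; case: (IH _ h e).
Qed.

Definition srt (b : part) := forall k l, k < l -> lex (b k) (b l).

Lemma srt_disj b k l x y : srt b -> scat (b k) x = scat (b l) y -> k = l.
Proof.
move=> h e; case: (ltngtP k l) => // lt; first by case: (lex_stream (h _ _ lt) e).
by case: (lex_stream (h _ _ lt) (esym e)).
Qed.

Lemma lex_rcons_l u v i : lex u v -> lex (rcons u i) v.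
Proof. by move=> h; rewrite -cats1 -[v]cats0; apply: lex_cat. Qed.
Lemma lex_rcons_r u v i : lex u v -> lex u (rcons v i).
Proof. by move=> h; rewrite -cats1 -[u]cats0; apply: lex_cat. Qed.

Lemma srt_split1 b i : srt b -> srt (split1 b i).
Proof.
move=> h k l kl; rewrite /split1; casel.
- exact: h.
- by apply: lex_rcons_r; apply: h.
- by apply: h; lia.
- rewrite -!cats1 lex_common /= !inordK; try lia.
- by apply: lex_rcons_l; apply: h; lia.
by apply: h; lia.
Qed.

Lemma srt_splits b L : srt b -> srt (splits b L).
Proof. by elim: L b => //= i L IH b h; apply/IH/srt_split1. Qed.

Lemma nseq_comb a k : nseq a ord_max ++ comb k = comb (a * m + k).
Proof.
by rewrite /comb divnMDl // modnMDl -!cats1 catA -nseqD.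
Qed.

Lemma combE k : comb k = nseq (k %/ m) ord_max ++ [:: inord (k %% m)].
Proof. by rewrite /comb cats1. Qed.

Lemma srt_comb : srt comb.
Proof.
move=> k l kl; have hk : k %% m < m by rewrite ltn_pmod.
have hl : l %% m < m by rewrite ltn_pmod.
rewrite !combE; have := leq_div2r m (ltnW kl); rewrite leq_eqVlt => /orP [/eqP e|lt].
  rewrite e lex_common /= !inordK ?ltnS ?(ltnW hk) ?(ltnW hl) //.
  rewrite andbF orbF; move: kl; rewrite {1}(divn_eq k m) {1}(divn_eq l m) e ltn_add2l.
  by move=> ->.
rewrite (_ : l %/ m = k %/ m + (l %/ m - k %/ m)); last by lia.
rewrite nseqD -catA lex_common; case: (l %/ m - k %/ m) (subn_gt0 (k %/ m) (l %/ m)).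
  by rewrite lt.
by move=> n _ /=; rewrite inordK ?hk // ltnS ltnW.
Qed.

Definition cover (b : part) := forall x, x <> pinf -> exists l y, x = scat (b l) y.
Definition nop (b : part) := forall l y, scat (b l) y <> pinf.

Lemma cover_split1 b i : cover b -> cover (split1 b i).
Proof.
move=> h x /h [l [y ->]]; case: (l =P i) => [->|ne].
  by exists (i + y 0), (stl y); rewrite split1_blk scat_rcons scons_eta.
by exists (dl m i l), y; rewrite split1_dl.
Qed.

Lemma nop_split1 b i : nop b -> nop (split1 b i).
Proof.
move=> h l y; case: (dlP m_gt0 i l) => [[k hk ->]|[k ->]].
  by rewrite split1_dl //; apply: h.
by rewrite split1_blk scat_rcons; apply: h.
Qed.

Lemma cover_splits b L : cover b -> cover (splits b L).
Proof. by elim: L b => //= i L IH b h; apply/IH/cover_split1. Qed.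
Lemma nop_splits b L : nop b -> nop (splits b L).
Proof. by elim: L b => //= i L IH b h; apply/IH/nop_split1. Qed.

Lemma scat_nseq_pinf n : scat (nseq n ord_max) pinf = pinf.
Proof.
elim: n => //= n ->; exact: (scons_eta pinf).
Qed.

Lemma nop_comb : nop comb.
Proof.
move=> l y; rewrite combE scat_cat -(scat_nseq_pinf (l %/ m)) => /scat_inj /=.
move=> /(f_equal (fun z => val (z 0))) /=.
have hl : l %% m < m by rewrite ltn_pmod.
by rewrite inordK; lia.
Qed.

Lemma cover_comb : cover comb.
Proof.
move=> x ne.
have hex : exists n, x n != ord_max.
  apply: NNPP => h; apply: ne; apply: functional_extensionality => n.
  by apply/eqP; apply/negPn/negP => hn; apply: h; exists n.
case: (ex_minnP hex) => n hn hmin.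
have lt : x n < m by rewrite ltn_neqAle -ltnS ltn_ord andbT.
exists (n * m + x n), (sdrop n.+1 x).
rewrite -nseq_comb combE divn_small // modn_small //= inord_val.
rewrite -[LHS](scat_stake n) scat_cat /=; congr (scat _ _).
  apply: (@eq_from_nth _ ord0); rewrite ?size_stake ?size_nseq // => i hi.
  rewrite nth_nseq hi nth_mkseq //; apply/eqP; apply/negPn/negP => h.
  by have := hmin i h; lia.
rewrite -[LHS]scons_eta /sdrop /= addn0; congr (scons _ _).
by apply: functional_extensionality => k; rewrite /stl addnS.
Qed.

(** * The Ore monoid of splittings *)

Section SplitWords.
Variables (H : group) (lam : nat -> H).
Fixpoint evl (L : seq nat) : H := if L is i :: L' then evl L' ** lam i else gone.
Lemma evl_cat L L' : evl (L ++ L') = evl L' ** evl L.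
Proof. by elim: L => [|i L IH] /=; rewrite ?gmulr1 // IH gmulA. Qed.
End SplitWords.

(** This stands in for equality in the splitting monoid. Of that equality it records the two
    consequences in use, the abstract one for values in groups and the geometric one for
    partitions. *)
Definition seqv (L L' : seq nat) :=
  (forall (H : group) (lam : nat -> H),
     (forall i j, i < j -> tk (lam i) (lam j) (lam (j + m))) -> evl lam L = evl lam L') /\
  (forall b, splits b L = splits b L').

Lemma seqv_refl L : seqv L L.
Proof. by []. Qed.
Lemma seqv_sym L L' : seqv L L' -> seqv L' L.
Proof. by move=> [e1 e2]; split=> // *; rewrite e1. Qed.
Lemma seqv_trans L1 L2 L3 : seqv L1 L2 -> seqv L2 L3 -> seqv L1 L3.
Proof. by move=> [a1 b1] [a2 b2]; split=> *; rewrite ?a1 ?b1 ?a2 ?b2. Qed.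
Lemma seqv_cat L1 L2 M1 M2 : seqv L1 L2 -> seqv M1 M2 -> seqv (L1 ++ M1) (L2 ++ M2).
Proof.
move=> [a1 b1] [a2 b2]; split=> [H lam hl|b].
  by rewrite !evl_cat (a1 _ _ hl) (a2 _ _ hl).
by rewrite /splits !foldl_cat -!/(splits _ _) b1 b2.
Qed.

Lemma seqv_swap i j : i < j -> seqv [:: i; j + m] [:: j; i].
Proof.
move=> ij; split=> [H lam hl|b] /=; last exact: split1_comm.
by rewrite !gmul1; symmetry; apply: hl.
Qed.

(** The bound on [L] says that the residue of a split past another split is at most one split; the
    recursion in [strip] rests on this. *)
Lemma diamond i j : exists L L', seqv (i :: L) (j :: L') /\ size L <= 1.
Proof.
case: (ltngtP i j) => [h|h|->].
- by exists [:: j + m], [:: i]; split=> //; apply: seqv_swap.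
- by exists [:: j], [:: i + m]; split=> //; apply/seqv_sym/seqv_swap.
by exists [::], [::].
Qed.

Lemma strip L j : exists M M', seqv (L ++ M) (j :: M') /\ size M <= 1.
Proof.
elim: L j => [|i L IH] j; first by exists [:: j], [::].
have [L0 [A' [e hs]]] := diamond i j; case: L0 e hs => [|k [|//]] e _.
  exists [::], (A' ++ L); split=> //; rewrite cats0.
  exact: (seqv_cat e (seqv_refl L)).
have [M [M' [e' hM]]] := IH k; exists M, (A' ++ M'); split=> //.
apply: (seqv_trans (L2 := [:: i; k] ++ M')); last exact: (seqv_cat e (seqv_refl M')).
exact: (seqv_cat (seqv_refl [:: i]) e').
Qed.

Lemma ore L L' : exists M M', seqv (L ++ M) (L' ++ M').
Proof.
elim: L' L => [|j L' IH] L; first by exists [::], L; rewrite cats0.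
have [M [N [e _]]] := strip L j; have [C [C' e']] := IH N.
exists (M ++ C), C'; rewrite catA.
apply: (seqv_trans (seqv_cat e (seqv_refl C))).
exact: (seqv_cat (seqv_refl [:: j]) e').
Qed.

(** If [b j] is no longer a leaf, it was split at some moment. Splits of different cones commute up
    to a change of index, so that split can be made first. *)
Lemma pull L (b : part) j : (forall l, splits b L l <> b j) -> exists L', seqv L (j :: L').
Proof.
elim: L b j => [|i L IH] b j h; first by case: (h j).
case: (i =P j) => [->|ne]; first by exists L.
have ji : j <> i by move=> e; apply: ne.
have [|L' e] := IH (split1 b i) (dl m i j); first by rewrite split1_dl.
suff [k ek] : exists k, seqv [:: i; dl m i j] [:: j; k].
  exists (k :: L'); apply: (seqv_trans (seqv_cat (seqv_refl [:: i]) e)).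
  exact: (seqv_cat ek (seqv_refl L')).
rewrite /dl; case: (ltnP j i) => lt.
  by exists (i + m); apply/seqv_sym/seqv_swap.
by exists i; apply: seqv_swap; lia.
Qed.

Lemma splits_ext L (b : part) l : exists k s, splits b L l = b k ++ s.
Proof.
elim: L b l => [|i L IH] b l; first by exists l, [::]; rewrite cats0.
rewrite splits_cons; have [k [s ->]] := IH (split1 b i) l; case: (dlP m_gt0 i k) => [[k' hk ->]|[k' ->]].
  by exists k', s; rewrite split1_dl.
by exists i, (k' :: s); rewrite split1_blk cat_rcons.
Qed.

Lemma split_gone L b j l : srt b -> splits b (j :: L) l <> b j.
Proof.
move=> sb; rewrite splits_cons; have [k [s ->]] := splits_ext L (split1 b j) l.
case: (dlP m_gt0 j k) => [[k' hk ->]|[k' ->]].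
  rewrite split1_dl // => e.
  case: (ltngtP k' j) => // /sb; rewrite -e ?lex_prefix ?lex_prefix' //.
by rewrite split1_blk => /(f_equal size); rewrite size_cat size_rcons; lia.
Qed.

(** The first split of [L] destroys the cone [b j], so [j] can be pulled to the front of [L'] as
    well; the two tails are then compared over [split1 b j]. *)
Lemma splits_inj L L' b : srt b -> splits b L = splits b L' -> seqv L L'.
Proof.
elim: L L' b => [|j L IH] L' b sb e.
  case: L' e => [|j L'] // e; case: (@split_gone L' b j j sb).
  by rewrite -[splits _ _ _](f_equal (fun c => c j) e).
have [|L2 e2] := @pull L' b j; first by rewrite -e => l; apply: split_gone.
have e3 : splits (split1 b j) L = splits (split1 b j) L2 by rewrite -!splits_cons -(e2.2 b).
have e4 := IH _ _ (@srt_split1 b j sb) e3.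
apply: seqv_trans (seqv_sym e2); exact: (seqv_cat (seqv_refl [:: j]) e4).
Qed.

(** * Table representations *)

Notation homeo := (Bij point).
Implicit Types f : homeo.

Definition maps f (b : part) (w : seq (atom K)) (a : part) :=
  forall l x, bf f (scat (b l) x) = scat (a (pw w l)) (act (lb w l) x).

Lemma maps_comp f f' b c d w w' :
  maps f c w d -> maps f' b w' c -> maps (f ** f') b (w ++ w') d.
Proof. by move=> h h' l x; rewrite bfM h' h pw_cat lb_cat actM. Qed.

Lemma maps_inv f b a w : maps f b w a -> maps (f^!) a (pwinv w) b.
Proof.
move=> h l x; apply: (bf_inj (a := f)); rewrite bfKV h pwKV lb_pwinv.
by rewrite -actM gmulrV act1.
Qed.

Lemma maps_weq f b a w w' : weq w w' -> maps f b w a -> maps f b w' a.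
Proof. by move=> [e1 e2] h l x; rewrite h e1 e2. Qed.

Lemma maps_split1 f b a w i w' :
  maps f b w a -> isexp w i w' -> maps f (split1 b i) w' (split1 a (pw w i)).
Proof.
move=> h [h1 h2] l x; case: (dlP m_gt0 i l) => [[k hk ->]|[k ->]].
  have [-> ->] := h1 k hk; rewrite !split1_dl //.
  by move=> /pw_inj.
have [-> ->] := h2 k; rewrite !split1_blk !scat_rcons h act_cons.
by [].
Qed.

Lemma maps_eq f f' b a w : cover b -> bf f pinf = pinf -> bf f' pinf = pinf ->
  maps f b w a -> maps f' b w a -> f = f'.
Proof.
move=> cb fp fp' h h'; apply: Bij_eq => x.
case: (excluded_middle_informative (x = pinf)) => [->|ne]; first by rewrite fp fp'.
by have [l [y ->]] := cb x ne; rewrite h h'.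
Qed.

Lemma srt_ge (a a' : part) (r : nat -> nat) : srt a -> srt a' ->
  (forall k, a' k = a (r k)) -> forall k, k <= r k.
Proof.
move=> sa sa' e.
have mono k l : k < l -> r k < r l.
  move=> /sa'; rewrite !e => hl; case: (ltngtP (r k) (r l)) => // [/sa /lex_asym|er].
    by rewrite hl.
  by move: hl; rewrite er -[X in lex _ X]cats0 lex_prefix.
elim=> // k IH; exact: leq_ltn_trans IH (mono _ _ (ltnSn k)).
Qed.

(** The two targets consist of the same cones, hence differ by a permutation [r] of the indices. As
    both are sorted, [r] and its inverse are increasing, so [r] is the identity. *)
Lemma maps_uniq f b a a' w w' : srt a -> srt a' ->
  maps f b w a -> maps f b w' a' -> a = a' /\ weq w w'.
Proof.
move=> sa sa' h h'.
have e l : a (pw w l) = a' (pw w' l) /\ lb w l = lb w' l.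
  by apply: scat_act_inj => x; rewrite -h h'.
pose r k := pw w (pw (pwinv w') k); pose r' k := pw w' (pw (pwinv w) k).
have er k : a' k = a (r k) by rewrite /r (e _).1 pwKV.
have er' k : a k = a' (r' k) by rewrite /r' -(e _).1 pwKV.
have rK k : r' (r k) = k by rewrite /r /r' pwK pwKV.
have ri k : r k = k.
  apply/eqP; rewrite eqn_leq (srt_ge sa sa' er) andbT.
  by have := srt_ge sa' sa er' (r k); rewrite rK.
split; first by apply: functional_extensionality => k; rewrite er ri.
split=> l; last exact: (e l).2.
by rewrite -(ri (pw w' l)) /r pwK.
Qed.

Lemma maps_exists b a w : srt a -> srt b -> nop a -> nop b -> cover a -> cover b ->
  exists f, bf f pinf = pinf /\ maps f b w a.
Proof.
move=> sa sb na nb ca cb.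
have build (b' a' : part) (v : seq (atom K)) : srt b' -> nop b' -> exists F : point -> point, F pinf = pinf /\
    forall l x, F (scat (b' l) x) = scat (a' (pw v l)) (act (lb v l) x).
  move=> sb' nb'.
  have ch x : exists y, (x = pinf -> y = pinf) /\
      (forall l z, x = scat (b' l) z -> y = scat (a' (pw v l)) (act (lb v l) z)).
    case: (excluded_middle_informative (exists l z, x = scat (b' l) z)) => [[l [z ->]]|ne].
      exists (scat (a' (pw v l)) (act (lb v l) z)); split; first by move=> /nb'.
      move=> l' z' ee; have ll := srt_disj sb' ee; subst l'.
      by rewrite (scat_inj ee).
    by exists pinf; split=> // l z ee; case: ne; exists l, z.
  exists (fun x => proj1_sig (constructive_indefinite_description _ (ch x))); split.
    by case: constructive_indefinite_description => y [h _] /=; apply: h.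
  by move=> l x; case: constructive_indefinite_description => y [_ h] /=; apply: h.
have [F [Fp hF]] := build b a w sb nb.
have [G [Gp hG]] := build a b (pwinv w) sa na.
have FK : cancel F G.
  move=> x; case: (excluded_middle_informative (x = pinf)) => [->|ne]; first by rewrite Fp Gp.
  by have [l [y ->]] := cb x ne; rewrite hF hG pwK lb_pwinv pwK actK.
have GK : cancel G F.
  move=> x; case: (excluded_middle_informative (x = pinf)) => [->|ne]; first by rewrite Gp Fp.
  by have [l [y ->]] := ca x ne; rewrite hG hF pwKV lb_pwinv -actM gmulrV act1.
by exists (MkBij FK GK).
Qed.

(** * Elements as fractions of splittings of the comb *)

Definition leaves L := splits comb L.
(* f = L1^-1 w L2, as a fraction of splittings of the comb. *)
Definition rep f L1 w L2 := bf f pinf = pinf /\ maps f (leaves L2) w (leaves L1).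

Lemma srt_leaves L : srt (leaves L).
Proof. exact: srt_splits srt_comb. Qed.
Lemma cover_leaves L : cover (leaves L).
Proof. exact: cover_splits cover_comb. Qed.
Lemma nop_leaves L : nop (leaves L).
Proof. exact: nop_splits nop_comb. Qed.
Lemma leaves_cat L M : leaves (L ++ M) = splits (leaves L) M.
Proof. by rewrite /leaves /splits foldl_cat. Qed.

Lemma rep_exists L1 w L2 : exists f, rep f L1 w L2.
Proof.
by apply: maps_exists; do ?[exact: srt_leaves | exact: nop_leaves | exact: cover_leaves].
Qed.

(** Refining the source by [A] dictates the refinement [A'] of the target, and each step is matched
    by an instance of [sr_exp]. Geometric refinement and computation in an abstract group thus stay
    synchronised. *)
Lemma maps_splits f b a w A : maps f b w a ->
  exists w' A', maps f (splits b A) w' (splits a A') /\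
    forall (H : group) (lam tau : nat -> H) kap, split_rels (K := K) lam tau kap ->
      evl lam A' ** ev tau kap w = ev tau kap w' ** evl lam A.
Proof.
elim: A f b a w => [|i A IH] f b a w h.
  by exists w, [::]; split=> // *; rewrite /= !gE.
have [w1 e1] := isexp_exists m_gt0 w i.
have [w' [A' [h' e']]] := IH _ _ _ _ (maps_split1 h e1).
exists w', (pw w i :: A'); split=> // H lam tau kap R /=.
by rewrite -gmulA (sr_exp R e1) !gmulA e'.
Qed.

Lemma maps_splits_l f b a w A' : maps f b w a ->
  exists w' A, maps f (splits b A) w' (splits a A') /\
    forall (H : group) (lam tau : nat -> H) kap, split_rels (K := K) lam tau kap ->
      evl lam A' ** ev tau kap w = ev tau kap w' ** evl lam A.
Proof.
elim: A' f b a w => [|i A IH] f b a w h.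
  by exists w, [::]; split=> // *; rewrite /= !gE.
have [w1 e1] := isexp_exists m_gt0 w (pw (pwinv w) i).
have := maps_split1 h e1; rewrite pwKV => /IH [w' [A' [h' e']]].
exists w', (pw (pwinv w) i :: A'); split=> // H lam tau kap R /=.
have := sr_exp R e1; rewrite pwKV => e.
by rewrite -gmulA e !gmulA e'.
Qed.

Section Value.
Variables (H : group) (lam tau : nat -> H) (kap : K -> H).
Hypothesis R : split_rels lam tau kap.

Definition repval L1 w L2 : H := (evl lam L1)^! ** ev tau kap w ** evl lam L2.

Definition reprel f (h : H) := exists L1 w L2, rep f L1 w L2 /\ h = repval L1 w L2.

(** The two partitions in the middle have a common refinement by [ore]; over it both tables are
    expanded and composed. *)
Lemma reprel_mul f f' (h h' : H) : reprel f h -> reprel f' h' -> reprel (f ** f') (h ** h').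
Proof.
move=> [L1 [w [L2 [[fp r] ->]]]] [L1' [w' [L2' [[fp' r'] ->]]]].
have [M [M' e]] := ore L2 L1'.
have [w1 [A1 [h1 e1]]] := maps_splits M r.
have [w1' [A2 [h1' e1']]] := maps_splits_l M' r'.
exists (L1 ++ A1), (w1 ++ w1'), (L2' ++ A2); split; first split.
- by rewrite bfM fp' fp.
- rewrite !leaves_cat; apply: maps_comp h1'.
  by rewrite -leaves_cat /leaves -(e.2 comb) -/(leaves _) leaves_cat.
have := e.1 _ _ (sr_lam R); rewrite !evl_cat => ee.
rewrite /repval !evl_cat ev_cat ginvM.
have {}e1 := e1 _ _ _ _ R; have {}e1' := e1' _ _ _ _ R.
apply: (@gmulI _ (evl lam A1 ** evl lam L1)).
rewrite !gE e1.
by rewrite -(gmulA (ev tau kap w1)) ee !gE -(gmulA (ev tau kap w1)) e1' !gE.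
Qed.

(** Over a common refinement of the two sources, [maps_uniq] identifies the tables and [splits_inj]
    the target splittings. So the value depends on the homeomorphism alone, which is what
    completeness of the relations means. *)
Lemma reprel_uniq f (h h' : H) : reprel f h -> reprel f h' -> h = h'.
Proof.
move=> [L1 [w [L2 [[fp r] ->]]]] [L1' [w' [L2' [[_ r'] ->]]]].
have [M [M' e]] := ore L2 L2'.
have [w1 [A1 [h1 e1]]] := maps_splits M r.
have [w2 [A2 [h2 e2]]] := maps_splits M' r'.
rewrite -!leaves_cat in h1 h2; rewrite /leaves -(e.2 comb) -/(leaves _) in h2.
have [ea we] := maps_uniq (srt_leaves (L1 ++ A1)) (srt_leaves (L1' ++ A2)) h1 h2.
have el := (splits_inj srt_comb ea).1 _ _ (sr_lam R).
have ee := e.1 _ _ (sr_lam R).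
have {}e1 := e1 _ _ _ _ R; have {}e2 := e2 _ _ _ _ R.
rewrite !evl_cat in el ee.
have key M1 M2 A B (v v' : seq (atom K)) : evl lam A ** ev tau kap v = ev tau kap v' ** evl lam B ->
   (evl lam M1)^! ** ev tau kap v ** evl lam M2 =
   (evl lam A ** evl lam M1)^! ** ev tau kap v' ** (evl lam B ** evl lam M2).
  by move=> x; rewrite gmulA -(gmulA _ _ (evl lam B)) -x !gE.
by rewrite /repval (key _ _ _ _ _ _ e1) (key _ _ _ _ _ _ e2) el ee (ev_weq R we).
Qed.

End Value.
End Action.

(** * The Roever-Nekrashevych group and the stabiliser of a point *)

Section RN.
Variables (m : nat) (K : selfsim m).
Hypothesis m_gt0 : 0 < m.
Notation letter := 'I_m.+1.
Notation word := (seq letter).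
Notation point := (stream letter).
Notation homeo := (Bij point).
Notation actW := (actw (@kp m K) (@ks m K)).
Notation pinf := (@pinf m).
Notation comb := (@comb m).

Implicit Types (f : homeo) (u v s : word) (x y : point).

Definition good f u := exists v (g : K), forall y, bf f (scat u y) = scat v (act g y).
Definition inV f := exists N, forall u, size u = N -> good f u.
Definition inA f := inV f /\ bf f pinf = pinf.

Lemma good_ext f u s : good f u -> good f (u ++ s).
Proof.
move=> [v [g h]]; exists (v ++ actW g s), (stw g s) => y.
by rewrite scat_cat h act_cat scat_cat.
Qed.

Lemma good_size f N u : (forall u, size u = N -> good f u) -> N <= size u -> good f u.
Proof.
move=> h hs; rewrite -(cat_take_drop N u); apply: good_ext; apply: h.
exact: size_takel.
Qed.

Lemma good_ext_big f u N : good f u -> forall s, size s = N ->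
  exists v (g : K), N <= size v /\ forall y, bf f (scat (u ++ s) y) = scat v (act g y).
Proof.
move=> [v [g h]] s hs; exists (v ++ actW g s), (stw g s); split.
  by rewrite size_cat size_actw hs leq_addl.
by move=> y; rewrite scat_cat h act_cat scat_cat.
Qed.

Lemma inV1 : inV gone.
Proof. by exists 0 => -[|//] _; exists [::], gone => y; rewrite act1. Qed.

Lemma inVM f f' : inV f -> inV f' -> inV (f ** f').
Proof.
move=> [N h] [N' h']; exists (N' + N) => u hu.
have h1 : good f' (take N' u) by apply: h'; rewrite size_takel // hu leq_addr.
have hs : size (drop N' u) = N by rewrite size_drop hu addKn.
have [v [g [hv e]]] := good_ext_big h1 hs.
have [v' [g' e']] := good_size h hv.
exists v', (g' ** g) => y; rewrite bfM -{1}(cat_take_drop N' u) e e' actM.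
by [].
Qed.

Lemma inVV f : inV f -> inV (f^!).
Proof.
move=> [N h].
pose V (t : N.-tuple letter) := proj1_sig (constructive_indefinite_description _ (h t (size_tuple t))).
have VP (t : N.-tuple letter) : exists g : K, forall y, bf f (scat t y) = scat (V t) (act g y).
  by rewrite /V; case: constructive_indefinite_description.
(* A word at least as long as all image prefixes has its cone inside one image cone. One point of
   the cone, pulled back to [z], tells which one. *)
exists (\max_t size (V t)) => w hw.
pose z := bf (f^!) (scat w (fun _ => ord0)).
have ht : size (stake N z) == N by rewrite size_stake.
pose t : N.-tuple letter := Tuple ht.
have [g hg] := VP t.
have e : scat w (fun _ => ord0) = scat (V t) (act g (sdrop N z)).
  by rewrite -hg /= scat_stake /z bfKV.
have hs : size (V t) <= size w by rewrite hw; apply: (leq_bigmax t).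
have [s ws] : exists s, w = V t ++ s.
  exists (drop (size (V t)) w); rewrite -{1}(cat_take_drop (size (V t)) w); congr (_ ++ _).
  have := e; rewrite -{1}(cat_take_drop (size (V t)) w) scat_cat.
  by move=> /scat_eq_size []; rewrite ?size_takel.
exists (t ++ actW (g^!) s), (stw (g^!) s) => y.
apply: (bf_inj (a := f)); rewrite bfKV scat_cat -act_cat hg actKV -scat_cat -ws.
by [].
Qed.

Lemma sub_inV : is_subgroup inV.
Proof. by split; [apply: inV1 | apply: inVM | apply: inVV]. Qed.

Lemma sub_inA : is_subgroup inA.
Proof.
split; first by split; [apply: inV1 | ].
  by move=> f f' [h e] [h' e']; split; [apply: inVM | rewrite bfM e' e].
by move=> f [h e]; split; [apply: inVV | rewrite -{1}e bfVK].
Qed.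

Lemma scat_pinf v x : scat v x = pinf -> v = nseq (size v) ord_max /\ x = pinf.
Proof.
move=> e; have e' : scat v x = scat (nseq (size v) ord_max) pinf by rewrite scat_nseq_pinf.
by apply: scat_eq_size e'; rewrite size_nseq.
Qed.

Lemma act_last g y : act (K := K) g (scons ord_max y) = scons ord_max y.
Proof. by rewrite act_cons kp_last ks_last act1. Qed.

(* The germ at a fixed point u m^oo is a shift along the comb. *)
Lemma germ_shift f u : inV f ->
  bf f (scat u pinf) = scat u pinf ->
  exists n b, forall y, bf f (scat u (scat (nseq n ord_max) y)) = scat u (scat (nseq b ord_max) y).
Proof.
move=> [N h] e.
have h1 : good f (u ++ nseq N ord_max).
  by apply: (good_size h); rewrite size_cat size_nseq leq_addl.
(* The [(size u).+1] further letters make the image prefix [v] longer than [u], so that [v] begins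
   with [u]. *)
have [v [g [hv eg]]] := good_ext_big h1 (size_nseq (size u).+1 ord_max).
pose v2 := drop (size u) v.
have ev : scat v (act g pinf) = scat u pinf.
  rewrite -eg -e; congr (bf f _).
  by rewrite !scat_cat !scat_nseq_pinf.
have [v1 ev2] : take (size u) v = u /\ scat v2 (act g pinf) = pinf.
  move: ev; rewrite -{1}(cat_take_drop (size u) v) scat_cat.
  by move=> /scat_eq_size []; rewrite ?size_takel // ltnW.
have [v2E _] := scat_pinf ev2.
(* The final [+ 1] feeds one letter [ord_max] to the label [g], whose state there is trivial. *)
exists (N + (size u).+1 + 1), (size v2 + 1) => y.
have -> : scat u (scat (nseq (N + (size u).+1 + 1) ord_max) y) =
    scat ((u ++ nseq N ord_max) ++ nseq (size u).+1 ord_max) (scons ord_max y).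
  by rewrite !nseqD !scat_cat.
rewrite eg act_last -{1}(cat_take_drop (size u) v) v1 -/v2 nseqD !scat_cat.
by rewrite -v2E.
Qed.

(** * Existence of representations *)

(** The rightmost cone is treated first, so that its splits do not move the cones still waiting. [n]
    bounds the length still missing, [inv] guarantees that long words stop, and [t] is the size of
    the window afterwards. *)
Lemma resolve (stop inv : word -> Prop) N :
  (forall u i, inv u -> ~ stop u -> inv (rcons u i)) ->
  (forall u, inv u -> N <= size u -> stop u) ->
  forall n r (b : part m) j,
  (forall l, j <= l < j + r -> inv (b l) /\ N <= size (b l) + n) ->
  exists L t, [/\ all (leq j) L, forall l, l < j -> splits b L l = b l,
    forall l, j <= l < j + t -> stop (splits b L l) &
    forall l, splits b L (j + t + l) = b (j + r + l)].
Proof.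
move=> invS invN; elim=> [|n IHn].
  move=> r b j h; exists [::], r; split=> // l hl.
  by have [h1 h2] := h l hl; apply: invN => //; rewrite -(addn0 (size _)).
elim=> [|r IHr] b j h; first by exists [::], 0; split=> // l; lia.
case: (excluded_middle_informative (stop (b (j + r)))) => hq.
  have [|L [t [h1 h2 h3 h4]]] := IHr b j; first by move=> l hl; apply: h; lia.
  exists L, t.+1; split=> // l.
    move=> hl; case: (ltnP l (j + t)) => hlt; first by apply: h3; lia.
    by rewrite (_ : l = j + t + 0); [rewrite h4 addn0 | lia].
  by rewrite (_ : j + t.+1 + l = j + t + l.+1); [rewrite h4; congr (b _); lia | lia].
set q := j + r.
have [hq1 hq2] : inv (b q) /\ N <= size (b q) + n.+1 by apply: h; lia.
have [|L2 [t2 [a1 a2 a3 a4]]] := IHn m.+1 (split1 b q) q.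
  move=> l hl; have hk : l - q < m.+1 by lia.
  rewrite (_ : l = q + Ordinal hk); last by rewrite /=; lia.
  rewrite split1_blk size_rcons; split; first exact: invS.
  by lia.
have b2E l : l < q -> splits (split1 b q) L2 l = b l.
  by move=> hl; rewrite a2 // /split1 hl.
have [|L3 [t3 [c1 c2 c3 c4]]] := IHr (splits (split1 b q) L2) j.
  move=> l hl; rewrite b2E; last by lia.
  by apply: h; lia.
exists (q :: L2 ++ L3), (t3 + t2).
have eL : splits b (q :: L2 ++ L3) = splits (splits (split1 b q) L2) L3.
  by rewrite splits_cons /splits foldl_cat.
rewrite eL; split.
- rewrite /= leq_addr all_cat c1 andbT; apply: sub_all a1 => i; apply: leq_trans.
  exact: leq_addr.
- by move=> l hl; rewrite c2 // b2E //; lia.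
- move=> l hl; case: (ltnP l (j + t3)) => hlt; first by apply: c3; lia.
  rewrite (_ : l = j + t3 + (l - (j + t3))); last by lia.
  by rewrite c4; apply: a3; lia.
move=> l; rewrite (_ : j + (t3 + t2) + l = j + t3 + (t2 + l)); last by lia.
rewrite c4 addnA a4 /split1; casel.
by congr (b _); lia.
Qed.

(** Pigeonhole: by injectivity the values at arguments below [c] must avoid the tail from [c'],
    which is already taken. *)
Lemma shift_leq (p : nat -> nat) c c' :
  injective p -> (forall l, p (c + l) = c' + l) -> c <= c'.
Proof.
move=> p_inj h.
rewrite -(size_iota 0 c) -(size_map p) -[leqRHS](size_iota 0 c').
apply: uniq_leq_size; first by rewrite map_inj_uniq ?iota_uniq.
move=> k /mapP [i]; rewrite !mem_iota => /andP [_ hi] ->.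
rewrite leq0n add0n ltnNge; apply/negP => hc.
have : i = c + (p i - c') by apply: p_inj; rewrite h subnKC.
by lia.
Qed.

(** The comb is refined twice: at the source until [f] acts on each cone by a prefix change and a
    label, at the target until the cones are the images. By [germ_shift] only finitely many cones
    are concerned. Nothing below [o] is split or moved, which with o = 1 yields generators for the
    two-point stabiliser. *)
Theorem rep_total o f : inA f ->
  (forall k, k < o -> forall x, bf f (scat (comb k) x) = scat (comb k) x) ->
  exists L1 w L2, [/\ all (leq o) L1, all (leq o) L2, all (amin o) w & rep (K := K) f L1 w L2].
Proof.
move=> [fV fp] fo.
have [N0 hN] := fV.
have [n1 [b1 /= hsh]] := @germ_shift f [::] fV fp.
have shc k y : bf f (scat (comb (n1 * m + k)) y) = scat (comb (b1 * m + k)) y.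
  by rewrite -!nseq_comb // !scat_cat hsh.
have [|L2 [t2 [o2 lo2 mid2 hi2]]] := @resolve (good f) (fun _ => True) N0
    (fun _ _ _ _ => I) (fun u _ => @good_size f N0 u hN) N0 (n1 * m) comb o.
  by move=> l _; split=> //; apply: leq_addl.
set bb := leaves m L2.
have hi2' l y : bf f (scat (bb (o + t2 + l)) y) = scat (comb (o + b1 * m + l)) y.
  rewrite /bb /leaves hi2 (_ : o + n1 * m + l = n1 * m + (o + l)); last by lia.
  by rewrite shc; congr (scat (comb _) _); lia.
have gd l : good f (bb l).
  case: (ltnP l o) => h1.
    by exists (comb l), gone => y; rewrite act1 /bb /leaves lo2 // fo.
  case: (ltnP l (o + t2)) => h2; first by apply: mid2; rewrite h1.
  rewrite -(subnKC h2); exists (comb (o + b1 * m + (l - (o + t2)))), gone => y.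
  by rewrite act1 hi2'.
have ch l : exists vg : word * K, forall y, bf f (scat (bb l) y) = scat vg.1 (act vg.2 y).
  by have [v [g h]] := gd l; exists (v, g).
pose V l := (proj1_sig (constructive_indefinite_description _ (ch l))).1.
pose G l := (proj1_sig (constructive_indefinite_description _ (ch l))).2.
have VG l y : bf f (scat (bb l) y) = scat (V l) (act (G l) y).
  by rewrite /V /G; case: constructive_indefinite_description.
have Vlo l : l < o -> V l = comb l /\ G l = gone.
  move=> h; apply: (scat_act_inj m_gt0) => x; rewrite -VG act1 /bb /leaves lo2 // fo //.
have Vhi l : V (o + t2 + l) = comb (o + b1 * m + l) /\ G (o + t2 + l) = gone.
  by apply: (scat_act_inj m_gt0) => x; rewrite -VG act1 hi2'.
have sbb : srt bb by apply: srt_leaves.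
have Vd l l' x x' : scat (V l) x = scat (V l') x' -> l = l'.
  move=> e; apply: (srt_disj sbb (x := act ((G l)^!) x) (y := act ((G l')^!) x')).
  by apply: (bf_inj (a := f)); rewrite !VG !actKV.
have Vc x : x <> pinf -> exists l y, x = scat (V l) y.
  move=> nx; have [|l [y e]] := cover_leaves m_gt0 L2 (x := bf (f^!) x).
    by move=> e; apply: nx; rewrite -fp -e bfKV.
  by exists l, (act (G l) y); rewrite -VG -e bfKV.
have Vn l x : scat (V l) x <> pinf.
  move=> e; apply: (@nop_leaves m m_gt0 L2 l (act ((G l)^!) x)).
  by apply: (bf_inj (a := f)); rewrite fp VG actKV.
pose z0 : point := fun _ => ord0.
have z0n u : scat u z0 <> pinf.
  move=> /scat_pinf [_ /(f_equal (fun z => val (z 0)))] /=; lia.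
pose N1 := \max_(l < o + t2) size (V l).
(* [inv u] says that [u] extends a comb cone to be refined and has not passed strictly below an
   image cone. As the image cones cover everything but [pinf], such a word is itself an image prefix
   once it is long. *)
pose stop u := exists l, V l = u.
pose inv u := (exists k s, k < o + b1 * m /\ u = comb k ++ s) /\
  (forall l s, u = V l ++ s -> s = [::]).
have invS u i : inv u -> ~ stop u -> inv (rcons u i).
  move=> [[k [s [hk ->]]] h2] ns; split; first by exists k, (rcons s i); rewrite rcons_cat.
  move=> l; elim/last_ind=> // t c _; rewrite -rcons_cat => /rcons_inj [e _].
  by case: ns; exists l; rewrite e (h2 _ _ e) cats0.
have invN u : inv u -> N1 <= size u -> stop u.
  move=> [[k [s [hk eu]]] h2] hs; have [l [y e]] := Vc _ (z0n u).
  have hl : l < o + t2.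
    rewrite ltnNge; apply/negP => h; move: e.
    rewrite eu -(subnKC h) (Vhi _).1 scat_cat => /(srt_disj (srt_comb m_gt0)); lia.
  have hsz : size (V l) <= size u.
    by apply: leq_trans hs; apply: (leq_bigmax (Ordinal hl)).
  exists l.
  have eV : u = V l ++ drop (size (V l)) u.
    rewrite -{1}(cat_take_drop (size (V l)) u); congr (_ ++ _).
    move: e; rewrite -{1}(cat_take_drop (size (V l)) u) scat_cat.
    by move=> /scat_eq_size []; rewrite ?size_takel.
  by rewrite eV (h2 _ _ eV) cats0.
have [|L1 [t1 [o1 lo1 mid1 hi1]]] := @resolve stop inv N1 invS invN N1 (b1 * m) comb o.
  move=> l hl; split; last exact: leq_addl.
  split; first by exists l, [::]; rewrite cats0; split=> //; lia.
  move=> l'; elim/last_ind=> // t c _; rewrite -rcons_cat /comb => /rcons_inj [e _].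
  have /(f_equal (fun u => scat u pinf)) := e.
  rewrite scat_nseq_pinf scat_cat => /esym /Vn [].
set aa := leaves m L1.
have hi1' l : aa (o + t1 + l) = V (o + t2 + l) by rewrite (Vhi l).1 /aa /leaves hi1.
have aaQ l : stop (aa l).
  case: (ltnP l o) => h1; first by exists l; rewrite (Vlo l h1).1 /aa /leaves lo1.
  case: (ltnP l (o + t1)) => h2; first by apply: mid1; rewrite h1.
  by rewrite -(subnKC h2) hi1'; exists (o + t2 + (l - (o + t1))).
pose r l := proj1_sig (constructive_indefinite_description _ (aaQ l)).
have rP l : V (r l) = aa l by rewrite /r; case: constructive_indefinite_description.
have Vi l l' : V l = V l' -> l = l' by move=> e; apply: (@Vd l l' z0 z0); rewrite e.
have ex l : exists k, r k = l.
  have [k [y e]] := cover_leaves m_gt0 L1 (z0n (V l)); exists k.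
  by apply: (@Vd _ _ y z0); rewrite rP -e.
pose p l := proj1_sig (constructive_indefinite_description _ (ex l)).
have pK : cancel p r by move=> l; rewrite /p; case: constructive_indefinite_description.
have saa : srt aa by apply: srt_leaves.
have ri : injective r.
  move=> k k' e; apply: (srt_disj saa (x := z0) (y := z0)).
  by rewrite -!rP e.
have rK : cancel r p by move=> k; apply: ri; rewrite pK.
have rhi l : r (o + t1 + l) = o + t2 + l by apply: Vi; rewrite rP hi1'.
have phi l : p (o + t2 + l) = o + t1 + l by rewrite -rhi rK.
(* Both windows hold equally many cones, because [r] and its inverse are injective and merely shift
   the tails. *)
have tt : o + t1 = o + t2.
  apply/eqP; rewrite eqn_leq (shift_leq ri rhi) /=.
  exact: (shift_leq (can_inj pK) phi).
have [||w [ow pww lbw]] := @labelled_word m K o (o + t2) p r G pK rK.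
- move=> l hl; have [e1 e2] := Vlo l hl; split=> //; apply: ri; rewrite pK; apply: Vi.
  by rewrite rP e1 /aa /leaves lo1.
- move=> l hl; rewrite -(subnKC hl); split; first by rewrite phi tt.
  exact: (Vhi _).2.
exists L1, w, L2; split=> //; split=> // l x.
by rewrite pww lbw VG -/aa -rP pK.
Qed.

End RN.

(** * Finite presentability of the point stabiliser *)

Arguments gmul {g} _ _ : simpl never.
Arguments ginv {g} _ : simpl never.
Arguments gone {g} : simpl never.

Section PointStabiliser.
Variables (m : nat) (K : selfsim m).
Hypothesis m_gt0 : 0 < m.
Notation letter := 'I_m.+1.
Notation point := (stream letter).
Notation homeo := (Bij point).
Notation pinf := (@pinf m).
Notation comb := (@comb m).
Implicit Types (f : homeo) (w : seq (atom K)).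

Definition repC L1 w L2 : homeo :=
  proj1_sig (constructive_indefinite_description _ (rep_exists m_gt0 L1 w L2)).

Lemma repCP L1 w L2 : rep (repC L1 w L2) L1 w L2.
Proof. by rewrite /repC; case: constructive_indefinite_description. Qed.

Definition lamC i := repC [::] [::] [:: i].
Definition tauC i := repC [::] [:: Tau K i] [::].
Definition kapC g := repC [::] [:: Kap 0 g] [::].

Lemma lamC_maps i : maps (K := K) (lamC i) (split1 comb i) [::] comb.
Proof. exact: (repCP _ _ _).2. Qed.
Lemma tauC_maps i : maps (tauC i) comb [:: Tau K i] comb.
Proof. exact: (repCP _ _ _).2. Qed.
Lemma kapC_maps g : maps (kapC g) comb [:: Kap 0 g] comb.
Proof. exact: (repCP _ _ _).2. Qed.
Lemma lamC_pinf i : bf (lamC i) pinf = pinf.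
Proof. exact: (repCP _ _ _).1. Qed.
Lemma tauC_pinf i : bf (tauC i) pinf = pinf.
Proof. exact: (repCP _ _ _).1. Qed.
Notation evC := (ev tauC kapC).

Lemma evC_rep w : rep (evC w) [::] w [::].
Proof.
have one f w1 f' w2 : rep f [::] w1 [::] -> rep f' [::] w2 [::] ->
    rep (f ** f') [::] (w1 ++ w2) [::].
  move=> [p1 h1] [p2 h2]; split; first by rewrite bfM p2 p1.
  exact: (maps_comp h1 h2).
elim: w => [|a w IH] /=; first by split=> // l x /=; rewrite act1.
apply: (one _ [:: a]) => //; case: a => [i|i g] /=; first exact: repCP.
elim: i => [|i IHi] /=; first exact: repCP.
have [h1 h2] := one _ _ _ _ (one _ _ _ _ (repCP [::] [:: Tau K i] [::]) IHi)
  (repCP [::] [:: Tau K i] [::]).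
split=> //; apply: maps_weq h2; rewrite -catA; exact: weq_kapS.
Qed.

Lemma evC_weq w w' : weq w w' -> evC w = evC w'.
Proof.
move=> e; have [h1 h2] := evC_rep w; have [h1' h2'] := evC_rep w'.
apply: (maps_eq (cover_comb m_gt0) h1 h1' (maps_weq e h2)).
exact: h2'.
Qed.

Lemma maps_split_nil f (b a : part m) i : maps (K := K) f b [::] a ->
  maps (K := K) f (split1 b i) [::] (split1 a i).
Proof. by move=> h; apply: (maps_split1 m_gt0 h (isexp_nil K i)). Qed.

(** Both sides of each relation fix [pinf] and have the same table over a covering partition, so
    [maps_eq] applies, directly or through [evC_weq]. *)
Lemma splitC : split_rels lamC tauC kapC.
Proof.
have tpk : forall i j, i.+1 < j -> tk (tauC i) (tauC j) (tauC j).
  move=> i j h; have := @evC_weq [:: Tau K i; Tau K j] [:: Tau K j; Tau K i].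
  rewrite /= !gmulr1; apply; split=> x //=.
  by rewrite /tp; casel.
split; first split; first split=> //.
- move=> i; have := @evC_weq [:: Tau K i; Tau K i] [::]; rewrite /= gmulr1; apply.
  by split=> x /=; [apply: tpK | rewrite !gmul1].
- move=> i; have := @evC_weq [:: Tau K i; Tau K i.+1; Tau K i] [:: Tau K i.+1; Tau K i; Tau K i.+1].
  rewrite /= !gmulr1 !gmulA; apply; split=> x //=.
  by rewrite /tp; casel.
- move=> g h; have := @evC_weq [:: Kap 0 (g ** h)] [:: Kap 0 g; Kap 0 h].
  rewrite /= !gmulr1; apply; split=> x //=.
  by rewrite !gmulr1; case: eqP => //; rewrite gmul1.
- move=> g j h; have := @evC_weq [:: Kap 0 g; Tau K j] [:: Tau K j; Kap 0 g].
  rewrite /= !gmulr1; apply; split=> x //=.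
  by rewrite /tp !gmulr1 gmul1; casel.
- move=> g h; have := @evC_weq [:: Kap 0 g; Kap 1 h] [:: Kap 1 h; Kap 0 g].
  rewrite /= !gmulr1; apply; split=> x //=.
  by rewrite !gmulr1; case: x => [|x]; rewrite /= ?gmul1 ?gmulr1.
- move=> i j ij.
  have h1 : maps (K := K) (lamC i ** lamC j) (split1 (split1 comb j) i) [::] comb.
    by apply: (maps_comp (lamC_maps i) (w' := [::])); apply: maps_split_nil; apply: lamC_maps.
  have h2 : maps (K := K) (lamC (j + m) ** lamC i) (split1 (split1 comb i) (j + m)) [::] comb.
    by apply: (maps_comp (lamC_maps _) (w' := [::])); apply: maps_split_nil; apply: lamC_maps.
  rewrite split1_comm // in h2.
  apply: (maps_eq _ _ _ h1 h2); try by rewrite bfM !lamC_pinf.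
  by do 2!apply: (cover_split1 m_gt0); apply: cover_comb.
move=> w i w' e; have [p1 h1] := evC_rep w; have [p2 h2] := evC_rep w'.
have h3 := maps_split1 m_gt0 h1 e.
have h4 := maps_comp (lamC_maps (pw w i)) h3.
have h5 := maps_comp h2 (lamC_maps i); rewrite cats0 in h5.
apply: (maps_eq _ _ _ h4 h5); try by rewrite bfM ?p1 ?lamC_pinf.
by apply: (cover_split1 m_gt0); apply: cover_comb.
Qed.

Lemma split_base (H : group) (lam tau : nat -> H) kap J (x : J -> K) :
  split_rels lam tau kap -> base_rels lam tau kap x.
Proof.
move=> R.
have T j i := sr_exp R (isexp_Tau K m_gt0 j i).
have eT u : ev tau kap (map (@Tau _ K) u) = evt tau u by elim: u => //= i u ->.
have lt i j : i < j -> tk (lam i) (tau j) (tau (j + m)).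
  move=> h; have := T j i; rewrite eT /= gmulr1 /tau_exp h /= gmulr1.
  by rewrite /tp; casel.
split; do ?by move=> *; apply: (sr_lam R); lia.
- by move=> j h; apply: lt.
- by move=> i j _ _ h _; apply: lt.
- move=> i j _ h _; have := T i j; rewrite eT /= gmulr1 /tau_exp.
  rewrite /tp /tk; casel; by rewrite /= gmulr1 => ->.
- by move=> i j _ h _; apply: (coxC R).
- by move=> i _; apply: (cox2 R).
- by move=> i _; apply: (coxB R).
- move=> j _; have := T j j; rewrite eT /= gmulr1 /tau_exp ltnn !eqxx.
  by rewrite /tp eqxx.
- exact: (lr_hom R).
- by move=> k j h _; apply: (lr_tau R).
- move=> k j h _; have := sr_exp R (isexp_Kap0 m_gt0 (x k) h); rewrite /= gmulr1.
  by move=> e; apply: tk_comm.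
- by move=> k l; apply: (lr_kap R).
move=> k; have [w hw] := isexp_Kap0_ex m_gt0 (x k); exists w => //.
by have := sr_exp R hw; rewrite /= gmulr1.
Qed.

Lemma splits_large L : exists B, forall (b : part m) l, B <= l -> splits b L (l + m * size L) = b l.
Proof.
elim: L => [|i L [B hB]]; first by exists 0 => b l _; rewrite muln0 addn0.
exists (B + i.+1) => b l hl; rewrite splits_cons /= mulnS addnA hB; last by lia.
by rewrite /split1; casel; congr (b _); lia.
Qed.

Lemma pw_large B w l : all (abnd B) w -> B <= l -> pw w l = l /\ lb w l = gone.
Proof.
elim: w => //= a w IH /andP [ha hw] hl; have [-> ->] := IH hw hl.
case: a ha => [i|i g] /= ha; last by split=> //; rewrite gmulr1; casel.
by split; [rewrite /tp; casel | rewrite gmul1].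
Qed.

Lemma rep_inA f L1 w L2 : rep f L1 w L2 -> inA K f.
Proof.
move=> [fp h]; split=> //.
have [B1 h1] := splits_large L1; have [B2 h2] := splits_large L2.
have [Bw hw] := abnd_ex w.
(* From the index [n1 * m] on, the splittings only shift indices and [w] acts trivially. The summand
   [size L1] keeps the subtraction in [b1] from truncating. *)
pose n1 := B1 + B2 + Bw + size L1; pose b1 := n1 + size L2 - size L1.
have n1E : n1 * m = B1 * m + B2 * m + Bw * m + m * size L1.
  by rewrite /n1 !mulnDl (mulnC m).
have [l1 l2 lw] : [/\ B1 <= B1 * m, B2 <= B2 * m & Bw <= Bw * m] by rewrite !leq_pmulr.
have shc k y : bf f (scat (comb (n1 * m + k)) y) = scat (comb (b1 * m + k)) y.
  rewrite -(h2 comb); last by lia.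
  rewrite (h _ y); have [|-> ->] := @pw_large Bw w (n1 * m + k + m * size L2) hw; first by lia.
  rewrite act1 (_ : _ + _ = b1 * m + k + m * size L1); last first.
    by rewrite /b1 mulnBl mulnDl (mulnC (size L1)) (mulnC (size L2)); lia.
  rewrite /leaves h1 //.
  by rewrite /b1 mulnBl mulnDl (mulnC (size L1)) (mulnC (size L2)); lia.
have hsh y : bf f (scat (nseq n1 ord_max) y) = scat (nseq b1 ord_max) y.
  case: (excluded_middle_informative (y = pinf)) => [->|ne].
    by rewrite !scat_nseq_pinf.
  have [k [z ->]] := cover_comb m_gt0 ne.
  by rewrite -!scat_cat !nseq_comb // shc.
pose T := n1 * m + m * size L2.
exists (maxn n1 (\max_(l < T) size (leaves m L2 l))) => u hu.
pose z0 : point := fun _ => ord0.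
have z0n : scat u z0 <> pinf.
  move=> /scat_pinf [_ /(f_equal (fun z => val (z 0)))] /=; lia.
have [l [y e]] := cover_leaves m_gt0 L2 z0n.
have pre v y' : scat u z0 = scat v y' -> size v <= size u -> exists s, u = v ++ s.
  move=> ee hs; exists (drop (size v) u); rewrite -{1}(cat_take_drop (size v) u); congr (_ ++ _).
  move: ee; rewrite -{1}(cat_take_drop (size v) u) scat_cat.
  by move=> /scat_eq_size []; rewrite ?size_takel.
case: (ltnP l T) => hl.
  have [|s ->] := pre _ _ e.
    by rewrite hu leq_max; apply/orP; right; apply: (leq_bigmax (Ordinal hl)).
  by apply: good_ext; exists (leaves m L1 (pw w l)), (lb w l) => y'; apply: h.
have [||s ->] := pre (nseq n1 ord_max) (scat (comb (l - T)) y).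
- rewrite e -scat_cat nseq_comb //; congr (scat _ _).
  rewrite -(h2 comb); last by lia.
  by rewrite /leaves /T; congr (splits _ _ _); lia.
- by rewrite size_nseq hu leq_maxl.
by apply: good_ext; exists (nseq b1 ord_max), gone => y'; rewrite act1.
Qed.

Lemma maps_splits_nil f (b a : part m) L : maps (K := K) f b [::] a ->
  maps (K := K) f (splits b L) [::] (splits a L).
Proof.
elim: L b a => // i L IH b a h; rewrite !splits_cons; apply: IH; exact: maps_split_nil.
Qed.

Lemma evl_maps L : maps (K := K) (evl lamC L) (leaves m L) [::] comb.
Proof.
elim: L => [|i L IH] /=; first by move=> l x /=; rewrite act1.
apply: (maps_comp (w := [::]) (w' := [::]) IH).
exact: (maps_splits_nil L (lamC_maps i)).
Qed.

Lemma rep_val f L1 w L2 : rep f L1 w L2 -> f = repval lamC tauC kapC L1 w L2.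
Proof.
move=> [fp h]; have [p2 h2] := evC_rep w.
have pl L : bf (evl lamC L) pinf = pinf.
  by elim: L => [|i L IH] //; rewrite -[evl _ _]/(evl lamC L ** lamC i) bfM lamC_pinf.
have pV f' : bf f' pinf = pinf -> bf (f'^!) pinf = pinf by move=> e; rewrite -{1}e bfVK.
apply: (maps_eq (cover_leaves m_gt0 L2) fp _ h).
  by rewrite /repval !bfM pl p2 pV.
have := maps_comp (maps_comp (maps_inv (evl_maps L1)) h2) (evl_maps L2).
by rewrite cats0.
Qed.

(* Indices beyond m are reached from 1, ..., m by conjugation. *)
Definition pext (H : group) (c : H) (y : letter -> H) j : H :=
  iter (j.-1 %/ m) (fun h => c ** h ** c^!) (y (inord (if j == 0 then 0 else (j.-1 %% m).+1))).

Lemma pext_small (H : group) (c : H) y (j : letter) : pext c y j = y j.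
Proof.
have hj := ltn_ord j; rewrite /pext; case: eqP => [e|j0].
  by rewrite e div0n /=; congr (y _); apply: val_inj; rewrite /= inordK ?e.
rewrite divn_small; last by lia.
rewrite modn_small; last by lia.
rewrite /=; congr (y _); apply: val_inj; rewrite /= inordK; lia.
Qed.

Lemma pext_shift (H : group) (c : H) y j : 0 < j -> tk c (pext c y j) (pext c y (j + m)).
Proof.
move=> j0; rewrite /pext (_ : (j + m).-1 = m + j.-1); last by lia.
rewrite divnDl ?dvdnn // divnn m_gt0 add1n iterS modnDl.
rewrite (_ : (j + m == 0) = false); last by lia.
rewrite (_ : (j == 0) = false); last by lia.
by rewrite /tk !gE.
Qed.

Lemma pext_unique (H : group) (z : nat -> H) c : (forall j, 0 < j -> tk c (z j) (z (j + m))) ->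
  pext c (fun i : letter => z i) = z.
Proof.
move=> h; apply: functional_extensionality => j.
elim/ltn_ind: j => j IH; case: (ltnP j m.+1) => hj.
  exact: (pext_small c (fun i : letter => z i) (Ordinal hj)).
rewrite (_ : j = (j - m) + m); last by lia.
have j0 : 0 < j - m by lia.
by rewrite (tkE (pext_shift _ _ j0)) (tkE (h _ j0)) IH //; lia.
Qed.

Lemma word_pext (I : Type) (c : forall H : group, (I -> H) -> H)
    (y : forall H : group, (I -> H) -> letter -> H) j :
  is_word c -> (forall i, is_word (fun H z => y H z i)) ->
  is_word (fun H z => pext (c H z) (y H z) j).
Proof.
move=> wc wy; rewrite /pext; elim: (j.-1 %/ m) => [|n IH] /=; first exact: wy.
by apply: word_M; [apply: word_M | apply: word_V].
Qed.

Theorem fp_inA : fp_on (fun _ : K => True) -> fp_on (@inA m K).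
Proof.
move=> [J [x [EK [finK _ xg xE xu]]]].
(* The relators must be words fixed in advance: [wd] spells each label in the generators of [K], and
   [W] below fixes one expansion for each generator. *)
have wdP (g : K) : exists s, evalw x s = g by apply: xg.
pose wd g := proj1_sig (constructive_indefinite_description _ (wdP g)).
have wdE g : evalw x (wd g) = g by rewrite /wd; case: constructive_indefinite_description.
pose W k := proj1_sig (constructive_indefinite_description _ (isexp_Kap0_ex m_gt0 (x k))).
have WP k : isexp [:: Kap 0 (x k)] 0 (W k) by rewrite /W; case: constructive_indefinite_description.
pose I : finType := ((letter + letter) + J)%type.
pose yl (H : group) (y : I -> H) (k : letter) := y (inl (inl k)).
pose yt (H : group) (y : I -> H) (k : letter) := y (inl (inr k)).
pose yk (H : group) (y : I -> H) (k : J) := y (inr k).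
pose la (H : group) (y : I -> H) := pext (yl H y ord0) (yl H y).
pose ta (H : group) (y : I -> H) := pext (yl H y ord0) (yt H y).
pose ka (H : group) (y : I -> H) (g : K) := evalw (yk H y) (wd g).
pose E (H : group) (y : I -> H) :=
  EK H (yk H y) /\
  (forall i, i < m.+1 -> forall j, j < (i + m.+1).+1 -> (0 < i < j) ->
     tk (la H y i) (la H y j) (la H y (j + m)) /\ tk (la H y i) (ta H y j) (ta H y (j + m))) /\
  (forall i, i < m.+1 -> forall j, j < (i + m.+2).+1 -> i.+1 < j ->
     tk (ta H y i) (la H y j) (la H y j) /\ tk (ta H y i) (ta H y j) (ta H y j)) /\
  (forall i, i < m.+1 -> ta H y i ** ta H y i = gone /\
     ta H y i ** ta H y i.+1 ** ta H y i = ta H y i.+1 ** ta H y i ** ta H y i.+1 /\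
     la H y i.+1 ** ta H y i = evt (ta H y) (iota i m.+1) ** la H y i) /\
  (forall k, forall j, j < m.+2 -> 0 < j ->
     tk (yk H y k) (ta H y j) (ta H y j) /\ tk (yk H y k) (la H y j) (la H y j)) /\
  (forall k l, tk (yk H y k) (ta H y 0 ** yk H y l ** ta H y 0) (ta H y 0 ** yk H y l ** ta H y 0)) /\
  (forall k, la H y 0 ** yk H y k = ev (ta H y) (ka H y) (W k) ** la H y 0).
have wl j : is_word (fun H y => la H y j).
  by apply: word_pext => [|i]; apply: word_gen.
have wt j : is_word (fun H y => ta H y j).
  by apply: word_pext => [|i]; apply: word_gen.
have wk k : is_word (fun H y => yk H y k) by apply: word_gen.
have wka g : is_word (fun H y => ka H y g) by apply: word_evalw.
have wev w : is_word (fun H y => ev (ta H y) (ka H y) w).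
  elim: w => [|a w IH] /=; first exact: word_1.
  apply: word_M => //; case: a => [i|i g] //=.
  elim: i => [|i IHi] //=.
  by apply: word_M => //; apply: word_M.
have wevt s : is_word (fun H y => evt (ta H y) s).
  by elim: s => [|a s IH] /=; [apply: word_1 | apply: word_M].
have finE : fin_eqs E.
  do !apply: fin_and.
  - have [R eR] := finK; exists [seq [seq ((inr p.1 : I), p.2) | p <- r] | r <- R] => H y.
    rewrite eR; split.
      by move=> h _ /mapP [r hr ->]; rewrite evalw_map; apply: h.
    by move=> h r hr; have := h _ (map_f _ hr); rewrite evalw_map.
  - apply: fin_bounded => i; apply: fin_bounded => j; apply: fin_cond.
    by apply: fin_and; apply: fin_tk.
  - apply: fin_bounded => i; apply: fin_bounded => j; apply: fin_cond.
    by apply: fin_and; apply: fin_tk.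
  - apply: fin_bounded => i; do !apply: fin_and; apply: fin_eq;
    by do ?[apply: word_M | exact: word_1 | exact: wt | exact: wl | exact: wevt].
  - apply: fin_fintype => k; apply: fin_bounded => j; apply: fin_cond.
    by apply: fin_and; apply: fin_tk.
  - apply: fin_fintype => k; apply: fin_fintype => l; apply: fin_tk => //;
    by do !apply: word_M.
  by apply: fin_fintype => k; apply: fin_eq; apply: word_M.
pose gens (i : I) : homeo := match i with
  | inl (inl k) => lamC k | inl (inr k) => tauC k | inr k => kapC (x k) end.
have R := splitC; have B := split_base x R.
have laE : la _ gens = lamC.
  exact: (pext_unique (br_lam0 B)).
have taE : ta _ gens = tauC.
  exact: (pext_unique (br_tau0 B)).
have kaE : ka _ gens = kapC.
  apply: functional_extensionality => g; rewrite /ka -{2}(wdE g).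
  have [_ ->] // := @evalw_hom J K homeo (fun _ => True) kapC x
    (fun a b _ _ => lr_hom R a b) (IsSubgroup Logic.I (fun _ _ _ _ => Logic.I) (fun _ _ => Logic.I)) (fun _ => Logic.I) (wd g).
have gl j : gen gens (lamC j).
  by have [u hu] := wl j; exists u; rewrite -hu laE.
have gt j : gen gens (tauC j).
  by have [u hu] := wt j; exists u; rewrite -hu taE.
have gk g : gen gens (kapC g).
  by have [u hu] := wka g; exists u; rewrite -hu kaE.
have kE k : yk _ gens k = kapC (x k) by [].
exists I, gens, E; split=> //.
- by case=> [[k|k]|k]; apply: rep_inA; apply: repCP.
- move=> f fA; have [|L1 [w [L2 [_ _ _ r]]]] := @rep_total m K m_gt0 0 f fA; first by [].
  rewrite (rep_val r) /repval.
  have gL L : gen gens (evl lamC L).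
    by elim: L => [|i L IH] /=; [apply: gen1 | apply: genM].
  apply: genM => //; apply: genM; first exact: genV.
  elim: w {r} => [|a w IH] /=; first exact: gen1.
  apply: genM => //; case: a => [i|i g] //=; elim: i => [|i IHi] //=.
  by do !apply: genM.
- rewrite /E laE taE kaE; split; last split; last split; last split; last split; last split.
  + have [RR eR] := finK; apply/eR => r hr.
    have -> : yk _ gens = kapC \o x by [].
    have [_ <-] := @evalw_hom J K homeo (fun _ => True) kapC x
      (fun a b _ _ => lr_hom R a b) (IsSubgroup Logic.I (fun _ _ _ _ => Logic.I) (fun _ _ => Logic.I)) (fun _ => Logic.I) r.
    by rewrite (proj1 (eR K x) xE r hr) (hom1 (lr_hom R)).
  + move=> i hi j hj /andP [i0 ij]; split; first by apply: (sr_lam R).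
    by apply: (br_tau B) => //; lia.
  + move=> i hi j hj ij; split; first by apply: (br_taulam B) => //; lia.
    by apply: (coxC R).
  + by move=> i hi; split; [|split]; [apply: (cox2 R) | apply: (coxB R) | apply: (br_block B)].
  + by move=> k j hj j0; split; [apply: (br_kaptau B) | apply: (br_kaplam B)].
  + by move=> k l; apply: (lr_kap R).
  by move=> k; have := sr_exp R (WP k); rewrite /= gmulr1.
move=> H y [yK [y1 [y2 [y3 [y4 [y5 y6]]]]]].
(* Only now is there a homomorphism on [K]; [kaH] shows that it agrees with the spelling of the
   labels used in the relators. *)
have [kap [kapM' kapx]] := xu H (yk H y) yK.
have kapM : is_hom kap by move=> a b; apply: kapM'.
have kaH : ka H y = kap.
  apply: functional_extensionality => g; rewrite /ka -{2}(wdE g).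
  have [_ ->] := @evalw_hom J K H (fun _ => True) kap x kapM'
    (IsSubgroup Logic.I (fun _ _ _ _ => Logic.I) (fun _ _ => Logic.I)) (fun _ => Logic.I) (wd g).
  by congr (evalw _ _); apply: functional_extensionality => k /=; rewrite kapx.
have BH : base_rels (la H y) (ta H y) kap x.
  have l0 : la H y 0 = yl H y ord0 by exact: (pext_small _ _ ord0).
  split=> //.
  - by move=> j j0; rewrite l0; apply: pext_shift.
  - by move=> j j0; rewrite l0; apply: pext_shift.
  - by move=> i j i0 im ij jm; have [] := y1 i im j jm; rewrite ?i0.
  - by move=> i j i0 im ij jm; have [] := y1 i im j jm; rewrite ?i0.
  - by move=> i j im ij jm; have [] := y2 i im j jm.
  - by move=> i j im ij jm; have [] := y2 i im j jm.
  - by move=> i im; have [] := y3 i im.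
  - by move=> i im; have [_ []] := y3 i im.
  - by move=> i im; have [_ []] := y3 i im.
  - by move=> k j j0 jm; rewrite kapx; have [] := y4 k j jm j0.
  - by move=> k j j0 jm; rewrite kapx; have [] := y4 k j jm j0.
  - by move=> k l; rewrite /= !kapx; apply: y5.
  by move=> k; exists (W k) => //; rewrite kapx -kaH; apply: y6.
have RH := base_split m_gt0 (fun g => xg g Logic.I) BH.
have [||||phi [phiM phiR]] := @hom_of_rel homeo H (@inA m K) (reprel (la H y) (ta H y) kap).
- move=> f fA; have [|L1 [w [L2 [_ _ _ r]]]] := @rep_total m K m_gt0 0 f fA; first by [].
  by eexists; exists L1, w, L2; split; first exact: r.
- exact: (sgM (sub_inA K)).
- by move=> a b h k; apply: (reprel_mul m_gt0 RH).
- by move=> a h k; apply: (reprel_uniq m_gt0 RH).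
exists phi; split=> // i.
have [L1 [w [L2 [r ->]]]] : exists L1 w L2, rep (K := K) (gens i) L1 w L2 /\
    y i = repval (la H y) (ta H y) kap L1 w L2.
  case: i => [[k|k]|k].
  - exists [::], [::], [:: nat_of_ord k]; split; first exact: repCP.
    by rewrite /repval /= !gE /la pext_small.
  - exists [::], [:: Tau K k], [::]; split; first exact: repCP.
    by rewrite /repval /= !gE /ta pext_small.
  exists [::], [:: Kap 0 (x k)], [::]; split; first exact: repCP.
  by rewrite /repval /= !gE kapx.
have iA : inA K (gens i) by apply: rep_inA r.
apply: (reprel_uniq m_gt0 RH (phiR _ iA)).
by exists L1, w, L2.
Qed.

End PointStabiliser.

(** * Finite presentability from a triply transitive action *)

(* The situation of a group V acting triply transitively on a set: A is the stabiliser of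
   a point p, B that of a second point q, t swaps p and q, and s fixes p and moves q. *)
Theorem fp_triple (X : group) (V A B : X -> Prop) (t s : X) (J : finType) (b : J -> X) :
  is_subgroup V -> is_subgroup A -> is_subgroup B ->
  (forall g, A g -> V g) -> (forall g, B g -> A g) -> V t -> A s -> ~ A t ->
  fp_on A -> (forall j, B (b j)) -> (forall g, B g -> gen b g) ->
  (forall g, B g -> A (t ** g ** t)) ->
  t ** t = gone -> t ** s ** t = s ** t ** s ->
  (forall g, A g -> B g \/ exists c d, [/\ B c, B d & g = c ** s ** d]) ->
  (forall g, V g -> A g \/ exists c d, [/\ A c, A d & g = c ** t ** d]) ->
  fp_on V.
Proof.
move=> sV sA sB AV BA Vt As At [I [x [E [finE Ax xg xE xu]]]] Bb bg tB tt tst AB VA.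
have wd (g : X) : exists w, A g -> evalw x w = g.
  case: (excluded_middle_informative (A g)) => [/xg [w e]|n]; last by exists [::].
  by exists w.
pose wo g := proj1_sig (constructive_indefinite_description _ (wd g)).
have woE g : A g -> evalw x (wo g) = g by rewrite /wo; case: constructive_indefinite_description.
pose y0 (H : group) (y : option I -> H) (i : I) := y (Some i).
pose E' (H : group) (y : option I -> H) := E H (y0 H y) /\
  y None ** y None = gone /\
  y None ** evalw (y0 H y) (wo s) ** y None =
    evalw (y0 H y) (wo s) ** y None ** evalw (y0 H y) (wo s) /\
  forall j, y None ** evalw (y0 H y) (wo (b j)) ** y None = evalw (y0 H y) (wo (t ** b j ** t)).
have wN : is_word (fun H (y : option I -> H) => y None) by apply: word_gen.
have wS w : is_word (fun H (y : option I -> H) => evalw (y0 H y) w).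
  by apply: word_evalw => i; apply: word_gen.
exists (option I : finType).
pose x' (i : option I) : X := if i is Some j then x j else t.
exists x', E'; split.
- do !apply: fin_and.
  + have [R eR] := finE; exists [seq [seq (Some p.1, p.2) | p <- r] | r <- R] => H y.
    rewrite eR; split.
      by move=> h _ /mapP [r hr ->]; rewrite evalw_map; apply: h.
    by move=> h r hr; have := h _ (map_f _ hr); rewrite evalw_map.
  + by apply: fin_eq; [apply: word_M | apply: word_1].
  + by apply: fin_eq; do !apply: word_M.
  by apply: fin_fintype => j; apply: fin_eq => //; do !apply: word_M.
- by case=> [i|] //=; apply: AV.
- have gA g : A g -> gen x' g.
    by move=> /xg [w <-]; exists [seq (Some p.1, p.2) | p <- w]; rewrite evalw_map.
  move=> g /VA [/gA //|[c [d [/gA gc /gA gd ->]]]].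
  by apply: genM => //; apply: genM => //; apply: (gen_gen x' None).
- rewrite /E' -/(x') (_ : y0 X x' = x) //; split=> //; split=> //; split.
    by rewrite woE.
  by move=> j /=; rewrite !woE //; [apply: tB | apply: BA].
move=> H y [yE [yT [yS yB]]].
have [phi [phiM phix]] := xu H _ yE.
set T := y None in yT yS yB.
have ex g : A g -> evalw (y0 H y) (wo g) = phi g.
  move=> ag; have [_] := evalw_hom phiM sA Ax (wo g); rewrite woE // => ->.
  by congr (evalw _ _); apply: functional_extensionality => i /=; rewrite phix.
have TV : T^! = T by apply: ginv_uniq.
have tV : t^! = t by apply: ginv_uniq.
have phi1 : phi gone = gone.
  by apply: (@gmulI _ (phi gone)); rewrite -phiM ?gmul1 ?gmulr1 //; apply: (sg1 sA).
have phiV g : A g -> phi (g^!) = (phi g)^!.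
  move=> ag; symmetry; apply: ginv_uniq; rewrite -phiM ?gmulrV //; exact: (sgV sA).
rewrite ex // in yS.
have {}yB g : B g -> [/\ A g, A (t ** g ** t) & T ** phi g ** T = phi (t ** g ** t)].
  move=> /bg; elim/gen_ind.
  - by rewrite gmulr1 tt phi1 gmulr1 yT; split=> //; apply: (sg1 sA).
  - move=> c d [c1 c2 c3] [d1 d2 d3].
    have e : t ** (c ** d) ** t = (t ** c ** t) ** (t ** d ** t).
      by rewrite !gmulA -(gmulA _ t t) tt gmulr1.
    rewrite e; split; [exact: (sgM sA) | exact: (sgM sA) |].
    by rewrite (phiM c) // (phiM (t ** c ** t)) // -c3 -d3 !gmulA -(gmulA _ T T) yT gmulr1.
  - move=> c [c1 c2 c3].
    have e : t ** c^! ** t = (t ** c ** t)^! by rewrite !ginvM tV gmulA.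
    rewrite e; split; [exact: (sgV sA) | exact: (sgV sA) |].
    by rewrite !phiV // -c3 !ginvM TV gmulA.
  move=> j; have h1 : A (t ** b j ** t) by apply: tB.
  by split=> //; [apply: BA | rewrite -!ex //; apply: BA].
(* The factors of an element of AtA are not unique, so the candidate homomorphism is a relation at
   first. *)
pose Rl (v : X) (h : H) := (A v /\ h = phi v) \/
  exists c d, [/\ A c, A d, v = c ** t ** d & h = phi c ** T ** phi d].
have AM := sgM sA.
have RM v v' h h' : Rl v h -> Rl v' h' -> Rl (v ** v') (h ** h').
  move=> [[av ->]|[c [d [ac ad -> ->]]]] [[av' ->]|[c' [d' [ac' ad' -> ->]]]].
  - by left; rewrite phiM //; split=> //; apply: AM.
  - right; exists (v ** c'), d'; split; rewrite ?gmulA ?phiM //; exact: AM.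
  - right; exists c, (d ** v'); split; rewrite ?gmulA ?phiM ?gmulA //; exact: AM.
  have adc : A (d ** c') by apply: AM.
  have -> : c ** t ** d ** (c' ** t ** d') = c ** (t ** (d ** c') ** t) ** d' by rewrite !gmulA.
  have -> : phi c ** T ** phi d ** (phi c' ** T ** phi d') =
     phi c ** (T ** phi (d ** c') ** T) ** phi d' by rewrite phiM // !gmulA.
  (* If the middle factor lies in B, its conjugate by [t] lies in A. Otherwise it is u s u', and $t
     u s u' t = (t u t)(t s t)(t u' t)$ returns to AtA by the braid relation. *)
  case: (AB _ adc) => [/yB [_ h2 ->]|[u [u' [/yB [u1 u2 u3] /yB [v1 v2 v3] ->]]]].
    have ac2 := AM _ _ ac h2; left; split; first exact: AM _ _ ac2 ad'.
    by rewrite (phiM _ _ ac2 ad') (phiM _ _ ac h2).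
  have ac2 := AM _ _ ac u2; have ac3 := AM _ _ ac2 As.
  have ad2 := AM _ _ As v2; have ad3 := AM _ _ ad2 ad'.
  right; exists (c ** (t ** u ** t) ** s), (s ** (t ** u' ** t) ** d'); split=> //.
  - have -> : t ** (u ** s ** u') ** t = (t ** u ** t) ** (t ** s ** t) ** (t ** u' ** t).
      by rewrite !gmulA -(gmulA _ t t) tt gmulr1 -(gmulA _ t t) tt gmulr1.
    by rewrite tst !gmulA.
  rewrite (phiM _ _ (AM _ _ u1 As) v1) (phiM _ _ u1 As).
  have -> : T ** (phi u ** phi s ** phi u') ** T =
      (T ** phi u ** T) ** (T ** phi s ** T) ** (T ** phi u' ** T).
    by rewrite !gmulA -(gmulA _ T T) yT gmulr1 -(gmulA _ T T) yT gmulr1.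
  rewrite u3 v3 yS (phiM _ _ ac2 As) (phiM _ _ ac u2) (phiM _ _ ad2 ad') (phiM _ _ As v2).
  by rewrite !gmulA.
have RU v h k : Rl v h -> Rl v k -> h = k.
  move=> rh rk.
  have inv u g : Rl u g -> Rl (u^!) (g^!).
    move=> [[au ->]|[c [d [ac ad -> ->]]]].
      by left; rewrite phiV //; split=> //; apply: (sgV sA).
    right; exists (d^!), (c^!); rewrite !phiV // !ginvM TV tV !gmulA.
    by split=> //; apply: (sgV sA).
  (* The quotient of two values of [v] is a value of 1, and 1 is not in AtA because [t] is not in
     A. *)
  suff : h^! ** k = gone by move=> /ginv_uniq; rewrite ginvK.
  have := RM _ _ _ _ (inv _ _ rh) rk; rewrite gmulV.
  case=> [[_ ->]|[c [d [ac ad e _]]]] //.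
  case: At; have -> : t = c^! ** d^!.
    by apply: (@gmulI _ c); apply: (@gmulIr _ d); rewrite -e !gE.
  by apply: AM; apply: (sgV sA).
have [|//|//|//|psi [psiM psiR]] := @hom_of_rel X H V Rl.
- move=> v /VA [av|[c [d [ac ad ->]]]]; first by exists (phi v); left.
  by exists (phi c ** T ** phi d); right; exists c, d.
- exact: (sgM sV).
exists psi; split=> // i.
have Vx : V (x' i) by case: i => [i|] //=; apply: AV.
apply: (RU _ _ _ (psiR _ Vx)).
case: i {Vx} => [i|] /=; first by left; rewrite phix.
right; exists gone, gone; rewrite phi1 !gE; split=> //; exact: (sg1 sA).
Qed.

(** * Swaps of cones *)

Section Swaps.
Variables (m : nat).
Notation letter := 'I_m.+1.
Notation word := (seq letter).
Notation point := (stream letter).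
Notation homeo := (Bij point).
Implicit Types (f : homeo) (u v s : word) (x y z : point).

Definition perp u v := forall x y, scat u x <> scat v y.

Lemma perp_sym u v : perp u v -> perp v u.
Proof. by move=> h x y e; apply: (h y x). Qed.

Lemma perp_ext u v s s' : perp u v -> perp (u ++ s) (v ++ s').
Proof. by move=> h x y; rewrite !scat_cat; apply: h. Qed.

Lemma perp_common c u v : perp u v -> perp (c ++ u) (c ++ v).
Proof. by move=> h x y; rewrite !scat_cat => /scat_inj; apply: h. Qed.

Lemma perp1 (i j : letter) : i <> j -> perp [:: i] [:: j].
Proof. by move=> h x y e; apply: h; have [] := scons_inj e. Qed.

Lemma perp_size u v : size u = size v -> u <> v -> perp u v.
Proof. by move=> es ne x y e; apply: ne; have [] := scat_eq_size es e. Qed.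

Definition incone u z := exists y, z = scat u y.

Lemma incone_stake u z : incone u z <-> stake (size u) z = u.
Proof.
split=> [[y ->]|e]; last by exists (sdrop (size u) z); rewrite -{1}e scat_stake.
by have [] // := scat_eq_size _ (scat_stake (size u) (scat u y)); rewrite size_stake.
Qed.

Lemma incone_dec u z : {incone u z} + {~ incone u z}.
Proof. exact: excluded_middle_informative. Qed.

Definition swapf u v z : point :=
  if incone_dec u z then scat v (sdrop (size u) z)
  else if incone_dec v z then scat u (sdrop (size v) z) else z.

Lemma sdrop_scat u x : sdrop (size u) (scat u x) = x.
Proof. by apply: functional_extensionality => n; rewrite /sdrop; elim: u. Qed.

Lemma swapf_l u v x : swapf u v (scat u x) = scat v x.
Proof.
rewrite /swapf; case: incone_dec => [h|[]] /=; last by exists x.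
by rewrite sdrop_scat.
Qed.

Lemma swapf_r u v x : perp u v -> swapf u v (scat v x) = scat u x.
Proof.
move=> h; rewrite /swapf; case: incone_dec => [[y e]|n] /=; first by case: (h y x).
by case: incone_dec => [c|[]] /=; [rewrite sdrop_scat | exists x].
Qed.

Lemma swapf_out u v z : ~ incone u z -> ~ incone v z -> swapf u v z = z.
Proof. by move=> h1 h2; rewrite /swapf; case: incone_dec => // n; case: incone_dec. Qed.

Lemma swapfK u v : perp u v -> involutive (swapf u v).
Proof.
move=> h z; case: (incone_dec u z) => [[y ->]|h1]; first by rewrite swapf_l swapf_r.
case: (incone_dec v z) => [[y ->]|h2]; first by rewrite swapf_r // swapf_l.
by rewrite !swapf_out // swapf_out.
Qed.

(* The identity when the two cones are not disjoint. *)
Definition swap u v : homeo :=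
  match excluded_middle_informative (perp u v) with
  | left h => MkBij (swapfK h) (swapfK h)
  | right _ => gone
  end.

Lemma swapE u v z : perp u v -> bf (swap u v) z = swapf u v z.
Proof. by move=> h; rewrite /swap; case: excluded_middle_informative. Qed.

Lemma swap_l u v x : perp u v -> bf (swap u v) (scat u x) = scat v x.
Proof. by move=> h; rewrite swapE // swapf_l. Qed.
Lemma swap_r u v x : perp u v -> bf (swap u v) (scat v x) = scat u x.
Proof. by move=> h; rewrite swapE // swapf_r. Qed.
Lemma swap_out u v z : ~ incone u z -> ~ incone v z -> bf (swap u v) z = z.
Proof.
move=> h1 h2; case: (excluded_middle_informative (perp u v)) => h.
  by rewrite swapE // swapf_out.
by rewrite /swap; case: excluded_middle_informative.
Qed.

Lemma swap2 u v : swap u v ** swap u v = gone.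
Proof.
case: (excluded_middle_informative (perp u v)) => h; last first.
  by rewrite /swap; case: excluded_middle_informative => //= n; rewrite gmul1.
by apply: Bij_eq => z; rewrite bfM !swapE // swapfK.
Qed.

Lemma swapV u v : (swap u v)^! = swap u v.
Proof. by apply: ginv_uniq; apply: swap2. Qed.

Lemma swap_sym u v : swap u v = swap v u.
Proof.
case: (excluded_middle_informative (perp u v)) => h; last first.
  rewrite /swap; do 2!case: excluded_middle_informative => //.
  by move=> h'; case: h; apply: perp_sym.
have h' := perp_sym h; apply: Bij_eq => z.
case: (incone_dec u z) => [[y ->]|h1]; first by rewrite swap_l // swap_r.
case: (incone_dec v z) => [[y ->]|h2]; first by rewrite swap_r // swap_l.
by rewrite !swap_out.
Qed.

Lemma swap_conj f u v u' v' : perp u v ->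
  (forall x, bf f (scat u x) = scat u' x) -> (forall x, bf f (scat v x) = scat v' x) ->
  f ** swap u v ** f^! = swap u' v'.
Proof.
move=> h hu hv.
have h' : perp u' v' by move=> x y; rewrite -hu -hv => e; apply: (h x y); apply: bf_inj e.
apply: Bij_eq => z; rewrite -[z](bfKV f); move: (bf (f^!) z) => {}z.
rewrite !bfM bfVK.
case: (incone_dec u z) => [[y ->]|h1]; first by rewrite swap_l // hu hv swap_l.
case: (incone_dec v z) => [[y ->]|h2]; first by rewrite swap_r // hu hv swap_r.
rewrite swap_out // swap_out //.
  by move=> [y]; rewrite -hu => e; apply: h1; exists y; apply: bf_inj e.
by move=> [y]; rewrite -hv => e; apply: h2; exists y; apply: bf_inj e.
Qed.

Lemma swap1 (i j k : letter) x : i <> j ->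
  bf (swap [:: i] [:: j]) (scons k x) = scons (if k == i then j else if k == j then i else k) x.
Proof.
move=> ne; have h := perp1 ne; case: eqP => [->|ki]; first exact: (swap_l x h).
case: eqP => [->|kj]; first exact: (swap_r x h).
by apply: swap_out => -[y e]; have [] := scons_inj e.
Qed.

Variable K : selfsim m.

Lemma inV_swap u v : inV K (swap u v).
Proof.
case: (excluded_middle_informative (perp u v)) => h; last first.
  rewrite /swap; case: excluded_middle_informative => // n; exact: inV1.
exists (maxn (size u) (size v)) => w hw.
have key c : size c <= size w -> (exists s, w = c ++ s) \/ (forall y, ~ incone c (scat w y)).
  move=> hc; case: (take (size c) w =P c) => [e|ne].
    by left; exists (drop (size c) w); rewrite -{1}e cat_take_drop.
  right=> y [z e]; apply: ne; move: e; rewrite -{1}(cat_take_drop (size c) w) scat_cat.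
  by move=> /scat_eq_size []; rewrite ?size_takel.
case: (key u) => [|[s ->]|h1]; first by rewrite hw leq_maxl.
  by exists (v ++ s), gone => y; rewrite act1 !scat_cat swap_l.
case: (key v) => [|[s ->]|h2]; first by rewrite hw leq_maxr.
  by exists (u ++ s), gone => y; rewrite act1 !scat_cat swap_r.
by exists w, gone => y; rewrite act1 swap_out.
Qed.

End Swaps.

(** * Finite presentability of the Roever-Nekrashevych group *)

Section FpV.
Variables (m : nat) (K : selfsim m).
Hypothesis m_gt1 : 1 < m.
Notation letter := 'I_m.+1.
Notation word := (seq letter).
Notation point := (stream letter).
Notation homeo := (Bij point).
Notation pinf := (@pinf m).
Notation comb := (@comb m).
Implicit Types (f : homeo) (u v s : word) (x y z : point).

Let m_gt0 : 0 < m := ltnW m_gt1.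

Lemma pinfE : pinf = scons ord_max pinf.
Proof. by symmetry; apply: (scons_eta pinf). Qed.

Lemma act_pinf (g : K) : act g pinf = pinf.
Proof. by rewrite {1}pinfE act_last -pinfE. Qed.

Lemma inV_orbit f u : inV K f -> exists v, bf f (scat u pinf) = scat v pinf.
Proof.
move=> [N h].
have [|v [g e]] := @good_size m K f N (u ++ nseq N ord_max) h.
  by rewrite size_cat size_nseq leq_addl.
by exists v; have := e pinf; rewrite scat_cat scat_nseq_pinf act_pinf.
Qed.

Lemma stake_sep z z' : z <> z' -> exists n, forall k k', n <= k -> n <= k' ->
  perp (stake k z) (stake k' z').
Proof.
move=> ne.
have [i hi] : exists i, z i <> z' i.
  apply: NNPP => h; apply: ne; apply: functional_extensionality => i.
  by apply: NNPP => hi; apply: h; exists i.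
exists i.+1 => k k' hk hk' x y /(f_equal (fun c => c i)).
rewrite !(scat_nth _ ord0) ?size_stake // !nth_mkseq //.
Qed.

Lemma sdrop_orbit u n : size u <= n -> sdrop n (scat u pinf) = pinf.
Proof.
move=> h; rewrite -(subnKC h) -{1}(scat_nseq_pinf m (n - size u)) -scat_cat.
rewrite -{1}(size_nseq (n - size u) (@ord_max m)) -size_cat; exact: sdrop_scat.
Qed.

(** The swap of two small cones around the points does this. It makes A transitive on the rest of
    the orbit of [pinf], and the stabiliser of [qpt] in A transitive on what then remains. *)
Lemma orbit_move u1 u2 c1 c2 :
  scat u1 pinf <> c1 -> scat u2 pinf <> c1 -> scat u1 pinf <> c2 -> scat u2 pinf <> c2 ->
  exists a, [/\ inV K a, bf a (scat u1 pinf) = scat u2 pinf, bf a c1 = c1 & bf a c2 = c2].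
Proof.
move=> h11 h21 h12 h22.
case: (excluded_middle_informative (scat u1 pinf = scat u2 pinf)) => [e|ne].
  by exists gone; rewrite bf1; split=> //; apply: inV1.
have [n1 p1] := stake_sep h11; have [n2 p2] := stake_sep h21.
have [n3 p3] := stake_sep h12; have [n4 p4] := stake_sep h22.
have [n5 p5] := stake_sep ne.
(* Deep enough to separate all pairs of points concerned and to reach the common tail [pinf] of the
   two points to be moved. *)
pose n := n1 + n2 + n3 + n4 + n5 + size u1 + size u2.
pose a := swap (stake n (scat u1 pinf)) (stake n (scat u2 pinf)).
have pp : perp (stake n (scat u1 pinf)) (stake n (scat u2 pinf)) by apply: p5; lia.
have nin z c : (exists n0, n0 <= n /\ forall k k', n0 <= k -> n0 <= k' -> perp (stake k z) (stake k' c)) ->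
    ~ incone (stake n z) c.
  move=> [n0 [h0 p]] [y e]; apply: (p n n h0 h0 y (sdrop n c)).
  by rewrite scat_stake.
exists a; split.
- exact: inV_swap.
- rewrite -{1}(scat_stake n (scat u1 pinf)) swap_l //.
  rewrite sdrop_orbit; last by lia.
  by rewrite -{2}(scat_stake n (scat u2 pinf)) sdrop_orbit //; lia.
- by apply: swap_out; apply: nin; [exists n1 | exists n2]; split=> //; lia.
by apply: swap_out; apply: nin; [exists n3 | exists n4]; split=> //; lia.
Qed.

Definition l0 : letter := ord0.
Definition l1 : letter := inord 1.
Definition lm : letter := ord_max.
Lemma l01 : l0 <> l1.
Proof. by move=> /(f_equal val) /=; rewrite inordK; lia. Qed.
Lemma l0m : l0 <> lm.
Proof. by move=> /(f_equal val) /=; lia. Qed.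
Lemma l1m : l1 <> lm.
Proof. by move=> /(f_equal val) /=; rewrite inordK; lia. Qed.

Definition qpt : point := scons l0 pinf.
Definition rpt : point := scons l1 pinf.
Definition tV := swap [:: l0] [:: lm].
Definition sV := swap [:: l0] [:: l1].

Lemma p_q : pinf <> qpt.
Proof. by rewrite pinfE => e; have [/esym/l0m] := scons_inj e. Qed.
Lemma p_r : pinf <> rpt.
Proof. by rewrite pinfE => e; have [/esym/l1m] := scons_inj e. Qed.
Lemma q_r : qpt <> rpt.
Proof. by move=> e; have [/l01] := scons_inj e. Qed.

Lemma tV_p : bf tV pinf = qpt.
Proof. by rewrite {1}pinfE (swap1 _ _ l0m) eqxx; case: eqP => // /esym/l0m. Qed.
Lemma tV_q : bf tV qpt = pinf.
Proof. by rewrite (swap1 _ _ l0m) eqxx -pinfE. Qed.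
Lemma sV_q : bf sV qpt = rpt.
Proof. by rewrite (swap1 _ _ l01) eqxx. Qed.
Lemma sV_p : bf sV pinf = pinf.
Proof.
rewrite {1}pinfE (swap1 _ _ l01); case: eqP => [/esym/l0m //|_].
by case: eqP => [/esym/l1m //|_]; rewrite -pinfE.
Qed.

Lemma braid_ts : tV ** sV ** tV = sV ** tV ** sV.
Proof.
apply: Bij_eq => z; rewrite -[z]scons_eta !bfM; move: (z 0) (stl z) => k x.
rewrite !(swap1 _ _ l0m, swap1 _ _ l01); congr (scons _ x).
have := l01; have := l0m; have := l1m; move: l0 l1 lm => a b c n1 n2 n3.
by do !(case: eqP => //=); congruence.
Qed.

Definition inB f := inA K f /\ bf f qpt = qpt.

Lemma sub_inB : is_subgroup inB.
Proof.
have sA := sub_inA K; split; first by split; [apply: (sg1 sA) | ].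
  by move=> f f' [h e] [h' e']; split; [apply: (sgM sA) | rewrite bfM e' e].
by move=> f [h e]; split; [apply: (sgV sA) | rewrite -{1}e bfVK].
Qed.

Lemma inA_sV : inA K sV.
Proof. by split; [apply: inV_swap | apply: sV_p]. Qed.

Notation lamC := (lamC K m_gt0).
Notation tauC := (tauC K m_gt0).
Notation kapC := (@kapC m K m_gt0).

(** The cone [[:: l0]] is split and its last child, the one containing [qpt], is brought to the
    first place, so this is a shift near [qpt]. Its powers supply the germs at [qpt], where the
    generators of index at least 1 are trivial. *)
Definition zV : homeo := @repC m K m_gt0 [::] (map (@Tau _ K) (iota 0 m)) [:: 0].

Lemma comb0 : comb 0 = [:: l0].
Proof. by rewrite /comb div0n mod0n /=; congr [:: _]; apply: val_inj; rewrite /= inordK. Qed.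

Lemma zV_cone y : bf zV (scons l0 (scons lm y)) = scons l0 y.
Proof.
have [_ /(_ m y)] := @repCP m K m_gt0 [::] (map (@Tau _ K) (iota 0 m)) [:: 0].
rewrite pw_Tau lb_Tau act1 pwt_iota add0n eqxx /leaves splits_cons /=.
have := @split1_blk m comb 0 ord_max; rewrite add0n /= => ->.
by rewrite comb0.
Qed.

Lemma zV_A : inA K zV.
Proof. exact: (rep_inA m_gt0 (repCP m_gt0 _ _ _)). Qed.

Lemma zV_iter n y : bf (iter n (gmul zV) gone) (scons l0 (scat (nseq n lm) y)) = scons l0 y.
Proof.
elim: n y => [|n IH] y //; rewrite iterS bfM (_ : nseq n.+1 lm = nseq n lm ++ [:: lm]) ?scat_cat ?IH; last first.
  by rewrite -[[:: lm]]/(nseq 1 lm) -nseqD addn1.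
exact: zV_cone.
Qed.

Theorem inB_fg : fp_on (fun _ : K => True) ->
  exists (J : finType) (b : J -> homeo), (forall j, inB (b j)) /\ (forall g, inB g -> gen b g).
Proof.
move=> [I [x [_ [_ _ xg _ _]]]].
have R := splitC K m_gt0.
(* The indices 1 to m + 1 suffice, since conjugation by [lamC 1] shifts the indices from 2 on by
   m. *)
pose b (j : ((letter + letter) + (I + unit))%type) : homeo := match j with
  | inl (inl k) => lamC k.+1 | inl (inr k) => tauC k.+1
  | inr (inl k) => kapi tauC kapC 1 (x k) | inr (inr _) => zV end.
exists (((letter + letter) + (I + unit))%type : finType), b; split.
  have fixq (f : homeo) w L : rep (K := K) f [::] w L -> pw w 0 = 0 -> lb w 0 = gone ->
      leaves m L 0 = comb 0 -> inB f.
    move=> r e1 e2 e3; split; first exact: (rep_inA m_gt0 r).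
    by have := r.2 0 pinf; rewrite e1 e2 e3 act1 /leaves /= comb0.
  case=> [[k|k]|[k|[]]] /=.
  - by apply: (fixq _ _ _ (repCP m_gt0 [::] [::] [:: k.+1])).
  - by apply: (fixq _ _ _ (repCP m_gt0 [::] [:: Tau K k.+1] [::])) => //=; rewrite gmul1.
  - apply: (fixq _ [:: Kap 1 (x k)] [::]) => //=; last by rewrite gmul1.
    have := evC_rep m_gt0 [:: Kap 1 (x k)]; rewrite /= gmulr1; exact.
  split; first exact: zV_A.
  rewrite /qpt; have := zV_cone pinf; rewrite -[scons lm pinf]pinfE; exact.
have gl j : 0 < j -> gen b (lamC j).
  elim/ltn_ind: j => j IH j0; case: (leqP j m.+1) => hj.
    have hk : j.-1 < m.+1 by lia.
    by have := gen_gen b (inl (inl (Ordinal hk))); rewrite /b /= prednK.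
  have e := sr_lam R (_ : 1 < j - m); rewrite subnK in e; last by lia.
  rewrite (tkE (e _)); last by lia.
  have g1 : gen b (lamC 1) by apply: IH; lia.
  by apply: genM; [apply: genM => //; apply: IH; lia | apply: genV].
have gt j : 0 < j -> gen b (tauC j).
  elim/ltn_ind: j => j IH j0; case: (leqP j m.+1) => hj.
    have hk : j.-1 < m.+1 by lia.
    by have := gen_gen b (inl (inr (Ordinal hk))); rewrite /b /= prednK.
  have e : tk (lamC 1) (tauC (j - m)) (tauC j).
    rewrite -{2}(@subnK m j); last by lia.
    by apply: (lam_tau m_gt0 (split_base m_gt0 x R)); lia.
  rewrite (tkE e).
  have g1 : gen b (lamC 1) by apply: gl.
  by apply: genM; [apply: genM => //; apply: IH; lia | apply: genV].
have gk j g : 0 < j -> gen b (kapi tauC kapC j g).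
  case: j => // j _; elim: j => [|j IH].
    have hom := kapi_hom R 1.
    apply: (@gen_ind _ _ x (fun g => gen b (kapi tauC kapC 1 g)) _ _ _ _ g (xg g Logic.I)).
    - by rewrite (hom1 hom); apply: gen1.
    - by move=> c d hc hd; rewrite hom; apply: genM.
    - by move=> c hc; rewrite (homV hom); apply: genV.
    by move=> k; apply: (gen_gen b (inr (inl k))).
  rewrite [kapi _ _ _ _]/=.
  by apply: genM; [apply: genM => //|]; apply: gt.
have gz n : gen b (iter n (gmul zV) gone).
  elim: n => [|n IH]; first exact: gen1.
  by rewrite iterS; apply: genM => //; apply: (gen_gen b (inr (inr tt))).
have Az n : inA K (iter n (gmul zV) gone).
  elim: n => [|n IH]; first exact: (sg1 (sub_inA K)).
  by rewrite iterS; apply: (sgM (sub_inA K)) => //; apply: zV_A.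
move=> f [fA fq].
have [n [c hc]] := @germ_shift m K f [:: l0] fA.1 fq.
set Zn := iter n (gmul zV) gone; set Zc := iter c (gmul zV) gone.
(* Powers of [zV] on both sides make the element trivial on the whole cone [[:: l0]], so that
   [rep_total] applies with o = 1. *)
pose f' := Zc ** f ** Zn^!.
have ZnA : inA K Zn := Az n.
have ZcA : inA K Zc := Az c.
have f'A : inA K f'.
  by apply: (sgM (sub_inA K)); [apply: (sgM (sub_inA K)) | apply: (sgV (sub_inA K))].
have f'0 k : k < 1 -> forall y, bf f' (scat (comb k) y) = scat (comb k) y.
  case: k => // _ y; rewrite comb0 /f' !bfM.
  have -> : bf (Zn^!) (scat [:: l0] y) = scat [:: l0] (scat (nseq n lm) y).
    by rewrite -[scat _ y](zV_iter n y) bfVK.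
  by rewrite hc; apply: zV_iter.
have [L1 [w [L2 [o1 o2 ow r]]]] := rep_total m_gt0 f'A f'0.
have -> : f = Zc^! ** f' ** Zn by rewrite /f' !gE.
apply: genM; last exact: gz.
apply: genM; first by apply: genV; apply: gz.
rewrite (rep_val m_gt0 r) /repval.
have gL L : all (leq 1) L -> gen b (evl lamC L).
  elim: L => [|i L IH] //=; first by move=> _; apply: gen1.
  by move=> /andP [hi /IH hL]; apply: genM => //; apply: gl.
apply: genM; last exact: gL.
apply: genM; first by apply: genV; apply: gL.
elim: w ow {r} => [|a w IH] /=; first by move=> _; apply: gen1.
move=> /andP [ha /IH hw]; apply: genM => //.
by case: a ha => [i|i g] /= hi; [apply: gt | apply: gk].
Qed.

Lemma inV_form g : inV K g ->
  inA K g \/ exists c d, [/\ inA K c, inA K d & g = c ** tV ** d].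
Proof.
have tt : tV ** tV = gone by apply: swap2.
move=> gV; case: (excluded_middle_informative (bf g pinf = pinf)) => [e|ne]; first by left.
right; have [v hv] := inV_orbit [::] gV; rewrite /= in hv.
case: (excluded_middle_informative (bf g pinf = qpt)) => [e|nq].
  exists gone, (tV ** g); split; last by rewrite gmul1 gmulA tt gmul1.
    exact: (sg1 (sub_inA K)).
  by split; [apply: inVM => //; apply: inV_swap | rewrite bfM e tV_q].
have [||||a [aV ar ap _]] := @orbit_move [:: l0] v pinf pinf; try by move=> e; apply: p_q.
- by rewrite -hv.
- by rewrite -hv.
exists a, (tV ** a^! ** g); split.
- by split.
- split; last by rewrite !bfM hv -ar bfVK tV_q.
  by apply: inVM => //; apply: inVM; [apply: inV_swap | apply: inVV].
by rewrite !gmulA -(gmulA _ tV tV) tt !gE.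
Qed.

Theorem fp_inV : fp_on (fun _ : K => True) -> fp_on (inV K).
Proof.
move=> fpK; have [J [b [Bb bg]]] := inB_fg fpK.
have tt : tV ** tV = gone by apply: swap2.
have orbq : qpt = scat [:: l0] pinf by [].
have orbr : rpt = scat [:: l1] pinf by [].
apply: (@fp_triple _ _ (inA K) inB tV sV J b) => //.
- exact: sub_inV.
- exact: sub_inA.
- exact: sub_inB.
- by move=> g [].
- by move=> g [].
- exact: inV_swap.
- exact: inA_sV.
- by move=> [_]; rewrite tV_p => e; apply: p_q.
- exact: (fp_inA m_gt0 fpK).
- move=> g [[gV gp] gq]; split; last by rewrite !bfM tV_p gq tV_q.
  by do 2?apply: inVM => //; apply: inV_swap.
- exact: braid_ts.
- move=> g gA; have [gV gp] := gA.
  case: (excluded_middle_informative (bf g qpt = qpt)) => [e|ne]; first by left.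
  right; have [v hv] := inV_orbit [:: l0] gV.
  have [||||a [aV ar ap aq]] := @orbit_move [:: l1] v pinf qpt.
  - by move=> e; apply: p_r.
  - by rewrite -hv -[RHS]gp => e; apply: p_q; symmetry; apply: bf_inj e.
  - by move=> e; apply: q_r.
  - by rewrite -hv.
  have aA : inA K a by split.
  have aB : inB a by split.
  exists a, (sV^! ** a^! ** g); split=> //; last by rewrite !gE.
  have sAA := sub_inA K; split.
    apply: (sgM sAA) => //; apply: (sgM sAA); apply: (sgV sAA) => //; exact: inA_sV.
  rewrite -orbq in hv; rewrite !bfM hv -ar bfVK -orbr -sV_q bfVK.
  by [].
exact: inV_form.
Qed.

End FpV.

(** * Simplicity *)

Section SwapProducts.
Variables (m : nat) (T : eqType) (u v : T -> seq 'I_m.+1).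
Notation point := (stream 'I_m.+1).
Implicit Types (s : seq T) (z x : point).

Definition sprod s : Bij point := foldr (fun i acc => swap (u i) (v i) ** acc) gone s.

Lemma sprod_cons i s : sprod (i :: s) = swap (u i) (v i) ** sprod s.
Proof. by []. Qed.

Lemma sprod_out s z : (forall i, i \in s -> ~ incone (u i) z /\ ~ incone (v i) z) ->
  bf (sprod s) z = z.
Proof.
elim: s => [|i s IH] h //; rewrite sprod_cons bfM IH.
  by have [h1 h2] := h i (mem_head _ _); apply: swap_out.
by move=> j hj; apply: h; rewrite inE hj orbT.
Qed.

Hypothesis uv : forall i j, perp (u i) (v j).
Hypothesis uu : forall i j, i <> j -> perp (u i) (u j).
Hypothesis vv : forall i j, i <> j -> perp (v i) (v j).

Lemma sprod_in s i x : uniq s -> i \in s ->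
  bf (sprod s) (scat (u i) x) = scat (v i) x /\ bf (sprod s) (scat (v i) x) = scat (u i) x.
Proof.
elim: s => // j s IH; rewrite cons_uniq sprod_cons => /andP [js us]; rewrite inE => /orP [/eqP ->|is_].
  have ne k : k \in s -> k <> j by move=> ks e; move: js; rewrite -e ks.
  rewrite !bfM !sprod_out; first by rewrite swap_l ?swap_r.
    move=> k /ne kj; split=> -[y e]; first exact: (uv (esym e)).
    by case: (vv kj (esym e)).
  move=> k /ne kj; split=> -[y e]; last exact: (uv e).
  by case: (uu kj (esym e)).
have ne : i <> j by move=> e; move: js; rewrite -e is_.
have [e1 e2] := IH us is_.
rewrite !bfM e1 e2; split; apply: swap_out => -[y e].
- exact: (uv (esym e)).
- exact: (vv ne e).
- exact: (uu ne e).
exact: (uv e).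
Qed.

End SwapProducts.

Section Simplicity.
Variables (m : nat) (K : selfsim m).
Hypothesis m_gt2 : 2 < m.
Hypothesis m_odd : odd m.
Notation letter := 'I_m.+1.
Notation word := (seq letter).
Notation point := (stream letter).
Notation homeo := (Bij point).
Notation pinf := (@pinf m).
Notation comb := (@comb m).
Implicit Types (f a b c d e : homeo) (u v s : word) (x y z : point).

Let m_gt1 : 1 < m := ltnW m_gt2.
Let m_gt0 : 0 < m := ltnW m_gt1.

Lemma swap_split u v : perp u v ->
  swap u v = sprod (fun i => rcons u i) (fun i => rcons v i) (enum letter).
Proof.
move=> h; apply: Bij_eq => z.
have uv i j : perp (rcons u i) (rcons v j) by rewrite -!cats1; apply: perp_ext.
have ne (c : word) i j : i <> j -> perp (rcons c i) (rcons c j).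
  by move=> ij; rewrite -!cats1; apply: perp_common; apply: perp1.
have key i x := @sprod_in m letter (fun i => rcons u i) (fun i => rcons v i) uv (ne u) (ne v)
  (enum letter) i x (enum_uniq _) (mem_enum _ i).
case: (incone_dec u z) => [[y ->]|h1].
  by rewrite swap_l // -(scons_eta y) -!scat_rcons (key _ _).1.
case: (incone_dec v z) => [[y ->]|h2].
  by rewrite swap_r // -(scons_eta y) -!scat_rcons (key _ _).2.
rewrite swap_out // sprod_out // => i _; split=> -[y e]; [apply: h1 | apply: h2];
  by exists (scons i y); rewrite -scat_rcons.
Qed.

Lemma avoid (l : seq letter) : size l <= 3 -> exists i, i \notin l.
Proof.
move=> hl; apply: NNPP => h.
have sub : {subset enum letter <= l}.
  by move=> i _; apply: NNPP => hi; apply: h; exists i; apply/negP.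
have := uniq_leq_size (enum_uniq letter) sub; rewrite size_enum_ord => h2.
by have := leq_trans h2 hl; rewrite ltnS leqNgt m_gt2.
Qed.

(* Two instances of "a class function which is multiplicative along the wreath recursion is
   trivial" that suffice to kill the labels in every proper quotient. *)
Definition killing := forall Z : K -> Prop, Z gone ->
  (forall g h, Z g -> Z h -> Z (g ** h)) ->
  (forall g i, (forall j, j <> i -> Z (ks g j)) -> Z g -> Z (ks g i)) ->
  (forall g i i', i <> i' -> ks g i' = g ->
     (forall j, j <> i -> j <> i' -> Z (ks g j)) -> Z (ks g i)) ->
  forall g, Z g.

Section Normal.
Variable N : homeo -> Prop.
Hypothesis N1 : N gone.
Hypothesis NM : forall a b, N a -> N b -> N (a ** b).
Hypothesis NV : forall a, N a -> N (a^!).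
Hypothesis NJ : forall a c, N a -> inV K c -> N (c ** a ** c^!).

Definition eqN a b := N (a ** b^!).

Lemma eqN_refl a : eqN a a.
Proof. by rewrite /eqN gmulrV. Qed.
Lemma eqN_sym a b : eqN a b -> eqN b a.
Proof. by move=> /NV; rewrite ginvM ginvK. Qed.
Lemma eqN_trans a b c : eqN a b -> eqN b c -> eqN a c.
Proof. by move=> h h'; have := NM h h'; rewrite /eqN !gE. Qed.
Lemma eqN_mul a a' b b' : inV K a' -> eqN a a' -> eqN b b' -> eqN (a ** b) (a' ** b').
Proof.
move=> va h h'; have := NM h (NJ h' va); rewrite /eqN !gE //.
Qed.
Lemma N_eqN a b : eqN a b -> N b -> N a.
Proof. by move=> h h'; have := NM h h'; rewrite !gE. Qed.
Lemma eqN1 a : N a -> eqN a gone.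
Proof. by rewrite /eqN ginv1 gmulr1. Qed.

Lemma comm_supp (U : point -> Prop) d e :
  (forall z, ~ U z -> bf e z = z) -> (forall z, U z -> bf d z = z) -> d ** e = e ** d.
Proof.
move=> he hd; apply: Bij_eq => z; rewrite !bfM.
case: (excluded_middle_informative (U z)) => uz.
  rewrite (hd z uz) hd //; apply: NNPP => h; have e1 := bf_inj (he _ h).
  by apply: h; rewrite e1.
rewrite (he z uz) he //; move=> h; have e1 := bf_inj (hd _ h).
by apply: uz; rewrite -e1.
Qed.

(** * Commutators and swaps, given an element that displaces a cone *)

Section Displaced.
Variables (f : homeo) (u : word).
Hypothesis fN : N f.
Hypothesis fu : forall y y', bf f (scat u y) <> scat u y'.

(** The conjugate [d] of [a] by [f] is trivial on the cone of [u], so it commutes with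
    [a^! ** b ** a]. The element in question is therefore the commutator of [d ** a^!], which lies
    in [N], with [b]. *)
Lemma N_comm a b : inV K a -> inV K b ->
  (forall z, ~ incone u z -> bf a z = z) -> (forall z, ~ incone u z -> bf b z = z) ->
  N (a^! ** b ** a ** b^!).
Proof.
move=> aV bV ha hb; pose d := f ** a ** f^!.
have dN : N (d ** a^!).
  have -> : d ** a^! = f ** (a ** f^! ** a^!) by rewrite /d !gE.
  by apply: NM => //; apply: NJ => //; apply: NV.
have haV z : ~ incone u z -> bf (a^!) z = z by move=> h; rewrite -{1}(ha z h) bfVK.
have c : d ** (a^! ** b ** a) = (a^! ** b ** a) ** d.
  apply: (comm_supp (U := incone u)).
    by move=> z h; rewrite !bfM (ha z h) (hb z h) haV.
  move=> z [y ->]; rewrite /d !bfM ha ?bfKV // => -[y' e].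
  by apply: (fu (y := y') (y' := y)); rewrite -e bfKV.
have -> : a^! ** b ** a ** b^! = (d ** a^!) ** (b ** (d ** a^!)^! ** b^!).
  have -> : a^! ** b ** a = d ** (a^! ** b ** a) ** d^! by rewrite c gmulK.
  by rewrite !gE.
by apply: NM => //; apply: NJ => //; apply: NV.
Qed.

Lemma swap_supp (x y : word) z : ~ incone u z -> bf (swap (u ++ x) (u ++ y)) z = z.
Proof.
move=> h; apply: swap_out => -[t e]; apply: h; rewrite scat_cat in e; eexists; exact: e.
Qed.

(** This is [N_comm] for the swaps of x, y and of y, w: the first conjugates the second into the
    swap of x, w. *)
Lemma N_triple (x y w : word) : perp x y -> perp y w -> perp x w ->
  N (swap (u ++ x) (u ++ w) ** swap (u ++ y) (u ++ w)).
Proof.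
move=> xy yw xw.
have := @N_comm (swap (u ++ x) (u ++ y)) (swap (u ++ y) (u ++ w)) (inV_swap K _ _) (inV_swap K _ _)
  (@swap_supp x y) (@swap_supp y w).
have pc (a b : word) : perp a b -> perp (u ++ a) (u ++ b) by apply: perp_common.
have -> : (swap (u ++ x) (u ++ y))^! ** swap (u ++ y) (u ++ w) ** swap (u ++ x) (u ++ y) =
   swap (u ++ x) (u ++ w).
  have := @swap_conj _ (swap (u ++ x) (u ++ y)) (u ++ y) (u ++ w) (u ++ x) (u ++ w).
  rewrite swapV; apply; first exact: pc.
    by move=> z; rewrite swap_r //; apply: pc.
  move=> z; apply: swap_out => -[t e]; first by case: (pc _ _ xw _ _ (esym e)).
  by case: (pc _ _ yw _ _ (esym e)).
by rewrite swapV.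
Qed.

(** Modulo [N] every factor equals the involution [e], so factors disappear in pairs. *)
Lemma N_even (T : Type) (l : seq T) (a : T -> homeo) e : inV K e -> e ** e = gone ->
  (forall i, N (a i ** e)) -> ~~ odd (size l) -> N (foldr (fun i acc => a i ** acc) gone l).
Proof.
move=> eV ee h.
have eV' : e^! = e by apply: ginv_uniq.
suff H n : forall l, size l <= n -> ~~ odd (size l) -> N (foldr (fun i acc => a i ** acc) gone l).
  by apply: (H (size l)).
elim: n => [|n IH] [|i [|j l']] //= hl od.
rewrite negbK in od.
have -> : forall r : homeo, a i ** (a j ** r) = (a i ** e) ** (e ** (a j ** e) ** e^!) ** r.
  by move=> r; rewrite !gmulA eV' -!(gmulA _ e e) ee !gmulr1.
apply: NM; last by apply: IH => //; lia.
by apply: NM => //; apply: NJ.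
Qed.

Lemma N_swap_in (x y : word) : perp x y -> N (swap (u ++ x) (u ++ y)).
Proof.
move=> xy; rewrite swap_split; last exact: perp_common.
have rc (c : word) i : rcons (u ++ c) i = u ++ rcons c i by rewrite rcons_cat.
pose e := swap (u ++ rcons x ord0) (u ++ rcons y ord0).
have pxy i j : perp (rcons x i) (rcons y j) by rewrite -!cats1; apply: perp_ext.
have ne (c : word) i j : i <> j -> perp (rcons c i) (rcons c j).
  by move=> ij; rewrite -!cats1; apply: perp_common; apply: perp1.
(* The swap of the children number [i] is congruent to [e] via a third swap that shares one cone
   with each; the number m + 1 of children is even. *)
apply: (@N_even _ _ _ e); [exact: inV_swap | exact: swap2 | | by rewrite size_enum_ord /= m_odd].
move=> i; rewrite !rc /e; case: (i =P ord0) => [->|i0]; first by rewrite swap2.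
have h1 : N (swap (u ++ rcons x i) (u ++ rcons y i) ** swap (u ++ rcons x ord0) (u ++ rcons y i)).
  by apply: N_triple => //; apply: ne.
have h2 : N (swap (u ++ rcons x ord0) (u ++ rcons y i) ** swap (u ++ rcons x ord0) (u ++ rcons y ord0)).
  rewrite swap_sym (swap_sym _ (u ++ rcons y ord0)).
  by apply: N_triple; [apply: ne | apply: perp_sym | apply: perp_sym].
have := NM h1 h2; rewrite !gmulA; set S := swap (u ++ rcons x ord0) (u ++ rcons y i).
by rewrite -(gmulA _ S S) swap2 gmulr1.
Qed.

(** Short words are split until both are longer than [u]. Then two children of [u] are disjoint from
    both cones, and an element of V carries these children onto [v] and [w]. *)
Lemma N_swap_all v w : perp v w -> N (swap v w).
Proof.
suff H n : forall v w, perp v w -> size u < size v + n -> size u < size w + n -> N (swap v w).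
  by move=> h; apply: (H (size u).+1) => //; lia.
elim: n => [|n IH] {v w} v w vw; last first.
  move=> hv hw; rewrite swap_split //.
  have h i : N (swap (rcons v i) (rcons w i)).
    apply: IH; rewrite ?size_rcons; try lia.
    by rewrite -!cats1; apply: perp_ext.
  by elim: (enum letter) => [|i l IHl] //=; apply: NM.
rewrite !addn0 => hv hw.
have sep (c : word) i : size u < size c -> i <> nth ord0 c (size u) -> perp (u ++ [:: i]) c.
  move=> hc ne; rewrite -(cat_take_drop (size u).+1 c) -[u ++ _]cats0.
  apply: perp_ext; apply: perp_size; first by rewrite size_cat addn1 size_takel.
  rewrite cats1 (take_nth ord0) // => /rcons_inj [_ e].
  exact: ne.
(* Two new letters are chosen, different from the letters of [v] and [w] at position [size u]; the
   second choice avoids three letters, so at least four are required. *)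
have [i hi] := @avoid [:: nth ord0 v (size u); nth ord0 w (size u)] isT.
have [j hj] := @avoid [:: nth ord0 v (size u); nth ord0 w (size u); i] isT.
move: hi hj; rewrite !inE !negb_or => /andP [/eqP iv /eqP iw] /and3P [/eqP jv /eqP jw /eqP ji].
have [piv piw] := (sep v i hv iv, sep w i hw iw).
have [pjv pjw] := (sep v j hv jv, sep w j hw jw).
have pij : perp (u ++ [:: i]) (u ++ [:: j]) by apply/perp_common/perp1 => e; apply: ji.
pose g := swap (u ++ [:: i]) v ** swap (u ++ [:: j]) w.
rewrite -(@swap_conj _ g (u ++ [:: i]) (u ++ [:: j]) v w) //.
- apply: NJ; first by apply: N_swap_in; apply: perp1 => e; apply: ji.
  by apply: inVM; apply: inV_swap.
- move=> x; rewrite /g bfM.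
  have -> : bf (swap (u ++ [:: j]) w) (scat (u ++ [:: i]) x) = scat (u ++ [:: i]) x.
    by apply: swap_out => -[y e]; [apply: (pij x y) | apply: (piw x y)].
  exact: swap_l.
move=> x; rewrite /g bfM swap_l //; apply: swap_out => -[y e]; first by apply: (piw y x).
by apply: (vw y x).
Qed.

(** * All generators lie in the normal subgroup *)

Notation lamC := (lamC K m_gt0).
Notation tauC := (tauC K m_gt0).
Notation kapC := (@kapC m K m_gt0).

Lemma comb_small (i : letter) : i < m -> comb i = [:: i].
Proof.
move=> h; rewrite /comb divn_small // modn_small //=; congr [:: _].
by rewrite inord_val.
Qed.

Lemma N_tau j : N (tauC j).
Proof.
have pp : perp (comb j) (comb j.+1).
  by move=> x y; apply: lex_stream; apply: srt_comb.
suff -> : tauC j = swap (comb j) (comb j.+1) by apply: N_swap_all.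
apply: Bij_eq => z; case: (excluded_middle_informative (z = pinf)) => [->|nz].
  rewrite tauC_pinf swap_out // => -[y /esym]; exact: nop_comb.
have [l [y ->]] := cover_comb m_gt0 nz.
rewrite (@tauC_maps m K m_gt0 j l y) /= gmul1 act1.
case: (tpP j l) => [[-> ->]|[-> ->]|[h1 h2 ->]].
- by rewrite swap_l.
- by rewrite swap_r.
rewrite swap_out // => -[y' e]; [apply: h1 | apply: h2]; exact: (srt_disj (srt_comb m_gt0) e).
Qed.

Lemma lamC0_head (i : letter) y : bf (lamC 0) (scat [:: l0 m; i] y) = scat (comb i) y.
Proof.
have := @lamC_maps m K m_gt0 0 i y; rewrite /= act1.
by have := @split1_blk m comb 0 i; rewrite add0n => ->; rewrite comb0.
Qed.

Lemma lamC0_comb l y : 0 < l -> bf (lamC 0) (scat (comb l) y) = scons (lm m) (scat (comb l) y).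
Proof.
move=> lpos; have := @lamC_maps m K m_gt0 0 (l + m) y; rewrite /= act1.
have := @split1_dl m m_gt0 comb 0 l; rewrite /dl /= => -> //; last by lia.
move=> ->; have := @nseq_comb m m_gt0 1 l; rewrite mul1n addnC => <-.
by [].
Qed.

(** [lamC 0] only replaces prefixes, without labels, and is an explicit product of swaps: [tV]
    exchanges 0 and m, [beta] exchanges j and mj for the other letters j, then [S2] and [S1] put the
    cones 0, m0 and mm in place. *)
Lemma N_lam0 : N (lamC 0).
Proof.
pose us (j : letter) := [:: j]; pose vs (j : letter) := [:: lm m; j].
pose beta := sprod (fun j : {j | (j != l0 m) && (j != lm m)} => us (val j))
  (fun j => vs (val j)) (enum {: {j : letter | (j != l0 m) && (j != lm m)}}).
have uv (i j : {j | (j != l0 m) && (j != lm m)}) : perp (us (val i)) (vs (val j)).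
  move=> x y e; have [e1 _] := scons_inj e; have /andP [_ /eqP] := valP i; exact.
have uu (i j : {j | (j != l0 m) && (j != lm m)}) : i <> j -> perp (us (val i)) (us (val j)).
  by move=> ij; apply: perp1 => /val_inj.
have vv (i j : {j | (j != l0 m) && (j != lm m)}) : i <> j -> perp (vs (val i)) (vs (val j)).
  by move=> ij; apply: (@perp_common _ [:: lm m]); apply: perp1 => /val_inj.
have b_in (j : letter) x : j != l0 m -> j != lm m ->
    bf beta (scons j x) = scons (lm m) (scons j x) /\ bf beta (scons (lm m) (scons j x)) = scons j x.
  move=> h1 h2; have h : (j != l0 m) && (j != lm m) by rewrite h1.
  exact: (@sprod_in _ _ _ _ uv uu vv _ (exist _ j h) x (enum_uniq _) (mem_enum _ _)).
have b_out z : z 0 = l0 m \/ z 0 = lm m -> (z 0 = lm m -> z 1 = l0 m \/ z 1 = lm m) ->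
    bf beta z = z.
  move=> h1 h2; apply: sprod_out => -[j hj] _; move: hj => /= /andP [/eqP j1 /eqP j2].
  split=> -[y e]; rewrite e /= in h1 h2; first by case: h1.
  by case: (h2 erefl).
have c1 : perp [:: l0 m] [:: lm m; l0 m].
  by move=> x y e; have [/(l0m m_gt1)] := scons_inj e.
have c2 : perp [:: l0 m] [:: lm m; lm m].
  by move=> x y e; have [/(l0m m_gt1)] := scons_inj e.
have tp0 := perp1 (l0m m_gt1).
have nm0 := l0m m_gt1.
pose S1 := swap [:: l0 m] [:: lm m; l0 m]; pose S2 := swap [:: l0 m] [:: lm m; lm m].
have S1_0 x : bf S1 (scons (l0 m) x) = scons (lm m) (scons (l0 m) x) := swap_l x c1.
have S1_m0 x : bf S1 (scons (lm m) (scons (l0 m) x)) = scons (l0 m) x := swap_r x c1.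
have S2_0 x : bf S2 (scons (l0 m) x) = scons (lm m) (scons (lm m) x) := swap_l x c2.
have S2_mm x : bf S2 (scons (lm m) (scons (lm m) x)) = scons (l0 m) x := swap_r x c2.
have t_0 x : bf (tV m) (scons (l0 m) x) = scons (lm m) x := swap_l x tp0.
have t_m x : bf (tV m) (scons (lm m) x) = scons (l0 m) x := swap_r x tp0.
have S_out i k x : k <> l0 m -> k <> lm m -> bf (swap [:: l0 m] [:: lm m; i]) (scons k x) = scons k x.
  by move=> k0 km; apply: swap_out => -[y e]; have [] := scons_inj e.
have S_m i k x : k <> i -> bf (swap [:: l0 m] [:: lm m; i]) (scons (lm m) (scons k x)) =
    scons (lm m) (scons k x).
  move=> ki; apply: swap_out => -[y e]; have [e1 e2] := scons_inj e; first exact: (nm0 (esym e1)).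
  by have [/ki] := scons_inj e2.
suff -> : lamC 0 = S1 ** S2 ** beta ** tV m.
  apply: NM; last exact: (N_swap_all tp0).
  apply: NM; first by apply: NM; apply: N_swap_all.
  rewrite /beta; elim: (enum _) => [|j l IH] //=.
  by apply: NM => //; apply: (N_swap_all (uv j j)).
apply: Bij_eq => z; rewrite !bfM -[z]scons_eta; move: (z 0) (stl z) => k y.
case: (k =P l0 m) => [->|k0].
  rewrite t_0 -[y]scons_eta; move: (y 0) (stl y) => i x.
  rewrite (lamC0_head i x).
  case: (i =P l0 m) => [->|i0].
    rewrite (b_out (scons (lm m) (scons (l0 m) x))); [|by right|by left].
    by rewrite S_m // S1_m0 comb0.
  case: (i =P lm m) => [->|im].
    rewrite (b_out (scons (lm m) (scons (lm m) x))); [|by right|by right].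
    rewrite S2_mm S1_0; have := @nseq_comb m m_gt0 1 0; rewrite mul1n addn0 comb0 /= => <-.
    by [].
  have [_ ->] := b_in i x (introN eqP i0) (introN eqP im).
  have lt : i < m.
    by rewrite ltn_neqAle -ltnS ltn_ord andbT; apply/eqP => e; apply: im; apply: val_inj.
  by rewrite comb_small // !S_out.
case: (k =P lm m) => [->|km].
  rewrite t_m (b_out (scons (l0 m) y)); [|by left|by move=> /nm0].
  rewrite S2_0 S_m; last by move=> e; apply: nm0.
  case: (excluded_middle_informative (y = pinf)) => [->|ny].
    by rewrite -!pinfE lamC_pinf.
  have [l [x ->]] := cover_comb m_gt0 ny.
  have := @nseq_comb m m_gt0 1 l; rewrite mul1n => el.
  rewrite -[scons _ (scat _ _)]/(scat (nseq 1 ord_max ++ comb l) x) el lamC0_comb; last by lia.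
  by rewrite -el.
have -> : bf (tV m) (scons k y) = scons k y.
  by apply: swap_out => -[t e]; have [] := scons_inj e.
have [-> _] := b_in k y (introN eqP k0) (introN eqP km).
have lt : k < m.
  by rewrite ltn_neqAle -ltnS ltn_ord andbT; apply/eqP => e; apply: km; apply: val_inj.
have kpos : 0 < k by rewrite lt0n; apply/eqP => e; apply: k0; apply: val_inj.
have := @lamC0_comb k y kpos; rewrite comb_small //= => ->.
by rewrite !S_m.
Qed.

Lemma N_lam j : N (lamC j).
Proof.
elim: j => [|j IH]; first exact: N_lam0.
have e := lam_block m_gt0 (split_base m_gt0 (fun g : K => g) (splitC K m_gt0)) j.
have -> : lamC j.+1 = evt tauC (iota j m.+1) ** lamC j ** (tauC j)^! by rewrite -e gmulK.
apply: NM; last by apply: NV; apply: N_tau.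
apply: NM => //; elim: (iota _ _) => [|k l IHl] //=.
by apply: NM => //; apply: N_tau.
Qed.

Notation kapn := (kapi tauC kapC).

Lemma kapn_inV j g : inV K (kapn j g).
Proof.
have := (rep_inA m_gt0 (evC_rep m_gt0 [:: Kap j g])).1.
by rewrite /= gmulr1.
Qed.

Lemma kapn_eqN j g : eqN (kapn j g) (kapC g).
Proof.
elim: j => [|j IH]; first exact: eqN_refl.
apply: eqN_trans IH; rewrite /eqN [kapn j.+1 g]/= -!gmulA.
apply: NM; first exact: N_tau.
by rewrite gmulA; apply: NJ; [apply: N_tau | apply: kapn_inV].
Qed.

Lemma kprod_inV B (l : nat -> K) : inV K (kprod tauC kapC B l).
Proof.
by elim: B => [|B IH] /=; [apply: inV1 | apply: inVM => //; apply: kapn_inV].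
Qed.

Lemma kprod_eqN B (l l' : nat -> K) : (forall j, j < B -> eqN (kapn j (l j)) (kapn j (l' j))) ->
  eqN (kprod tauC kapC B l) (kprod tauC kapC B l').
Proof.
elim: B => [|B IH] h /=; first exact: eqN_refl.
by apply: eqN_mul; [apply: kprod_inV | apply: IH => j hj; apply: h; lia | apply: h].
Qed.

(** Modulo [N] the splitting relation of [kapC g] loses its permutation part and both factors
    [lamC 0]. What is left is the product of the labels of the states. *)
Lemma kap_kprod g : exists B (l : nat -> K), [/\ m < B, eqN (kapC g) (kprod tauC kapC B l),
  forall i : letter, l i = ks g i & forall j, m < j -> l j = gone].
Proof.
have R := splitC K m_gt0.
have [w hw] := isexp_Kap0_ex m_gt0 g.
have [B0 hB0] := abnd_ex w.
pose B := maxn B0 m.+1.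
have hB : all (abnd B) w by apply: abnd_mono hB0; apply: leq_maxl.
exists B, (lb w); split.
- by rewrite leq_max leqnn orbT.
- have := sr_exp R hw; rewrite /= gmulr1 (ev_normal R hB) => e.
  set P := kprod _ _ _ _ in e *; set T := evt _ _ in e.
  have -> : kapC g = (lamC 0)^! ** T ** P ** lamC 0.
    by rewrite -!gmulA (gmulA T) -e !gE.
  have NT : N T by rewrite /T; elim: (taus w) => [|k l IHl] //=; apply: NM => //; apply: N_tau.
  have -> : eqN ((lamC 0)^! ** T ** P ** lamC 0) P =
      N ((lamC 0)^! ** T ** (P ** lamC 0 ** P^!)) by rewrite /eqN !gmulA.
  apply: NM; first by apply: NM => //; apply/NV/N_lam.
  by apply: NJ; [apply: N_lam | apply: kprod_inV].
- by move=> i; have [_ /(_ i) [_]] := hw; rewrite /= gmulr1 add0n.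
move=> j hj; have [/(_ (j - m)) h _] := hw; have [|_] := h; first by lia.
rewrite /dl /= (subnK (ltnW hj)) gmulr1 => ->; case: eqP => //; lia.
Qed.

Theorem N_kap : killing -> forall g, N (kapC g).
Proof.
have R := splitC K m_gt0.
have k1 j : kapn j gone = gone by apply: (hom1 (kapi_hom R j)).
have Nn j g : N (kapC g) -> N (kapn j g) by apply: N_eqN; apply: kapn_eqN.
move=> kill; apply: (kill (fun g => N (kapC g))).
- by rewrite (hom1 (lr_hom R)).
- by move=> g h ng nh; rewrite (lr_hom R); apply: NM.
(* All states except the one at [i] are trivial modulo [N], so [g] is congruent to that state. *)
- move=> g i others ng; have [B [l [mB e li lj]]] := kap_kprod g.
  have iB : i < B by apply: leq_trans mB.
  have := @kprod_mul _ _ _ _ _ R B (fun _ => gone) i (ks g i) iB.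
  rewrite (kprod1 R) // gmulr1 => ed.
  apply: (N_eqN _ ng); apply: eqN_trans (eqN_sym e); apply: eqN_trans (eqN_sym (kapn_eqN i _)) _.
  rewrite ed; apply: kprod_eqN => j hj; case: eqP => [->|ji].
    by rewrite gmulr1 li; apply: eqN_refl.
  rewrite k1; apply: eqN_sym; apply: eqN1; case: (ltnP j m.+1) => hjm; last first.
    by rewrite lj // k1.
  have := li (Ordinal hjm) => /= ->; apply: Nn; apply: others => e2.
  by apply: ji; rewrite -e2.
(* The state at [i'] is [g] itself and cancels against the left side, which leaves the state at
   [i]. *)
move=> g i i' ii' gi' others; have [B [l [mB e li lj]]] := kap_kprod g.
have iB : i < B by apply: leq_trans mB.
have iB' : i' < B by apply: leq_trans mB.
have := @kprod_mul _ _ _ _ _ R B (fun _ => gone) i' g iB'.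
rewrite (kprod1 R) // gmulr1 => ed'.
have := @kprod_mul _ _ _ _ _ R B (fun j => if j == i' then g ** gone else gone) i (ks g i) iB.
rewrite -ed' => ed.
have h1 : eqN (kapC g) (kapC (ks g i) ** kapC g).
  apply: (eqN_trans e); apply: (@eqN_trans _ (kapn i (ks g i) ** kapn i' g)); last first.
    apply: eqN_mul; [exact: kapn_inV 0 _ | exact: kapn_eqN | exact: kapn_eqN].
  rewrite ed; apply: kprod_eqN => j hj; case: eqP => [->|ji].
    rewrite li; case: eqP => [/ord_inj /ii' //|_]; rewrite gmulr1; exact: eqN_refl.
  case: eqP => [->|ji'].
    by rewrite li gi' gmulr1; apply: eqN_refl.
  rewrite k1; apply: eqN1; case: (ltnP j m.+1) => hjm; last by rewrite lj // k1.
  have := li (Ordinal hjm) => /= ->; apply: Nn; apply: others => e2.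
    by apply: ji; rewrite -e2.
  by apply: ji'; rewrite -e2.
by have := NV h1; rewrite !gE.
Qed.

Theorem N_full : killing -> forall c, inV K c -> N c.
Proof.
move=> kill.
have NA c : inA K c -> N c.
  move=> cA; have [|L1 [w [L2 [_ _ _ r]]]] := @rep_total m K m_gt0 0 c cA; first by [].
  rewrite (rep_val m_gt0 r) /repval.
  have NL L : N (evl lamC L) by elim: L => [|i L IH] //=; apply: NM => //; apply: N_lam.
  apply: NM => //; apply: NM; first exact: NV.
  elim: w {r} => [|a w IH] //=; apply: NM => //; case: a => [i|i g] /=; first exact: N_tau.
  by apply: (N_eqN (kapn_eqN i g)); apply: N_kap.
move=> c /(inV_form m_gt1) [/NA //|[a [d [/NA na /NA nd ->]]]].
apply: NM => //; apply: NM => //; exact: (N_swap_all (perp1 (l0m m_gt1))).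
Qed.

End Displaced.
End Normal.

Theorem simple_inV : killing -> simple_group (subgroup_group (sub_inV K)).
Proof.
move=> kill; split.
  exists (exist _ (tV m) (inV_swap K _ _)) => e0.
  have e : bf (tV m) pinf = pinf.
    exact: (f_equal (fun r : subgroup_group (sub_inV K) => bf (proj1_sig r) pinf) e0).
  by apply: (p_q m_gt1); rewrite -(tV_p m_gt1).
move=> N [N1 NM NV NJ].
case: (excluded_middle_informative (forall r, N r -> r = gone)) => [|nt]; first by left.
right.
have [[f fV] [fN fne]] : exists r, N r /\ r <> gone.
  by apply: NNPP => h; apply: nt => r nr; apply: NNPP => ne; apply: h; exists r.
pose N' (c : homeo) := exists h : inV K c, N (exist _ c h).
have N'P c (h : inV K c) : N' c -> N (exist _ c h).
  by move=> [h' nh]; rewrite (proof_irrelevance _ h h').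
pose sV := sub_inV K.
have N'1 : N' gone by exists (sg1 sV); exact: N1.
have N'M a b : N' a -> N' b -> N' (a ** b).
  by move=> [ha na] [hb nb]; exists (sgM sV ha hb); exact: (NM _ _ na nb).
have N'V a : N' a -> N' (a^!).
  by move=> [ha na]; exists (sgV sV ha); exact: (NV _ na).
have N'J a c : N' a -> inV K c -> N' (c ** a ** c^!).
  move=> [ha na] hc; have hc' := sgV sV hc.
  have := NJ _ (exist _ _ hc') na => n1.
  exists (sgM sV (sgM sV hc ha) hc').
  apply: (@eq_ind _ _ N n1); apply: sub_eq.
  by change (c^!^! ** a ** c^! = c ** a ** c^!); rewrite ginvK.
have fN' : N' f by exists fV.
have [x hx] : exists x, bf f x <> x.
  apply: NNPP => h; apply: fne; apply: sub_eq => /=; apply: Bij_eq => x.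
  by apply: NNPP => hx; apply: h; exists x.
have hx' : x <> bf f x by move=> e0; apply: hx.
have [n hn] := stake_sep hx'.
have [N0 h0] := fV.
(* The [n] extra letters make both the cone [u] around the moved point and its image prefix [v] long
   enough to be disjoint. *)
have [v [g [hv e]]] := good_ext_big (h0 (stake N0 x) (size_stake N0 x)) (size_stake n (sdrop N0 x)).
set u := stake N0 x ++ stake n (sdrop N0 x) in e.
have ux : x = scat u (sdrop n (sdrop N0 x)) by rewrite /u scat_cat !scat_stake.
have uE : u = stake (size u) x.
  by symmetry; apply/incone_stake; exists (sdrop n (sdrop N0 x)).
have vE : v = stake (size v) (bf f x).
  by symmetry; apply/incone_stake; eexists; rewrite {1}ux e.
have puv : perp u v.
  rewrite uE vE; apply: hn => //.
  by rewrite /u size_cat !size_stake leq_addl.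
have fu y y' : bf f (scat u y) <> scat u y'.
  by rewrite e => e2; apply: (puv y' (act g y)).
move=> [c cV]; apply: N'P.
exact: (N_full N'1 N'M N'V N'J fN' fu kill cV).
Qed.

End Simplicity.

(** * Doubling a self-similar group *)

Section Product.
Variable G : group.

Definition sq_mul (a b : G * G) := (a.1 ** b.1, a.2 ** b.2).
Definition sq_inv (a : G * G) := (a.1^!, a.2^!).
Lemma sq_mulA a b c : sq_mul a (sq_mul b c) = sq_mul (sq_mul a b) c.
Proof. by rewrite /sq_mul /= !gmulA. Qed.
Lemma sq_mul1 a : sq_mul (gone, gone) a = a.
Proof. by case: a => a b; rewrite /sq_mul /= !gmul1. Qed.
Lemma sq_mulV a : sq_mul (sq_inv a) a = (gone, gone).
Proof. by rewrite /sq_mul /= !gmulV. Qed.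
Definition square : group := Defs.Group sq_mulA sq_mul1 sq_mulV.

Lemma square_mulE (a b c d : G) : ((a, b) : square) ** (c, d) = (a ** c, b ** d).
Proof. by []. Qed.

Lemma fp_square : fp_on (fun _ : G => True) -> fp_on (fun _ : square => True).
Proof.
move=> [I [x [E [finE _ xg xE xu]]]].
pose x' (i : (I + I)%type) : square :=
  match i with inl i => (x i, gone) | inr i => (gone, x i) end.
pose E' (H : group) (y : (I + I)%type -> H) := E H (fun i => y (inl i)) /\
  E H (fun i => y (inr i)) /\ forall i j, tk (y (inl i)) (y (inr j)) (y (inr j)).
exists ((I + I)%type : finType), x', E'; split=> //.
- have [R eR] := finE; apply: fin_and.
    exists [seq [seq (inl p.1, p.2) | p <- r] | r <- R] => H y; rewrite eR; split.
      by move=> h _ /mapP [r hr ->]; rewrite evalw_map; apply: h.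
    by move=> h r hr; have := h _ (map_f _ hr); rewrite evalw_map.
  apply: fin_and.
    exists [seq [seq (inr p.1, p.2) | p <- r] | r <- R] => H y; rewrite eR; split.
      by move=> h _ /mapP [r hr ->]; rewrite evalw_map; apply: h.
    by move=> h r hr; have := h _ (map_f _ hr); rewrite evalw_map.
  apply: fin_fintype => i; apply: fin_fintype => j.
  by apply: fin_tk; apply: word_gen.
- move=> [a b] _; have [u hu] := xg a Logic.I; have [v hv] := xg b Logic.I.
  have -> : ((a, b) : square) = ((a, gone) : square) ** (gone, b).
    by rewrite square_mulE gmul1 gmulr1.
  apply: genM.
    exists [seq (inl p.1, p.2) | p <- u]; rewrite evalw_map -hu.
    by elim: u {hu} => [|[i []] u IH] //=; rewrite IH /= square_mulE ?gmul1 // ginv1 gmul1.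
  exists [seq (inr p.1, p.2) | p <- v]; rewrite evalw_map -hv.
  by elim: v {hv} => [|[i []] v IH] //=; rewrite IH /= square_mulE ?gmul1 // ginv1 gmul1.
- have [R eR] := finE; split; last split.
  + apply/eR => r hr.
    have -> : evalw (fun i => x' (inl i)) r = (evalw x r, gone).
      by elim: r {hr} => [|[i []] u IH] //=; rewrite IH /= square_mulE ?gmul1 // ginv1 gmul1.
    by rewrite (proj1 (eR G x) xE r hr).
  + apply/eR => r hr.
    have -> : evalw (fun i => x' (inr i)) r = (gone, evalw x r).
      by elim: r {hr} => [|[i []] u IH] //=; rewrite IH /= square_mulE ?gmul1 // ginv1 gmul1.
    by rewrite (proj1 (eR G x) xE r hr).
  by move=> i j; rewrite /tk /= !square_mulE !gmul1 !gmulr1.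
move=> H y [y1 [y2 y3]].
have [p1 [p1M p1x]] := xu H _ y1; have [p2 [p2M p2x]] := xu H _ y2.
have h1 : is_hom p1 by move=> a b; apply: p1M.
have h2 : is_hom p2 by move=> a b; apply: p2M.
have c a b : tk (p1 a) (p2 b) (p2 b).
  apply: (@gen_ind _ _ x (fun a => tk (p1 a) (p2 b) (p2 b)) _ _ _ _ a (xg a Logic.I)).
  - by rewrite (hom1 h1) /tk !gE.
  - by move=> u v hu hv; rewrite h1; apply: (tk_comp hv hu).
  - by move=> u hu; rewrite (homV h1); apply: tk_sym.
  move=> i.
  apply: (@gen_ind _ _ x (fun b => tk (p1 (x i)) (p2 b) (p2 b)) _ _ _ _ b (xg b Logic.I)).
  - by rewrite (hom1 h2); apply: tk1.
  - by move=> u v hu hv; rewrite h2; apply: tkM.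
  - by move=> u hu; rewrite (homV h2); apply: tkV.
  by move=> j; rewrite p1x p2x; apply: y3.
exists (fun a => p1 a.1 ** p2 a.2); split.
  move=> [a b] [a' b'] _ _; rewrite square_mulE /= h1 h2.
  by rewrite !gmulA -(gmulA (p1 a) (p1 a')) c !gmulA.
by case=> i /=; rewrite ?(hom1 h1) ?(hom1 h2) ?p1x ?p2x !gE.
Qed.

End Product.

Section Doubling.
Variables (d : nat) (G : Aut_T d -> Prop) (sG : is_subgroup G) (ssG : self_similar G).
Notation SG := (subgroup_group sG).
Notation aw g := (afun (proj1_sig (g : SG))).

Lemma state_ex (g : SG) (i : 'I_d) : exists hj : SG * 'I_d,
  forall w, aw g (i :: w) = hj.2 :: aw hj.1 w.
Proof.
case: g => g hg; have [gi [j [hgi e]]] := ssG hg i.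
by exists (exist _ gi hgi, j).
Qed.

Definition st g i : SG := (proj1_sig (constructive_indefinite_description _ (state_ex g i))).1.
Definition pm g i : 'I_d := (proj1_sig (constructive_indefinite_description _ (state_ex g i))).2.

Lemma stP g i w : aw g (i :: w) = pm g i :: aw (st g i) w.
Proof. by rewrite /st /pm; case: constructive_indefinite_description. Qed.

Lemma SG_eq (g h : SG) : (forall w, aw g w = aw h w) -> g = h.
Proof. by move=> e; apply: sub_eq; apply: aut_eq. Qed.

Lemma st_uniq g i j h : (forall w, aw g (i :: w) = j :: aw h w) -> pm g i = j /\ st g i = h.
Proof.
move=> e; split; first by have := e [::]; rewrite stP => -[].
by apply: SG_eq => w; have := e w; rewrite stP => -[].
Qed.

Lemma aw_mul (g h : SG) w : aw (g ** h) w = aw g (aw h w).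
Proof. by []. Qed.

Lemma stM g h i : pm (g ** h) i = pm g (pm h i) /\ st (g ** h) i = st g (pm h i) ** st h i.
Proof. by apply: st_uniq => w; rewrite !aw_mul !stP. Qed.

Lemma st1 i : pm gone i = i /\ st gone i = gone.
Proof. by apply: st_uniq. Qed.

Lemma aw_nil g : aw g [::] = [::].
Proof.
case e : (aw g [::]) => [//|i w].
have : aw (g^! ** g) [::] = [::] by rewrite gmulV.
by rewrite aw_mul e stP.
Qed.

(** There are [dm.+1] letters: the [d] old ones, three that move coordinates, the fixed last one,
    and a spare one if [d] is odd. Hence [dm] is odd. *)
Definition dm := d + 3 + odd d.
Notation letter := 'I_dm.+1.

Lemma d_le : d <= dm.+1.
Proof. rewrite /dm; lia. Qed.

Definition wid (i : 'I_d) : letter := widen_ord d_le i.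
Definition cl (k : letter) : option 'I_d := insub (val k).

Lemma clP k : (exists2 i, k = wid i & cl k = Some i) \/ (d <= k /\ cl k = None).
Proof.
rewrite /cl; case: insubP => [i hi e|hk]; last by right; rewrite leqNgt hk.
by left; exists i => //; apply: val_inj; rewrite /= -e.
Qed.

Lemma cl_wid i : cl (wid i) = Some i.
Proof. by rewrite /cl /= valK. Qed.

Notation K2 := (square SG).

Definition kp2 (x : K2) (k : letter) : letter := if cl k is Some i then wid (pm x.1 i) else k.
(* The letters d, d+1 and d+2 move the coordinates around: they force the images of both
   copies of G to vanish in every proper quotient. *)
Definition ks2 (x : K2) (k : letter) : K2 :=
  if cl k is Some i then (st x.1 i, gone)
  else if val k == d then (gone, x.1)
  else if val k == d.+1 then (x.2, gone)
  else if val k == d.+2 then (gone, x.2) else (gone, gone).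

Lemma kp2_1 k : kp2 gone k = k.
Proof. by rewrite /kp2; case: (clP k) => [[i -> ->]|[_ ->]] //; rewrite (st1 i).1. Qed.

Lemma ks2_1 k : ks2 gone k = gone.
Proof.
rewrite /ks2; case: (clP k) => [[i -> ->]|[_ ->]]; first by rewrite (st1 i).2.
by do !case: ifP.
Qed.

Lemma kp2M g h k : kp2 (g ** h) k = kp2 g (kp2 h k).
Proof.
rewrite /kp2; case: (clP k) => [[i _ ->]|[_ e]]; last by rewrite e e.
by rewrite cl_wid (stM _ _ _).1.
Qed.

Lemma ks2M g h k : ks2 (g ** h) k = ks2 g (kp2 h k) ** ks2 h k.
Proof.
rewrite /ks2 /kp2; case: (clP k) => [[i _ ->]|[_ e]].
  by rewrite cl_wid square_mulE gmul1 (stM _ _ _).2.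
rewrite !e; do !case: ifP => _; rewrite ?square_mulE ?gmul1 //.
Qed.

Lemma cl_last : cl ord_max = None.
Proof. by case: (clP ord_max) => [[i e _]|[]] //; have := ltn_ord i; rewrite -[nat_of_ord i]/(val (wid i)) -e /= /dm; lia. Qed.

Lemma kp2_last g : kp2 g ord_max = ord_max.
Proof. by rewrite /kp2 cl_last. Qed.

Lemma ks2_last g : ks2 g ord_max = gone.
Proof. by rewrite /ks2 cl_last /= /dm; do !case: eqP => //; lia. Qed.

(** The first coordinate is visible on words over the old letters, below which the states keep the
    form (st g i, 1). *)
Lemma kp2_faithful1 (g h : SG) : (forall u, actw kp2 ks2 ((g, h) : K2) u = u) -> g = gone.
Proof.
move=> e; apply: SG_eq => w; elim: w g h e => [|i w IH] g h e; first by rewrite !aw_nil.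
have e1 u : wid (pm g i) = wid i /\ actw kp2 ks2 ((st g i, gone) : K2) u = u.
  by have := e (wid i :: u); rewrite /= {1}/kp2 {2}/ks2 cl_wid => /eqP; rewrite eqseq_cons => /andP [/eqP -> /eqP ->].
rewrite stP (IH (st g i) gone); last by move=> u; have [] := e1 u.
have [ew _] := e1 [::].
by have -> : pm g i = i by apply: val_inj; exact: (f_equal val ew).
Qed.

Lemma kp2_faithful (x : K2) : (forall u, actw kp2 ks2 x u = u) -> x = gone.
Proof.
case: x => g h e; have g1 := kp2_faithful1 e; subst g; congr (_, _).
(* The second coordinate becomes visible below the letter d + 1, where the state is (h, 1). *)
have hk : d.+1 < dm.+1 by rewrite /dm; lia.
apply: (@kp2_faithful1 h gone) => u.
have := e (Ordinal hk :: u); rewrite /= {2}/ks2.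
case: (clP (Ordinal hk)) => [[i ei _]|[_ ->]]; last by rewrite /= eqxx; case: eqP => [|_ []]; first lia.
have := ltn_ord i; rewrite -[nat_of_ord i]/(val (wid i)) -ei /=; lia.
Qed.

Definition double : selfsim dm :=
  SelfSim kp2_1 ks2_1 kp2M ks2M kp2_last ks2_last kp2_faithful.

Lemma killing_double : killing double.
Proof.
move=> Z Z1 ZM r1 r2.
have cN k : d <= k -> forall hk : k < dm.+1, cl (Ordinal hk) = None.
  move=> dk hk; case: (clP (Ordinal hk)) => [[i e _]|[]] //.
  by have := ltn_ord i; rewrite -[nat_of_ord i]/(val (wid i)) -e /=; lia.
have hd0 : d < dm.+1 by rewrite /dm; lia.
have hd1 : d.+1 < dm.+1 by rewrite /dm; lia.
have hd2 : d.+2 < dm.+1 by rewrite /dm; lia.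
have k0 x : ks2 x (Ordinal hd0) = (gone, x.1) by rewrite /ks2 cN //=; casel.
have k1 x : ks2 x (Ordinal hd1) = (x.2, gone).
  by rewrite /ks2 cN //=; casel.
have k2 x : ks2 x (Ordinal hd2) = (gone, x.2).
  by rewrite /ks2 cN //=; casel.
(* The element (1, h) has itself as state at d + 2 and (h, 1) at d + 1; its other states are
   trivial. *)
have Za h : Z ((h, gone) : K2).
  have := r2 ((gone, h) : K2) (Ordinal hd1) (Ordinal hd2); rewrite /= k1 k2; apply=> //.
    by move=> /(f_equal val) /=; lia.
  move=> j j1 j2; rewrite /ks2; case: (clP j) => [[i _ ->]|[_ ->]] /=.
    by rewrite (st1 i).2.
  case: eqP => // _; case: eqP => [e|_]; first by case: j1; apply: val_inj.
  by case: eqP => [e|_] //; case: j2; apply: val_inj.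
(* Every state of (g, 1) other than (1, g) at the letter d is of the form covered by [Za]. *)
have Zb g : Z ((gone, g) : K2).
  have := r1 ((g, gone) : K2) (Ordinal hd0); rewrite /= k0; apply=> // j j0.
  rewrite /ks2; case: (clP j) => [[i _ ->]|[_ ->]] //=.
  case: eqP => [e|_]; first by case: j0; apply: val_inj.
  by do !case: eqP.
move=> [g h]; have := ZM _ _ (Za g) (Zb h).
by rewrite square_mulE gmul1 gmulr1.
Qed.

End Doubling.

Theorem theorem1p1 (d : nat) (hd : 2 <= d) (G : Aut_T d -> Prop)
    (sG : is_subgroup G) (ssG : self_similar G) :
  finitely_presented (subgroup_group sG) -> boone_higman (subgroup_group sG).
Proof.
move=> fpG; pose K := double sG ssG.
have m_gt2 : 2 < dm d by rewrite /dm; lia.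
have m_odd : odd (dm d) by rewrite /dm; lia.
have m_gt1 := ltnW m_gt2; have m_gt0 := ltnW m_gt1.
have fpK : fp_on (fun _ : K => True) by apply: fp_square; apply: fp_on_of_fp.
have kV (g : K) : inV K (@kapC (dm d) K m_gt0 g).
  exact: (rep_inA m_gt0 (repCP m_gt0 _ _ _)).1.
pose emb (g : subgroup_group sG) : K := (g, gone).
exists (subgroup_group (sub_inV K)), (fun g => exist _ _ (kV (emb g))); split; [|split; [|split]].
- exact: (fp_of_fp_on (sub_inV K) (fp_inV m_gt1 fpK)).
- exact: (simple_inV m_gt2 m_odd (killing_double (ssG := ssG))).
- move=> a b; apply: sub_eq.
  change (kapC m_gt0 (emb (a ** b)) = kapC m_gt0 (emb a) ** kapC m_gt0 (emb b)).
  rewrite -(lr_hom (splitC K m_gt0)); congr (kapC _ _).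
  by rewrite /emb; change (((a ** b, gone) : square (subgroup_group sG)) = (a ** b, gone ** gone)); rewrite gmul1.
move=> a b /(f_equal (fun r => proj1_sig r)) /= e.
(* Both images act on the cone [comb 0] by their labels, and a label is determined by its action. *)
have [_] : comb (dm d) 0 = comb (dm d) 0 /\ emb a = emb b.
  apply: (scat_act_inj m_gt0) => x.
  have := @kapC_maps (dm d) K m_gt0 (emb a) 0 x; rewrite e (@kapC_maps (dm d) K m_gt0 (emb b) 0 x).
  by rewrite /= !gmulr1.
by case.
Qed.
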